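(* Let $(R,\mathfrak{m}_R,k)$, $(S,\mathfrak{m}_S,k)$ and $(T,\mathfrak{m}_T,k)$ be local rings with the same residue field $k$, where $R$ and $S$ have the same prime characteristic $p>0$, and let $\epsilon_R:R\to T$ and $\epsilon_S:S\to T$ be surjective ring homomorphisms. Assume $\dim R>0$. Let $\mathfrak{m}$ be the maximal ideal of $P=R\times_T S$, let $I$ and $J$ be $\mathfrak{m}$-primary ideals of $P$, and let $s>0$ be a real number. Regard $R$, $S$, $T$ as $P$-modules. Then: (i) if $\dim(R)=\dim(S)=\dim(T)$, then $e_s(I,J;R\times_T S)=e_s(I,J;R)+e_s(I,J;S)-e_s(I,J;T)$; (ii) if $\dim(R)=\dim(S)>\dim(T)$, then $e_s(I,J;R\times_T S)=e_s(I,J;R)+e_s(I,J;S)$; (iii) if $\dim(R)>\dim(S)>\dim(T)$, then $e_s(I,J;R\times_T S)=e_s(I,J;R)$. Here all $s$-multiplicities are taken over the local ring $P$.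
   Context: All rings are commutative, Noetherian, local, with identity. The fiber product is $R\times_T S=\{(r,s)\in R\times S:\epsilon_R(r)=\epsilon_S(s)\}$; it is a Noetherian local ring with maximal ideal $\mathfrak{m}=\mathfrak{m}_R\times_{\mathfrak{m}_T}\mathfrak{m}_S$ and residue field $k$, of characteristic $p$, with $\dim(R\times_T S)=\max\{\dim R,\dim S\}$. It acts on $R$ and $S$ via the two projections and on $T$ via the common composite $R\times_T S\to T$. $s$-multiplicity: let $(A,\mathfrak{n})$ be a local ring of prime characteristic $p>0$ and dimension $d>0$, let $I,J$ be $\mathfrak{n}$-primary ideals, $N$ a finitely generated $A$-module, $s>0$ real. Put $$h_s(I,J;N)=\lim_{e\to\infty}\frac{\ell_A\big(N/(I^{\lceil sp^e\rceil}+J^{[p^e]})N\big)}{p^{ed}},\qquad d=\dim A,$$ where $\ell_A$ is length and $J^{[p^e]}$ is the ideal generated by the $p^e$-th powers of elements of $J$ (the limit is known to exist), and $$e_s(I,J;N)=\frac{h_s(I,J;N)}{\mathcal{H}_s(d)},\qquad \mathcal{H}_s(d)=\sum_{i=0}^{\lfloor s\rfloor}\frac{(-1)^i}{d!}\binom{d}{i}(s-i)^d .$$ *)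

(* Defs.v *)
From HB Require Import structures.
From mathcomp Require Import all_boot all_order all_algebra.
From mathcomp Require Import all_classical all_reals all_analysis.

Set Implicit Arguments.
Unset Strict Implicit.
Unset Printing Implicit Defensive.

Import Order.TTheory GRing.Theory Num.Theory.
Import numFieldNormedType.Exports.

Local Open Scope classical_set_scope.
Local Open Scope ring_scope.
Local Open Scope quotient_scope.

(* The greatest element of E; by convention 0 if E is empty or unbounded. *)
Definition nat_sup (E : set nat) : nat :=
  xget 0%N [set n | E n /\ forall m, E m -> (m <= n)%N].

Section Submodules.
Variables (A : comNzRingType) (N : lmodType A).

Definition is_submod (L : set N) : Prop :=
  [/\ L 0, forall x y, L x -> L y -> L (x + y)
    & forall (a : A) x, L x -> L (a *: x)].

Definition span (X : set N) : set N := smallest is_submod X.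

Lemma span_submod (X : set N) : is_submod (span X).
Proof.
split=> [L [[]]//|x y xX yX L LX|a x xX L LX].
- by have [[_ LD _] _] := LX; apply: LD; [exact: xX | exact: yX].
- by have [[_ _ LZ] _] := LX; apply: LZ; exact: xX.
Qed.

Definition spanb (X : set N) : pred N := fun x => `[< span X x >].

Lemma spanb_closed (X : set N) : GRing.subsemimod_closed (spanb X).
Proof.
have [X0 XD XZ] := span_submod X; split; [split|].
- exact/asboolP.
- by move=> x y /asboolP xX /asboolP yX; apply/asboolP; exact: XD.
- by move=> a x /asboolP xX; apply/asboolP; exact: XZ.
Qed.

HB.instance Definition _ (X : set N) :=
  GRing.isSubmodClosed.Build A N (spanb X) (spanb_closed X).

End Submodules.

Section QuotientModule.
Variables (A : comNzRingType) (N : lmodType A) (X : set N).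

Let L : zmodClosed N := GRing.ZmodClosed.clone N (spanb X) _.

(* N / <X>, where <X> is the submodule generated by X *)
Definition quot_mod : Type := Quotient.quot L.

HB.instance Definition _ := GRing.Zmodule.on quot_mod.

Let pr (x : N) : quot_mod := \pi_(Quotient.quot L) x.

Definition quot_scale (a : A) (v : quot_mod) : quot_mod :=
  pr (a *: repr (v : Quotient.quot L)).

Let pr_eq (x y : N) : x - y \in L -> pr x = pr y.
Proof. by move=> xyL; apply/eqP; rewrite /pr -Quotient.idealrBE. Qed.

Let LZ (a : A) (x : N) : x \in L -> a *: x \in L.
Proof.
by move=> /asboolP xX; apply/asboolP; have [_ _ SZ] := span_submod X; exact: SZ.
Qed.

Let prK (v : quot_mod) : pr (repr (v : Quotient.quot L)) = v.
Proof. exact: reprK. Qed.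

Let prD (x y : N) : pr (x + y) = pr x + pr y.
Proof. exact: (raddfD \pi_(Quotient.quot L)). Qed.

Lemma quot_scaleE (a : A) (x : N) : quot_scale a (pr x) = pr (a *: x).
Proof.
apply: pr_eq; rewrite -scalerBr; apply: LZ; rewrite Quotient.idealrBE; apply/eqP.
exact: reprK.
Qed.

Let quot_ind (P : quot_mod -> Prop) : (forall x, P (pr x)) -> forall v, P v.
Proof. by move=> Ppr v; rewrite -(prK v). Qed.

Let quot_scaleA (a b : A) v :
  quot_scale a (quot_scale b v) = quot_scale (a * b) v.
Proof. by elim/quot_ind: v => x; rewrite !quot_scaleE scalerA. Qed.

Let quot_scale1 : left_id 1 quot_scale.
Proof. by elim/quot_ind => x; rewrite quot_scaleE scale1r. Qed.

Let quot_scaleDr : right_distributive quot_scale +%R.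
Proof.
move=> a; elim/quot_ind => x; elim/quot_ind => y.
by rewrite -prD !quot_scaleE scalerDr prD.
Qed.

Let quot_scaleDl v : {morph quot_scale^~ v : a b / a + b}.
Proof. by elim/quot_ind: v => x a b; rewrite !quot_scaleE scalerDl prD. Qed.

HB.instance Definition _ := GRing.Zmodule_isLmodule.Build A quot_mod
  quot_scaleA quot_scale1 quot_scaleDr quot_scaleDl.

End QuotientModule.

(* The largest n for which there is a strict chain L_0 < ... < L_n of submodules
   of M. The value 0 for modules of infinite length is never reached below: the
   modules N / (I^a + J^[q])N have finite length when I and J are m-primary and
   N is finitely generated. *)
Definition length (A : comNzRingType) (M : lmodType A) : nat :=
  nat_sup [set n | exists c : nat -> set M,
    (forall i, (i <= n)%N -> is_submod (c i)) /\
    (forall i, (i < n)%N -> c i `<` c i.+1)].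

Section Ideals.
Variable A : comNzRingType.

Definition is_ideal (I : set A) : Prop := @is_submod A A^o I.

Definition ideal_gen (X : set A) : set A := @span A A^o X.

Definition noetherian : Prop :=
  forall I : set A, is_ideal I -> exists s : seq A, I = ideal_gen [set` s].

Definition maximal_ideal (I : set A) : Prop :=
  [/\ is_ideal I, ~ I 1
    & forall J, is_ideal J -> I `<=` J -> J = I \/ J = setT].

Definition prime_ideal (I : set A) : Prop :=
  [/\ is_ideal I, ~ I 1 & forall x y, I (x * y) -> I x \/ I y].

Definition radical (I : set A) : set A := [set x | exists n, I (x ^+ n)].

Definition primary_ideal (I : set A) : Prop :=
  [/\ is_ideal I, ~ I 1 & forall x y, I (x * y) -> I x \/ radical I y].

Definition is_primary_to (m I : set A) : Prop :=
  primary_ideal I /\ radical I = m.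

(* (A, m, k) is a Noetherian local ring: m is the only maximal ideal of A, and
   k is (isomorphic to) A / m. *)
Definition local_ring (m : set A) (k : fieldType) : Prop :=
  [/\ noetherian, maximal_ideal m,
      forall m', maximal_ideal m' -> m' = m
    & exists f : {rmorphism A -> k},
        (forall y, exists x, f x = y) /\ m = [set x | f x = 0]].

(* The largest length of a chain of primes; it is finite for a Noetherian local
   ring, so the default value 0 plays no role here. *)
Definition krull_dim : nat :=
  nat_sup [set n | exists c : nat -> set A,
    (forall i, (i <= n)%N -> prime_ideal (c i)) /\
    (forall i, (i < n)%N -> c i `<` c i.+1)].

Definition ideal_add (I J : set A) : set A :=
  [set z | exists x y, [/\ I x, J y & z = x + y]].

Definition ideal_pow (I : set A) (n : nat) : set A :=
  ideal_gen [set z | exists x : 'I_n -> A,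
    (forall i, I (x i)) /\ z = \prod_(i < n) x i].

(* I^[q] *)
Definition frobenius_pow (I : set A) (q : nat) : set A :=
  ideal_gen [set z | exists2 x, I x & z = x ^+ q].

(* generators of the submodule I N of N *)
Definition ideal_act (N : lmodType A) (I : set A) : set N :=
  [set z | exists (a : A) (x : N), I a /\ z = a *: x].

End Ideals.

(* R regarded as a P-module via the ring homomorphism f : P -> R *)
Definition restr (P R : comNzRingType) (f : {rmorphism P -> R}) : Type := R.

Section RestrictionOfScalars.
Variables (P R : comNzRingType) (f : {rmorphism P -> R}).

HB.instance Definition _ := GRing.Zmodule.copy (restr f) R.

Definition restr_scale (a : P) (x : restr f) : restr f := f a * (x : R).

Let restr_scaleA a b x :
  restr_scale a (restr_scale b x) = restr_scale (a * b) x.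
Proof. by rewrite /restr_scale rmorphM mulrA. Qed.

Let restr_scale1 : left_id 1 restr_scale.
Proof. by move=> x; rewrite /restr_scale rmorph1 mul1r. Qed.

Let restr_scaleDr : right_distributive restr_scale +%R.
Proof. by move=> a x y; exact: mulrDr. Qed.

Let restr_scaleDl x : {morph restr_scale^~ x : a b / a + b}.
Proof. by move=> a b; rewrite /restr_scale rmorphD; exact: mulrDl. Qed.

HB.instance Definition _ := GRing.Zmodule_isLmodule.Build P (restr f)
  restr_scaleA restr_scale1 restr_scaleDr restr_scaleDl.

End RestrictionOfScalars.

Section FiberProduct.
Variables (R S T : comNzRingType).
Variables (eR : {rmorphism R -> T}) (eS : {rmorphism S -> T}).

Definition fiber_pred : pred (R * S)%type := fun u => eR u.1 == eS u.2.

Lemma fiber_pred_closed : subring_closed fiber_pred.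
Proof.
split=> [|u v /eqP uE /eqP vE|u v /eqP uE /eqP vE]; apply/eqP => /=.
- by rewrite !rmorph1.
- by rewrite !rmorphB uE vE.
- by rewrite !rmorphM uE vE.
Qed.

HB.instance Definition _ :=
  GRing.isSubringClosed.Build (R * S)%type fiber_pred fiber_pred_closed.

Record fiber_prod := FiberProd {
  fiber_val :> (R * S)%type;
  fiber_valP : fiber_val \in fiber_pred
}.

HB.instance Definition _ := [isSub for fiber_val].
HB.instance Definition _ := [Choice of fiber_prod by <:].
HB.instance Definition _ := [SubChoice_isSubComNzRing of fiber_prod by <:].

Definition fiber_fst (u : fiber_prod) : R := (val u).1.
Definition fiber_snd (u : fiber_prod) : S := (val u).2.

Let fiber_fst_zmod : zmod_morphism fiber_fst.
Proof. by move=> u v; rewrite /fiber_fst rmorphB. Qed.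
Let fiber_fst_monoid : monoid_morphism fiber_fst.
Proof. by split=> [|u v]; rewrite /fiber_fst ?rmorph1 ?rmorphM. Qed.
HB.instance Definition _ :=
  GRing.isZmodMorphism.Build fiber_prod R fiber_fst fiber_fst_zmod.
HB.instance Definition _ :=
  GRing.isMonoidMorphism.Build fiber_prod R fiber_fst fiber_fst_monoid.

Let fiber_snd_zmod : zmod_morphism fiber_snd.
Proof. by move=> u v; rewrite /fiber_snd rmorphB. Qed.
Let fiber_snd_monoid : monoid_morphism fiber_snd.
Proof. by split=> [|u v]; rewrite /fiber_snd ?rmorph1 ?rmorphM. Qed.
HB.instance Definition _ :=
  GRing.isZmodMorphism.Build fiber_prod S fiber_snd fiber_snd_zmod.
HB.instance Definition _ :=
  GRing.isMonoidMorphism.Build fiber_prod S fiber_snd fiber_snd_monoid.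

(* the ideal mR x_{mT} mS of the fiber product *)
Definition fiber_max (mR : set R) (mS : set S) : set fiber_prod :=
  [set u | mR (fiber_fst u) /\ mS (fiber_snd u)].

(* R, S and T as modules over the fiber product; the structure on T does not
   depend on the side chosen, see [fiber_prod_comm]. *)
Definition modR : lmodType fiber_prod := restr fiber_fst.
Definition modS : lmodType fiber_prod := restr fiber_snd.
Definition modT : lmodType fiber_prod := restr (eR \o fiber_fst).

Lemma fiber_prod_comm (u : fiber_prod) : eR (fiber_fst u) = eS (fiber_snd u).
Proof. exact: (eqP (fiber_valP u)). Qed.

End FiberProduct.

Section SMultiplicity.
Variables (K : realType) (A : comNzRingType) (p : nat).

Definition s_ideal (I J : set A) (s : K) (e : nat) : set A :=
  ideal_add (ideal_pow I `|Num.ceil (s * (p ^ e)%:R)|%N)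
            (frobenius_pow J (p ^ e)).

Definition s_length (I J : set A) (N : lmodType A) (s : K) (e : nat) : nat :=
  length (quot_mod (@ideal_act A N (s_ideal I J s e))).

Definition h_mult (I J : set A) (N : lmodType A) (s : K) : K :=
  lim ((fun e : nat =>
    (s_length I J N s e)%:R / (p ^ (e * krull_dim A))%:R : K) @ \oo).

(* Num.truncn is the floor function on nonnegative numbers. *)
Definition H_norm (s : K) (d : nat) : K :=
  \sum_(0 <= i < (Num.truncn s).+1)
    (-1) ^+ i / d`!%:R * 'C(d, i)%:R * (s - i%:R) ^+ d.

Definition e_mult (I J : set A) (N : lmodType A) (s : K) : K :=
  h_mult I J N s / H_norm s (krull_dim A).

End SMultiplicity.

(* Main.v *)
(* Let d = dim R and I_e = I^{ceil(s p^e)} + J^{[p^e]}, and write a_e for the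
   image of I_e in each of R, S and T. From the exact sequence
   0 -> P -> R x S -> T -> 0 and the modular law,
     l(R/I_e R) + l(S/I_e S) <= l(P/I_e) + l(T/I_e T),
     l(P/I_e) <= l(R/I_e R) + l(L / a_e L),    L = ker (S -> T).
   Hence the theorem follows once, for A = R, S, T (local rings of
   characteristic p with dim A <= d), the sequence l(A/a_e) / p^{ed} converges and
   l(L / a_e L) + l(A / (L + a_e)) <= l(A/a_e) + O(p^{e(d-1)}) for every ideal L;
   the limit is 0 when dim A < d, by a system of parameters.

   Both are proved after completion, where A is a finite module over
   D = k[[x_1, ..., x_d]]. Let C_e be the D-subalgebra of A generated by the
   p^e-th powers. For e0 large the rank of C = C_{e0} is minimal, which makes C
   generically a product of fields: up to D-torsion each ideal of C is generated
   by an idempotent. Torsion only contributes O(p^{e(d-1)}). So each C-module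
   of finite type is, up to this error, filtered by quotients C / K that
   split off C, and l(C / (K + b_e)) / p^{ed} is almost decreasing, where b_e is
   the ideal of C generated by the p^{e0}-th powers of elements of a_e; A is one
   such module, and b_e A differs from a_{e+e0} by a bounded power of the
   maximal ideal. *)
Require Import Defs.
From HB Require Import structures.
From mathcomp Require Import all_boot all_order all_algebra.
From mathcomp Require Import all_classical all_reals all_analysis.
From mathcomp Require Import ring lra zify.

Set Implicit Arguments.
Unset Strict Implicit.
Unset Printing Implicit Defensive.

Import Order.TTheory GRing.Theory Num.Theory.
Local Open Scope classical_set_scope.
Local Open Scope ring_scope.
Local Open Scope quotient_scope.

(** * Length through chains of submodules *)

(** The residue field k is arbitrary of characteristic p, so A need not be finite over its subring
    of p^e-th powers, and lengths cannot be compared by pushing A forward along Frobenius. The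
    algebra C_e is the substitute: it contains the image of D, is finite over D, and its p-th powers
    span C_{e+1}. Frobenius never increases rank, and at minimal rank it creates no torsion: if z^p
    were torsion and z not, completing z to a generic basis of C would show that the next algebra
    has smaller rank. So nilpotents of C are torsion, which gives the product of fields; minimality
    likewise makes the quotient of C by the next algebra torsion. The almost decreasing sequence
    comes from Frobenius too: a simple step, generated by y and killed by the x_i, becomes a step
    generated by y^p and killed by the x_i^p, of length at most p^d. This one-sided bound suffices,
    because the scaled lengths are bounded below. Along a filtration lengths modulo b_e are only
    subadditive in general. The idempotents split each step up to a denominator and thereby give
    additivity up to the error term; this yields both the convergence and the inequality for L. *)

Section Submodule.
Variables (A : comNzRingType) (N : lmodType A).
Implicit Types (L U M : set N) (x y z : N).

Lemma submod0 L : is_submod L -> L 0. Proof. by case. Qed.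
Lemma submodD L x y : is_submod L -> L x -> L y -> L (x + y).
Proof. by case=> _ + _; apply. Qed.
Lemma submodZ L a x : is_submod L -> L x -> L (a *: x).
Proof. by case=> _ _; apply. Qed.
Lemma submodN L x : is_submod L -> L x -> L (- x).
Proof. by move=> hL Lx; rewrite -scaleN1r; apply: submodZ. Qed.
Lemma submodB L x y : is_submod L -> L x -> L y -> L (x - y).
Proof. by move=> hL Lx Ly; apply: submodD => //; apply: submodN. Qed.
Lemma submod_sum L I (r : seq I) (P : pred I) (F : I -> N) : is_submod L ->
  (forall i, P i -> L (F i)) -> L (\sum_(i <- r | P i) F i).
Proof.
move=> hL hF; elim/big_ind: _ => //; first exact: submod0.
by move=> x y; apply: submodD.
Qed.
Lemma submodT : is_submod [set: N].
Proof. by []. Qed.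
Lemma submod_zero : is_submod [set 0 : N].
Proof.
split=> //= [x y -> ->|a x ->]; first by rewrite addr0.
by rewrite scaler0.
Qed.
Lemma submodI L M : is_submod L -> is_submod M -> is_submod (L `&` M).
Proof.
move=> hL hM; split=> [|x y [? ?] [? ?]|a x [? ?]].
- by split; apply: submod0.
- by split; apply: submodD.
- by split; apply: submodZ.
Qed.

Definition sum_set L M : set N := [set z | exists x y, [/\ L x, M y & z = x + y]].

Lemma sum_submod L M : is_submod L -> is_submod M -> is_submod (sum_set L M).
Proof.
move=> hL hM; split.
- by exists 0, 0; rewrite addr0; split=> //; apply: submod0.
- move=> _ _ [x1 [y1 [Lx1 My1 ->]]] [x2 [y2 [Lx2 My2 ->]]].
  by exists (x1 + x2), (y1 + y2); rewrite addrACA; split=> //; apply: submodD.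
- move=> a _ [x [y [Lx My ->]]]; exists (a *: x), (a *: y).
  by rewrite scalerDr; split=> //; apply: submodZ.
Qed.
Lemma sum_subl L M : is_submod M -> L `<=` sum_set L M.
Proof. by move=> hM x Lx; exists x, 0; rewrite addr0; split=> //; apply: submod0. Qed.
Lemma sum_subr L M : is_submod L -> M `<=` sum_set L M.
Proof. by move=> hM x Lx; exists 0, x; rewrite add0r; split=> //; apply: submod0. Qed.
Lemma sum_min L M U : is_submod U -> L `<=` U -> M `<=` U -> sum_set L M `<=` U.
Proof. by move=> hU LU MU _ [x [y [Lx My ->]]]; apply: submodD; auto. Qed.
Lemma sum_mono L M L' M' : L `<=` L' -> M `<=` M' -> sum_set L M `<=` sum_set L' M'.
Proof. by move=> LU MU _ [x [y [Lx My ->]]]; exists x, y; split; auto. Qed.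

Lemma span_sub (X : set N) : X `<=` Defs.span X.
Proof. exact: sub_smallest. Qed.
Lemma span_min (X : set N) L : is_submod L -> X `<=` L -> Defs.span X `<=` L.
Proof. by move=> hL XL; apply: smallest_sub. Qed.
Definition adjoin L y : set N := [set z | exists a, L (z - a *: y)].

Lemma adjoin_submod L y : is_submod L -> is_submod (adjoin L y).
Proof.
move=> hL; split.
- by exists 0; rewrite scale0r subr0; apply: submod0.
- move=> u v [a La] [b Lb]; exists (a + b).
  by rewrite scalerDl opprD addrACA; apply: submodD.
- by move=> c u [a La]; exists (c * a); rewrite -scalerA -scalerBr; apply: submodZ.
Qed.
Lemma sub_adjoin L y : L `<=` adjoin L y.
Proof. by move=> x Lx; exists 0; rewrite scale0r subr0. Qed.
Lemma adjoin_mem L y : is_submod L -> adjoin L y y.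
Proof. by move=> hL; exists 1; rewrite scale1r subrr; apply: submod0. Qed.
Lemma adjoin_min L y U : is_submod U -> L `<=` U -> U y -> adjoin L y `<=` U.
Proof.
move=> hU LU Uy x [a La]; rewrite -(subrK (a *: y) x).
by apply: submodD => //; [exact: LU|exact: submodZ].
Qed.
Lemma adjoin_mono L L' y : L `<=` L' -> adjoin L y `<=` adjoin L' y.
Proof. by move=> LL x [a La]; exists a; apply: LL. Qed.
Lemma adjoinAC L x y : adjoin (adjoin L x) y = adjoin (adjoin L y) x.
Proof.
by apply/seteqP; split=> z [a [b hz]]; exists b, a; rewrite addrAC.
Qed.

End Submodule.

(* [fl m n L U] says that U/(L `&` U) has length at most n, when m is the
   maximal ideal: U is reached from L in n steps, each adding a generator
   killed by m modulo what precedes. *)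
Section Length.
Variables (A : comNzRingType) (m : set A).
Section OneModule.
Variable (N : lmodType A).
Implicit Types (L U M : set N) (x y z : N).

Fixpoint fl (n : nat) (L U : set N) : Prop :=
  if n is n'.+1 then
    exists y, [/\ U y, forall a, m a -> L (a *: y) & fl n' (adjoin L y) U]
  else U `<=` L.

Lemma fl_mono n L L' U : L `<=` L' -> fl n L U -> fl n L' U.
Proof.
elim: n L L' => [|n IH] L L' LL /=; first by move=> UL; apply: subset_trans LL.
move=> [y [Uy my fn]]; exists y; split=> // [a /my /LL//|].
by apply: IH fn; apply: adjoin_mono.
Qed.

Lemma flS n L U : L 0 -> U 0 -> fl n L U -> fl n.+1 L U.
Proof.
move=> L0 U0 fn; exists 0; split=> //= [a _|]; first by rewrite scaler0.
by apply: fl_mono fn; apply: sub_adjoin.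
Qed.

Lemma fl_leq n n' L U : is_submod L -> U 0 -> (n <= n')%N -> fl n L U -> fl n' L U.
Proof.
move=> hL U0 /subnK <-; elim: (n' - n)%N => // k IH fn.
by rewrite addSn; apply: flS => //; [exact: submod0|exact: IH].
Qed.

Lemma fl_trans a b L M U : M `<=` U -> fl a L M -> fl b M U -> fl (a + b) L U.
Proof.
move=> MU; elim: a L => [|a IH] L /=; first by move=> ML; rewrite add0n; apply: fl_mono.
by move=> [y [My my fa]] fb; exists y; split=> //; [exact: MU|exact: IH].
Qed.

Hypothesis hres : forall a, ~ m a -> exists b, m (a * b - 1).

(** Modulo L the generator y is killed by m, so it spans at most a line over the residue field; an
    element z of that line outside L generates y back. *)
Lemma adjoin_exchange L M y z : is_submod L -> is_submod M ->
  L `<=` M -> (forall a, m a -> L (a *: y)) ->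
  M z -> ~ L z -> adjoin L y z -> M y.
Proof.
move=> hL hM LM my Mz nLz [a La].
have [ma|nma] := pselect (m a).
  by case: nLz; rewrite -(subrK (a *: y) z); apply: submodD => //; apply: my.
have [b mb] := hres nma.
have May : M (a *: y).
  by rewrite -(subKr z (a *: y)); apply: submodB => //; apply: LM.
have -> : y = b *: (a *: y) - (a * b - 1) *: y.
  by rewrite scalerBl scale1r scalerA mulrC subKr.
by apply: submodB => //; [exact: submodZ|apply: LM; exact: my].
Qed.

(** One-sided Jordan-Hoelder: a strictly larger starting point saves a step. If y lies in L', its
    own step is saved; otherwise the exchange property keeps L + Ay strictly below L' + Ay and the
    induction goes on. *)
Lemma fl_drop n L L' U : is_submod L -> is_submod L' -> is_submod U ->
  L `<` L' -> L' `<=` U -> fl n L U -> exists2 n', n = n'.+1 & fl n' L' U.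
Proof.
elim: n L L' => [|n IH] L L' hL hL' hU LL L'U /=.
  by move=> UL; case: LL => _ []; apply: subset_trans UL.
move=> [y [Uy my fn]]; exists n => //.
have [LL' /nonsubset [z [L'z nLz]]] := LL.
have [L'y|nL'y] := pselect (L' y); first by apply: fl_mono fn; apply: adjoin_min.
have [n' -> fn'] : exists2 n', n = n'.+1 & fl n' (adjoin L' y) U.
  apply: (IH (adjoin L y) _ _ _ hU _ _ fn); try exact: adjoin_submod.
    split; first exact: (adjoin_mono LL').
    move=> /(_ z (@sub_adjoin _ _ _ y _ L'z)) hz; apply: nL'y.
    exact: (adjoin_exchange hL hL' LL' my L'z nLz hz).
  exact: adjoin_min.
exists y; split=> // a /my; exact: LL'.
Qed.

(** Dual to [fl]: [fl n] bounds the length of U modulo L from above, [sc n] from below. *)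
Fixpoint sc (n : nat) (L U : set N) : Prop :=
  if n is n'.+1 then exists L', [/\ is_submod L', L `<` L', L' `<=` U & sc n' L' U]
  else True.

Lemma sc_mono n L L' U : L `<=` L' -> sc n L' U -> sc n L U.
Proof.
case: n => //= n LL [M [hM LM MU sM]]; exists M; split=> //.
by case: LM => L'M nML; split; [exact: subset_trans L'M|move=> ML; apply: nML; apply: subset_trans LL].
Qed.

Lemma sc_fl n n' L U : is_submod L -> is_submod U -> sc n L U -> fl n' L U -> (n <= n')%N.
Proof.
move=> + hU; elim: n n' L => // n IH n' L hL [L' [hL' LL L'U sn]] fn.
have [n1 -> fn1] := fl_drop hL hL' hU LL L'U fn.
by rewrite ltnS; apply: (IH _ L').
Qed.

Lemma sc_cat a b L M U : L `<=` M -> M `<=` U -> sc a L M -> sc b M U -> sc (a + b) L U.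
Proof.
move=> + MU; elim: a L => [|a IH] L LM /=; first by move=> _; apply: sc_mono.
move=> [L' [hL' LL L'M sa]] sb; exists L'; split=> //; last exact: IH.
exact: subset_trans MU.
Qed.

(** In a filtration with the least number of steps no generator is redundant, since a redundant one
    could be dropped; its stages therefore form a strict chain. *)
Lemma fl_sc n L U : is_submod L -> is_submod U -> L `<=` U -> fl n L U ->
  (forall n', fl n' L U -> (n <= n')%N) -> sc n L U.
Proof.
move=> + hU; elim: n L => // n IH L hL LU /= [y [Uy my fn]] nmin.
have nLy : ~ L y.
  move=> Ly; have /nmin : fl n L U by apply: fl_mono fn; apply: adjoin_min.
  by rewrite ltnn.
have hLy := adjoin_submod y hL.
exists (adjoin L y); split=> //.
- by split; [exact: sub_adjoin|move=> /(_ _ (adjoin_mem y hL))].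
- exact: adjoin_min.
- apply: IH => //; first exact: adjoin_min.
  by move=> n' fn'; rewrite -ltnS; apply: nmin; exists y.
Qed.

(** The length of U modulo L when it is finite, and the default 0 otherwise; hence the witness
    [fl n L U] carried by the lemmas on it. *)
Definition flen L U : nat :=
  xget 0%N [set n | fl n L U /\ forall n', fl n' L U -> (n <= n')%N].

Lemma flen_spec n L U : fl n L U ->
  fl (flen L U) L U /\ forall n', fl n' L U -> (flen L U <= n')%N.
Proof.
move=> fn; rewrite /flen; case: xgetP => [n0 _ [] //|] /= none; exfalso.
have ex : exists n, `[< fl n L U >] by exists n; apply/asboolP.
have [n1 /asboolP fn1 min1] := ex_minnP ex.
by apply: (none n1); split=> // n' fn'; apply: min1; apply/asboolP.
Qed.

Lemma flenP n L U : fl n L U -> fl (flen L U) L U.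
Proof. by case/flen_spec. Qed.

Lemma flen_le n L U : fl n L U -> (flen L U <= n)%N.
Proof. by move=> fn; case: (flen_spec fn) => _; apply. Qed.

Lemma flen_sc n L U : is_submod L -> is_submod U -> L `<=` U -> fl n L U ->
  sc (flen L U) L U.
Proof.
by move=> hL hU LU fn; apply: fl_sc => //; [exact: flenP fn|move=> n'; exact: flen_le].
Qed.

Lemma flen_eq n L U : is_submod L -> is_submod U -> fl n L U -> sc n L U -> flen L U = n.
Proof.
move=> hL hU fn sn; apply/eqP; rewrite eqn_leq (flen_le fn).
exact: (sc_fl hL hU sn (flenP fn)).
Qed.

(** A filtration is intersected with M: by the exchange property each of its steps adds to the
    intersection either nothing or a single generator. *)
Lemma fl_restrict n L M U : is_submod L -> is_submod M -> M `<=` U ->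
  fl n L U -> fl n (L `&` M) M.
Proof.
move=> + hM MU; elim: n L => [|n IH] L hL /=.
  by move=> UL x Mx; split=> //; apply/UL/MU.
move=> [y [Uy my fn]]; have hLy := adjoin_submod y hL.
have {IH fn} fn := IH _ hLy fn.
have [sub|/nonsubset [z [[Lyz Mz] nLz]]] := pselect (adjoin L y `&` M `<=` L).
  apply: (@flS n); [by split; apply: submod0|exact: submod0|].
  by apply: fl_mono fn => x [? ?]; split=> //; apply: sub.
exists z; split=> // [a ma|].
  split; last exact: submodZ.
  have [b Lb] := Lyz; rewrite -(subrK (b *: y) z) scalerDr scalerA mulrC -scalerA.
  by apply: submodD => //; apply: submodZ => //; apply: my.
apply: fl_mono fn => w [Lyw Mw].
have Lzy : adjoin L z y.
  apply: (adjoin_exchange hL _ _ my _ nLz Lyz); last exact: adjoin_mem.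
    exact: adjoin_submod.
  exact: sub_adjoin.
have [c Lc] := adjoin_min (adjoin_submod z hL) (@sub_adjoin _ _ L z) Lzy Lyw.
by exists c; split=> //; apply: submodB => //; apply: submodZ.
Qed.

Lemma fl_sub n L M U : is_submod L -> is_submod M -> L `<=` M -> M `<=` U ->
  fl n L U -> fl n L M.
Proof. by move=> hL hM LM MU /(fl_restrict hL hM MU); rewrite setIidl. Qed.

Lemma flen_add n L M U : is_submod L -> is_submod M -> is_submod U ->
  L `<=` M -> M `<=` U -> fl n L U -> flen L U = (flen L M + flen M U)%N.
Proof.
move=> hL hM hU LM MU fn.
have fM := fl_sub hL hM LM MU fn; have fU := fl_mono LM fn.
apply: flen_eq => //; first by apply: fl_trans MU _ _; apply: flenP; [exact: fM|exact: fU].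
by apply: (@sc_cat _ _ L M U) => //; apply: flen_sc; [..|exact: fM| | | |exact: fU].
Qed.

End OneModule.

(* G is a linear relation, defined on all of U, that sends L into L'. *)
Lemma fl_rel (N N' : lmodType A) (G : N -> N' -> Prop) a b
    (L U : set N) (L' U' : set N') :
  is_submod L' ->
  (forall x x' y y', G x y -> G x' y' -> G (x + x') (y + y')) ->
  (forall c x y, G x y -> G (c *: x) (c *: y)) ->
  (forall x, U x -> exists2 y, U' y & G x y) ->
  (forall x y, L x -> G x y -> L' y) ->
  fl a L U -> fl b (sum_set L' [set y | exists2 x, U x & G x y]) U' ->
  fl (a + b) L' U'.
Proof.
move=> + GD GZ GU + + ; elim: a L L' => [|a IH] L L' hL' GL /=.
  move=> UL; apply: fl_mono => _ [u [v [L'u [x Ux Gxv] ->]]].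
  by apply: submodD => //; apply: GL Gxv; apply: UL.
move=> [y [Uy my fa]] fb; have [y' U'y' Gyy'] := GU _ Uy.
exists y'; split=> //; first by move=> c mc; apply: GL (GZ c _ _ Gyy'); apply: my.
apply: IH fa _; first exact: adjoin_submod.
  move=> x x' [c Lc] Gxx'; exists c; apply: GL Lc _; rewrite -!scaleNr.
  by apply: GD => //; apply: GZ.
by apply: fl_mono fb; apply: sum_mono => //; apply: sub_adjoin.
Qed.

Lemma fl_map (N N' : lmodType A) (g : {linear N -> N'}) a b
    (L U : set N) (L' U' : set N') :
  is_submod L' ->
  (forall x, U x -> U' (g x)) -> (forall x, L x -> L' (g x)) ->
  fl a L U -> fl b (sum_set L' (g @` U)) U' -> fl (a + b) L' U'.
Proof.
move=> hL' gU gL fa fb.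
apply: (@fl_rel _ _ (fun x y => y = g x) a b L U L' U') => //.
- by move=> x x' y y' -> ->; rewrite linearD.
- by move=> c x y ->; rewrite linearZ.
- by move=> x Ux; exists (g x) => //; apply: gU.
- by move=> x y Lx ->; apply: gL.
apply: fl_mono fb; apply: sum_mono => // _ [x Ux <-]; by exists x.
Qed.

End Length.

(** * Agreement with the length of a quotient module defined by chains *)

Section QuotientLength.
Variables (A : comNzRingType) (N : lmodType A) (X : set N).

Lemma quot_mod_proj : exists g : {linear N -> quot_mod X},
  (forall v, exists x, g x = v) /\ (forall x, g x = 0 <-> Defs.span X x).
Proof.
pose pr (x : N) : quot_mod X := \pi_(Quotient.quot (GRing.ZmodClosed.clone N (spanb X) _)) x.
have prD : zmod_morphism pr by move=> x y; exact: (raddfB \pi_(Quotient.quot (GRing.ZmodClosed.clone N (spanb X) _))).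
have prZ : scalable pr by move=> a x; rewrite /pr -quot_scaleE.
pose f1 := GRing.isZmodMorphism.Build N (quot_mod X) pr prD.
pose f2 := GRing.isScalable.Build A N (quot_mod X) *:%R pr prZ.
pose g : {linear N -> quot_mod X} := HB.pack pr f1 f2.
exists g; split.
  by move=> v; exists (repr (v : Quotient.quot (GRing.ZmodClosed.clone N (spanb X) _))); exact: reprK.
move=> x; rewrite -[0](raddf0 g) /g /= /pr; split.
  by move=> /eqP; rewrite -Quotient.idealrBE subr0 => /asboolP.
by move=> Xx; apply/eqP; rewrite -Quotient.idealrBE subr0; apply/asboolP.
Qed.

Lemma nat_sup_eq (E : set nat) n : E n -> (forall m, E m -> (m <= n)%N) -> nat_sup E = n.
Proof.
move=> En maxn; rewrite /nat_sup; case: xgetP => [n' -> [En' max']|/(_ n) []] //=.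
by apply/eqP; rewrite eqn_leq maxn // max'.
Qed.

Lemma sc_chain n (L : set N) : is_submod L -> sc n L setT ->
  exists c : nat -> set N, [/\ c 0%N = L, forall i, (i <= n)%N -> is_submod (c i) &
    forall i, (i < n)%N -> c i `<` c i.+1].
Proof.
elim: n L => [|n IH] L hL /=; first by move=> _; exists (fun=> L); split.
move=> [L' [hL' LL _ sn]]; have [c [c0 hc ltc]] := IH _ hL' sn.
exists (fun i => if i is i'.+1 then c i' else L); split=> // [[|i]|[|i]] //=.
- exact: hc.
- by rewrite c0.
- exact: ltc.
Qed.

Lemma chain_sc n (L : set N) (c : nat -> set N) : L `<=` c 0%N ->
  (forall i, (i <= n)%N -> is_submod (c i)) ->
  (forall i, (i < n)%N -> c i `<` c i.+1) -> sc n L setT.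
Proof.
elim: n c L => // n IH c L Lc hc ltc; apply: (sc_mono Lc).
exists (c 1%N); split=> //; first exact: hc.
  exact: ltc.
by apply: (IH (c \o S)) => // i ilt /=; [exact: hc|exact: ltc].
Qed.

Variable m : set A.
Hypothesis hres : forall a, ~ m a -> exists b, m (a * b - 1).

(** Images and preimages under the projection exchange strict chains in the quotient with strict
    chains above the span of X, so the supremum in [length] is attained at [flen]. *)
Lemma length_quot_mod n : fl m n (Defs.span X) setT ->
  length (quot_mod X) = flen m (Defs.span X) setT.
Proof.
move=> fn; have [g [gs gk]] := quot_mod_proj; have hX := @span_submod _ _ X.
have pre_submod (M : set (quot_mod X)) : is_submod M -> is_submod (g @^-1` M).
  move=> hM; split=> [|x y|a x] /=; first by rewrite linear0; apply: submod0.
    by rewrite linearD; apply: submodD.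
  by rewrite linearZ; apply: submodZ.
have im_submod (M : set N) : is_submod M -> is_submod (g @` M).
  move=> hM; split=> [|_ _ [x Mx <-] [y My <-]|a _ [x Mx <-]].
  - by exists 0; [apply: submod0|rewrite linear0].
  - by exists (x + y); [apply: submodD|rewrite linearD].
  - by exists (a *: x); [apply: submodZ|rewrite linearZ].
apply: nat_sup_eq => /=.
  have [c [c0 hc ltc]] := sc_chain hX (flen_sc hX (submodT N) (@subsetT _ _) fn).
  have Xc i : (i <= flen m (Defs.span X) setT)%N -> Defs.span X `<=` c i.
    elim: i => [|i IH] ilt; first by rewrite c0.
    by apply: subset_trans (IH (ltnW ilt)) _; case: (ltc _ ilt).
  exists (fun i => g @` c i); split=> [i /hc /im_submod//|i ilt]; split.
    by apply: image_subset; case: (ltc _ ilt).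
  move=> sub; case: (ltc _ ilt) => _; apply=> x cx.
  have [y cy gyx] : (g @` c i) (g x) by apply: sub; exists x.
  rewrite -(subrK y x); apply: submodD => //; first exact/hc/ltnW.
  apply: (Xc i (ltnW ilt)); apply/gk.
  by rewrite linearB gyx subrr.
move=> n' [c [hc ltc]].
apply: (sc_fl hres hX (submodT N) _ (flenP fn)).
apply: (@chain_sc _ _ (fun i => g @^-1` c i)) => [x /gk /= ->|i /hc /pre_submod//|i ilt].
  by apply: submod0; exact: hc.
case: (ltc _ ilt) => le nle; split=> [x|sub]; first exact: le.
by apply: nle => v; have [x <-] := gs v; apply: sub.
Qed.

End QuotientLength.

(** * Powers of an ideal given by generators *)

Section IdealPowers.
Variable A : comNzRingType.
Implicit Types (I J L U : set A) (gs : seq A).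

Lemma idl0 I : is_ideal I -> I 0. Proof. exact: submod0. Qed.
Lemma idlD I x y : is_ideal I -> I x -> I y -> I (x + y). Proof. exact: submodD. Qed.
Lemma idlB I x y : is_ideal I -> I x -> I y -> I (x - y). Proof. exact: submodB. Qed.
Lemma idlM I a x : is_ideal I -> I x -> I (a * x).
Proof. exact: (@submodZ A A^o). Qed.
Lemma idlMr I a x : is_ideal I -> I x -> I (x * a).
Proof. by rewrite mulrC; apply: idlM. Qed.
Lemma idl_sum I T (r : seq T) (P : pred T) (F : T -> A) : is_ideal I ->
  (forall i, P i -> I (F i)) -> I (\sum_(i <- r | P i) F i).
Proof. exact: submod_sum. Qed.
Lemma idlT : is_ideal [set: A]. Proof. exact: submodT. Qed.
(** The product of the ideal generated by [gs] with the ideal L, in normal form with one coefficient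
    in L per generator: later, series are summed coefficient by coefficient. A finitely generated
    ideal is always written [gpow gs 1]. *)
Fixpoint gmul gs L : set A :=
  if gs is g :: gs' then [set z | exists a b, [/\ L a, gmul gs' L b & z = g * a + b]]
  else [set 0].

Definition gpow gs n : set A := iter n (gmul gs) setT.

Lemma gmul_ideal gs L : is_ideal L -> is_ideal (gmul gs L).
Proof.
move=> hL; elim: gs => [|g gs IH] /=; first exact: submod_zero.
split.
- by exists 0, 0; rewrite mulr0 addr0; split=> //; apply: idl0.
- move=> _ _ [a [b [La hb ->]]] [a' [b' [La' hb' ->]]].
  exists (a + a'), (b + b'); rewrite mulrDr addrACA; split=> //; exact: idlD.
- move=> c _ [a [b [La hb ->]]]; exists (c * a), (c * b).
  by split; [exact: idlM|exact: idlM|rewrite scalerDr /GRing.scale /= mulrCA].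
Qed.

Lemma gmul_mem gs L g a : is_ideal L -> g \in gs -> L a -> gmul gs L (g * a).
Proof.
move=> hL + La; elim: gs => // h gs IH; rewrite inE => /orP[/eqP <-|/IH hg] /=.
  by exists a, 0; rewrite addr0; split=> //; apply: idl0; apply: gmul_ideal.
by exists 0, (g * a); rewrite mulr0 add0r; split=> //; apply: idl0.
Qed.

Lemma gmul_min gs L U : is_ideal U -> (forall g a, g \in gs -> L a -> U (g * a)) ->
  gmul gs L `<=` U.
Proof.
move=> hU; elim: gs => [|g gs IH] hg /=; first by move=> _ ->; apply: idl0.
move=> _ [a [b [La hb ->]]]; apply: idlD => //.
  by apply: hg => //; rewrite inE eqxx.
by apply: IH hb => h c hh; apply: hg; rewrite inE hh orbT.
Qed.

Lemma gmul_mono gs L L' : L `<=` L' -> gmul gs L `<=` gmul gs L'.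
Proof.
move=> LL; elim: gs => //= g gs IH _ [a [b [La hb ->]]].
by exists a, b; split; auto.
Qed.

Lemma gmul_sub gs L : is_ideal L -> gmul gs L `<=` L.
Proof. by move=> hL; apply: gmul_min => // g a _; apply: idlM. Qed.

Lemma gpow_ideal gs n : is_ideal (gpow gs n).
Proof. by elim: n => [|n IH]; [exact: idlT|exact: gmul_ideal]. Qed.

Lemma gpowS gs n : gpow gs n.+1 = gmul gs (gpow gs n). Proof. by []. Qed.

Lemma gpow_decr gs n n' : (n <= n')%N -> gpow gs n' `<=` gpow gs n.
Proof.
move=> /subnK <-; elim: (n' - n)%N => // k IH.
rewrite addSn gpowS; apply: subset_trans IH; by apply: gmul_sub; apply: gpow_ideal.
Qed.

Lemma gpow_mul gs i j a b : gpow gs i a -> gpow gs j b -> gpow gs (i + j) (a * b).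
Proof.
elim: i a => [|i IH] a; first by move=> _ hb; apply: idlM => //; apply: gpow_ideal.
rewrite addSn !gpowS => ha hb.
suff: gmul gs (gpow gs i) `<=` [set x | gmul gs (gpow gs (i + j)) (x * b)] by apply.
apply: gmul_min => [|g c hg hc] /=.
  split=> [|x y hx hy|c x hx] /=.
  - by rewrite mul0r; apply: idl0; apply: gmul_ideal; apply: gpow_ideal.
  - by rewrite mulrDl; apply: idlD => //; apply: gmul_ideal; apply: gpow_ideal.
  - by rewrite /GRing.scale /= -mulrA; apply: idlM => //; apply: gmul_ideal; apply: gpow_ideal.
by rewrite -mulrA; apply: gmul_mem => //; [exact: gpow_ideal|exact: IH].
Qed.

Lemma gpow_exp gs i a n : gpow gs i a -> gpow gs (i * n) (a ^+ n).
Proof.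
move=> ha; elim: n => [|n IH]; first by rewrite muln0.
by rewrite exprS mulnS; apply: gpow_mul.
Qed.

Lemma gpow1_mem gs g : g \in gs -> gpow gs 1 g.
Proof. by move=> hg; rewrite -[g]mulr1; apply: gmul_mem => //; exact: idlT. Qed.

Lemma gpow1_min gs U : is_ideal U -> (forall g, g \in gs -> U g) -> gpow gs 1 `<=` U.
Proof. by move=> hU gU; apply: gmul_min => // g a /gU Ug _; apply: idlMr. Qed.

Lemma gpow1_gen gs : gpow gs 1 = ideal_gen [set` gs].
Proof.
apply/seteqP; split.
  by apply: gpow1_min => [|g hg]; [exact: span_submod|exact: span_sub].
apply: (@span_min A A^o) => [|g]; [exact: gpow_ideal|exact: gpow1_mem].
Qed.

Lemma gpow_min gs (U : nat -> set A) : (forall n, is_ideal (U n)) -> U 0%N = setT ->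
  (forall n g a, g \in gs -> U n a -> U n.+1 (g * a)) -> forall n, gpow gs n `<=` U n.
Proof.
move=> hU U0 US; elim=> [|n IH]; first by rewrite U0.
by rewrite gpowS; apply: gmul_min => // g a hg /IH; apply: US.
Qed.

Lemma gpow_sub gs gs' n : gpow gs 1 `<=` gpow gs' 1 -> gpow gs n `<=` gpow gs' n.
Proof.
move=> sub; apply: gpow_min => // [k|k g a hg]; first exact: gpow_ideal.
by rewrite -add1n; apply: gpow_mul; apply: sub; apply: gpow1_mem.
Qed.

End IdealPowers.

Section Adjoins.
Variables (A : comNzRingType) (N : lmodType A).

Definition adjoins (L : set N) (ys : seq N) : set N := foldr (fun y M => adjoin M y) L ys.

Lemma adjoins_submod L ys : is_submod L -> is_submod (adjoins L ys).
Proof. by move=> hL; elim: ys => //= y ys; apply: adjoin_submod. Qed.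
Lemma adjoins_mono L L' ys : L `<=` L' -> adjoins L ys `<=` adjoins L' ys.
Proof. by move=> LL; elim: ys => //= y ys; apply: adjoin_mono. Qed.
Lemma adjoins_mem L ys y : is_submod L -> y \in ys -> adjoins L ys y.
Proof.
move=> hL; elim: ys => // z ys IH; rewrite inE => /orP[/eqP ->|/IH] /=.
  by apply: adjoin_mem; apply: adjoins_submod.
exact: sub_adjoin.
Qed.
Lemma adjoins_min L ys U : is_submod U -> L `<=` U -> (forall y, y \in ys -> U y) ->
  adjoins L ys `<=` U.
Proof.
move=> hU LU; elim: ys => //= y ys IH yU; apply: adjoin_min => //.
  by apply: IH => z hz; apply: yU; rewrite inE hz orbT.
by apply: yU; rewrite inE eqxx.
Qed.
Lemma adjoinsAC L ys y : adjoins (adjoin L y) ys = adjoin (adjoins L ys) y.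
Proof. by elim: ys => //= z ys ->; rewrite adjoinAC. Qed.

End Adjoins.

(** * Length estimates for quotients of a ring *)

Section RingLength.
Variables (A : comNzRingType) (m : set A).
Notation flr n L := (@fl A m A^o n L setT).

(** Modulo L, U is a quotient of a sum of [size ys] copies of A/c, filtered one copy after another
    through the maps a |-> ay. *)
Lemma fl_gen (N : lmodType A) (L U : set N) (c : set A) ys n :
  is_submod L -> is_submod U -> (forall y, y \in ys -> U y) ->
  (forall y a, y \in ys -> c a -> L (a *: y)) -> U `<=` adjoins L ys ->
  flr n c -> fl m (size ys * n) L U.
Proof.
move=> + hU + + + fn; elim: ys L => [|y ys IH] L hL yU cy Us //=.
rewrite mulSn.
have linf : linear (fun a : A^o => a *: y : N).
  by move=> a u v; rewrite scalerDl scalerA.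
pose f : {linear A^o -> N} := HB.pack (fun a : A^o => a *: y : N) (GRing.isLinear.Build _ _ _ _ _ linf).
apply: (@fl_map _ m A^o N f _ _ c setT L U) => //.
- by move=> a _; apply: submodZ => //; apply: yU; rewrite inE eqxx.
- by move=> a ca; apply: cy => //; rewrite inE eqxx.
apply: (@fl_mono _ _ _ _ (adjoin L y)).
  by move=> z [a La]; exists (z - a *: y), (a *: y); rewrite subrK; split=> //; exists a.
apply: IH; first exact: adjoin_submod.
- by move=> z zys; apply: yU; rewrite inE zys orbT.
- by move=> z a zys ca; apply: sub_adjoin; apply: cy => //; rewrite inE zys orbT.
- by rewrite adjoinsAC.
Qed.

(** Right exactness of A/(L + x) -> A/(L + xy) -> A/(L + y) -> 0, the first map being multiplication
    by y. *)
Lemma fl_mul (L : set A^o) (x y : A) n1 n2 : is_ideal L ->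
  flr n1 (adjoin L x) -> flr n2 (adjoin L y) -> flr (n1 + n2) (adjoin L (x * y : A^o)).
Proof.
move=> hL f1 f2.
have linf : linear (fun a : A^o => a * y : A^o).
  by move=> a u v; rewrite mulrDl /GRing.scale /= mulrA.
pose f : {linear A^o -> A^o} := HB.pack (fun a : A^o => a * y : A^o) (GRing.isLinear.Build _ _ _ _ _ linf).
apply: (@fl_map _ m A^o A^o f _ _ (adjoin L x) setT) => //.
- exact: adjoin_submod.
- by move=> z [a La]; exists a; rewrite /GRing.scale /= mulrA -mulrBl; apply: idlMr.
apply: fl_mono f2 => z [a La]; exists (z - a *: (y : A^o)), (a *: (y : A^o)); rewrite subrK.
by split=> //; exact: sub_adjoin.
Qed.

Lemma fl_expr (L : set A^o) (x : A) n k : is_ideal L ->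
  flr n (adjoin L x) -> flr (k * n) (adjoin L (x ^+ k : A^o)).
Proof.
move=> hL fn; elim: k => [|k IH].
  by rewrite expr0 mul0n => z _; exists z; rewrite /GRing.scale /= mulr1 subrr; apply: idl0.
by rewrite mulSn exprS; apply: fl_mul.
Qed.

(** Each listed element in turn is replaced by its k-th power at the cost of a factor k. With k = p
    this later gives the factor p^d, and with k proportional to p^e the growth of lengths in e. *)
Lemma fl_exprs (L : set A^o) (xs : seq A) n k : is_ideal L ->
  flr n (adjoins L xs) -> flr (k ^ size xs * n) (adjoins L [seq (x ^+ k : A^o) | x <- xs]).
Proof.
elim: xs L n => [|x xs IH] L n hL /=; first by rewrite expn0 mul1n.
rewrite -adjoinsAC => fn.
have := IH _ _ (adjoin_submod _ hL) fn; rewrite adjoinsAC expnS -mulnA.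
by apply: fl_expr; apply: adjoins_submod.
Qed.

Lemma gpow1_adjoins gs : gpow gs 1 `<=` adjoins [set 0 : A^o] gs.
Proof.
apply: gpow1_min => [|g hg]; first exact: (adjoins_submod _ (@submod_zero A A^o)).
exact: (adjoins_mem (@submod_zero A A^o) hg).
Qed.

Lemma fl1 (L : set A^o) : is_ideal L -> m `<=` L -> flr 1 L.
Proof.
move=> hL mL /=; exists 1; split=> // [a ma|]; first by rewrite /GRing.scale /= mulr1; apply: mL.
by move=> z _; exists z; rewrite /GRing.scale /= mulr1 subrr; apply: idl0.
Qed.

Lemma fl_gpow gs n : m `<=` gpow gs 1 -> flr (n ^ size gs) (gpow gs n).
Proof.
move=> mgs; have [->|n0] := posnP n.
  by apply: (@fl_leq _ _ _ 0%N) => //; exact: gpow_ideal.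
have f1 : flr 1 (adjoins [set 0 : A^o] gs).
  apply: fl1; first exact: (adjoins_submod _ (@submod_zero A A^o)).
  exact: subset_trans mgs (gpow1_adjoins (gs:=gs)).
have := fl_exprs n (@submod_zero _ _) f1; rewrite muln1; apply: fl_mono.
apply: adjoins_min; first exact: gpow_ideal.
  by move=> _ ->; apply: idl0; apply: gpow_ideal.
by move=> _ /mapP[x xgs ->]; have := gpow_exp n (gpow1_mem xgs); rewrite mul1n.
Qed.

Lemma fl_finite gs n (L : set A^o) : m `<=` gpow gs 1 -> gpow gs n `<=` L ->
  flr (n ^ size gs) L.
Proof. move=> mgs sL; exact: (@fl_mono A m A^o _ _ _ _ sL (fl_gpow n mgs)). Qed.

End RingLength.

Section Push.
Variables (A B : comNzRingType) (mA : set A) (mB : set B) (f : {rmorphism A -> B}).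

Lemma fl_push n (L : set A^o) (L' : set B^o) : is_ideal L' ->
  (forall b, exists a, L' (b - f a)) ->
  (forall b, mB b -> exists2 a, mA a & L' (b - f a)) ->
  (forall a, L a -> L' (f a)) ->
  @fl A mA A^o n L setT -> @fl B mB B^o n L' setT.
Proof.
move=> + + + + ; elim: n L L' => [|n IH] L L' hL' hB hm fL /=.
  move=> TL b _; have [a La] := hB b; rewrite -(subrK (f a) b).
  by apply: idlD => //; apply: fL; apply: TL.
move=> [y [_ my fn]]; exists (f y); split=> // [b mb|].
  have [a ma La] := hm _ mb; rewrite -(subrK (f a) b) scalerDl; apply: idlD => //.
    by rewrite /GRing.scale /=; apply: idlMr.
  by rewrite /GRing.scale /= -rmorphM; apply: fL; apply: my.
apply: IH fn; first exact: adjoin_submod.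
- by move=> b; have [a La] := hB b; exists a; apply: sub_adjoin.
- by move=> b /hm[a ma La]; exists a => //; apply: sub_adjoin.
- move=> a [c Lc]; exists (f c); rewrite /GRing.scale /= -rmorphM -rmorphB; exact: fL.
Qed.

End Push.

(** * Rank of modules over a domain *)

Section Rank.
Variables (D : comNzRingType) (N : lmodType D).
Hypothesis hdom : forall a b : D, a * b = 0 -> a = 0 \/ b = 0.
Implicit Types (L U V : set N).

Lemma dom_neq0 (a b : D) : a != 0 -> b != 0 -> a * b != 0.
Proof. by move=> a0 b0; apply/eqP => /hdom[] /eqP; apply/negP. Qed.

Lemma dom_exp (a : D) n : a != 0 -> a ^+ n != 0.
Proof.
move=> a0; elim: n => [|n IH]; first by rewrite expr0 oner_neq0.
by rewrite exprS dom_neq0.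
Qed.

(** The preimage of the D-torsion of N/L. *)
Definition cl L : set N := [set z | exists2 c : D, c != 0 & L (c *: z)].

Lemma cl_submod L : is_submod L -> is_submod (cl L).
Proof.
move=> hL; split.
- by exists 1; [exact: oner_neq0|rewrite scaler0; apply: submod0].
- move=> x y [a a0 Lx] [b b0 Ly]; exists (a * b); first exact: dom_neq0.
  rewrite scalerDr; apply: submodD => //; last by rewrite -scalerA; apply: submodZ.
  by rewrite mulrC -scalerA; apply: submodZ.
- by move=> b x [a a0 Lx]; exists a => //; rewrite scalerA mulrC -scalerA; apply: submodZ.
Qed.

Lemma sub_cl L : L `<=` cl L.
Proof. by move=> x Lx; exists 1; [exact: oner_neq0|rewrite scale1r]. Qed.

Lemma cl_mono L L' : L `<=` L' -> cl L `<=` cl L'.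
Proof. by move=> LL x [c c0 Lx]; exists c => //; apply: LL. Qed.

Lemma cl_min L L' : L `<=` cl L' -> cl L `<=` cl L'.
Proof.
move=> LL x [c c0 /LL[d d0 Lx]]; exists (d * c); first exact: dom_neq0.
by rewrite -scalerA.
Qed.

Lemma cl_exch L y z : is_submod L -> ~ cl L z -> cl (adjoin L y) z -> cl (adjoin L z) y.
Proof.
move=> hL nz [c c0 [a La]]; have [a0|a0] := eqVneq a 0.
  by case: nz; exists c => //; move: La; rewrite a0 scale0r subr0.
by exists a => //; exists c; rewrite -opprB; apply: submodN.
Qed.

(** Over the fraction field of D, which is never formed, the image of U in N/L spans a space of
    dimension at most n. The witnesses y are not asked to lie in U, so the bound passes at once to
    subsets of U. *)
Fixpoint rk (n : nat) L U : Prop :=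
  if n is n'.+1 then exists y, rk n' (adjoin L y) U else U `<=` cl L.

Lemma adjoin_cl L L' y : is_submod L' -> L `<=` cl L' -> adjoin L y `<=` cl (adjoin L' y).
Proof.
move=> hL' LL z [a /LL [c c0 L'z]]; exists c => //; exists (c * a).
by rewrite -scalerA -scalerBr.
Qed.

Lemma rk_cl n L L' U : is_submod L' -> L `<=` cl L' -> rk n L U -> rk n L' U.
Proof.
elim: n L L' => [|n IH] L L' hL' LL /=; first by move/subset_trans; apply; apply: cl_min.
move=> [y rn]; exists y; apply: IH rn; first exact: adjoin_submod.
exact: adjoin_cl.
Qed.

Lemma rk_mono n L L' U : is_submod L' -> L `<=` L' -> rk n L U -> rk n L' U.
Proof. by move=> hL' LL; apply: rk_cl => //; apply: subset_trans LL (@sub_cl _). Qed.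

Lemma rk_leq n n' L U : is_submod L -> (n <= n')%N -> rk n L U -> rk n' L U.
Proof.
move=> hL /subnK <-; elim: (n' - n)%N => // k IH rn; rewrite addSn; exists 0.
apply: rk_mono (IH rn); [exact: adjoin_submod|exact: sub_adjoin].
Qed.

Lemma rk_subset n L U V : V `<=` U -> rk n L U -> rk n L V.
Proof.
move=> VU; elim: n L => [|n IH] L /=; first exact: subset_trans.
by move=> [y rn]; exists y; apply: IH.
Qed.

Lemma rk_drop n L U z : is_submod L -> U z -> ~ cl L z -> rk n L U ->
  exists2 n', n = n'.+1 & rk n' (adjoin L z) U.
Proof.
elim: n L => [|n IH] L hL Uz nz /=; first by move=> UL; case: nz; apply: UL.
move=> [y rn]; have hLy := adjoin_submod y hL; exists n => //.
have [zy|nzy] := pselect (cl (adjoin L y) z).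
  apply: rk_cl rn; first exact: adjoin_submod.
  apply: adjoin_min; [exact/cl_submod/adjoin_submod| |exact: cl_exch].
  exact: subset_trans (@sub_adjoin _ _ _ _) (@sub_cl _).
have [n' -> rn'] := IH _ hLy Uz nzy rn.
by exists y; rewrite adjoinAC.
Qed.

(** Elements of V independent of L are exchanged, one by one, for witnesses of the rank of U; as z
    stays outside the closure of V, one witness is left over. *)
Lemma rk_strict n L U V z : is_submod L -> is_submod V -> L `<=` V -> V `<=` U ->
  U z -> ~ cl V z -> rk n L U -> exists2 n', n = n'.+1 & rk n' L V.
Proof.
move=> + hV + VU Uz nz; elim: n L => [|n IH] L hL LV /=.
  by move=> /(_ _ Uz) Lz; case: nz; apply: cl_mono Lz.
move=> [y rn]; exists n => //.
have [VL|/nonsubset [v [Vv nv]]] := pselect (V `<=` cl L).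
  by apply: (@rk_leq 0).
have [n1 [e] rn1] := rk_drop (n := n.+1) hL (VU _ Vv) nv (ex_intro _ y rn).
rewrite -e in rn1.
have [n2 -> rn2] := IH _ (adjoin_submod v hL) (adjoin_min hV LV Vv) rn1.
by exists v.
Qed.

Lemma cl_unif L ys : is_submod L -> (forall y, y \in ys -> cl L y) ->
  exists2 c : D, c != 0 & forall z, adjoins [set 0] ys z -> L (c *: z).
Proof.
move=> hL; elim: ys => [|y ys IH] hy.
  by exists 1; [exact: oner_neq0|move=> _ ->; rewrite scaler0; apply: submod0].
have [|c c0 hc] := IH; first by move=> z zs; apply: hy; rewrite inE zs orbT.
have [|d d0 Ly] := hy y; first by rewrite inE eqxx.
exists (c * d); first exact: dom_neq0.
move=> z [a /hc Lz]; rewrite -(subrK (a *: y) z) scalerDr; apply: submodD => //.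
  by rewrite mulrC -scalerA; apply: submodZ.
by rewrite scalerA -mulrA (mulrC d) mulrA -scalerA; apply: submodZ.
Qed.

(** A single denominator for all the torsion, by induction on the rank. If y is not torsion modulo
    L, an element of ay + L can be torsion only when a = 0; if y is torsion, its denominator is
    absorbed. *)
Lemma rk_torsion n L ys : is_submod L -> rk n L (adjoins [set 0] ys) ->
  exists2 c : D, c != 0 & forall z, adjoins [set 0] ys z -> cl L z -> L (c *: z).
Proof.
elim: n L => [|n IH] L hL /=.
  move=> sub; have [|c c0 hc] := @cl_unif L ys hL.
    by move=> y yys; apply: sub; apply: adjoins_mem => //; apply: submod_zero.
  by exists c => // z /hc.
move=> [y rn]; have [c c0 hc] := IH _ (adjoin_submod y hL) rn.
have [[c1 c10 Ly]|nLy] := pselect (cl L y).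
  exists (c1 * c); first exact: dom_neq0.
  move=> z Uz Lz; have [a La] := hc z Uz (cl_mono (@sub_adjoin _ _ _ y) Lz).
  rewrite -scalerA -(subrK (a *: y) (c *: z)) scalerDr; apply: submodD => //.
    exact: submodZ.
  by rewrite scalerA mulrC -scalerA; apply: submodZ.
exists c => // z Uz Lz; have [a La] := hc z Uz (cl_mono (@sub_adjoin _ _ _ y) Lz).
have [a0|a0] := eqVneq a 0; first by move: La; rewrite a0 scale0r subr0.
have [c' c'0 Lc'z] := Lz; case: nLy; exists (c' * a); first exact: dom_neq0.
rewrite -(subKr (c' *: (c *: z)) ((c' * a) *: y)) -scalerA -scalerBr.
apply: submodB => //; last exact: submodZ.
by rewrite scalerA mulrC -scalerA; apply: submodZ.
Qed.

Lemma rk_gen L U ys : U `<=` adjoins L ys -> rk (size ys) L U.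
Proof.
elim: ys L => [|y ys IH] L /=; first by move=> UL; apply: subset_trans UL (@sub_cl _).
by move=> UL; exists y; apply: IH; rewrite adjoinsAC.
Qed.

End Rank.

(** * Subalgebras of p^e-th powers *)

Section CharP.
Variables (B : comNzRingType) (p : nat).
Hypothesis (pB : p \in [pchar B]).

Lemma exprDp e (x y : B) : (x + y) ^+ (p ^ e) = x ^+ (p ^ e) + y ^+ (p ^ e).
Proof. by apply: exprDn_pchar; rewrite pnatX pnatE ?pB // (pcharf_prime pB). Qed.

Lemma exprBp e (x y : B) : (x - y) ^+ (p ^ e) = x ^+ (p ^ e) - y ^+ (p ^ e).
Proof. by rewrite -[in RHS](subrK y x) [in RHS]exprDp addrK. Qed.

Lemma exprDp1 (x y : B) : (x + y) ^+ p = x ^+ p + y ^+ p.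
Proof. exact: (exprDp 1). Qed.

Lemma exprBp1 (x y : B) : (x - y) ^+ p = x ^+ p - y ^+ p.
Proof. exact: (exprBp 1). Qed.

End CharP.

(** * Algebras over a domain, viewed as modules *)

Section OverD.
Variables (D B : comNzRingType) (phi : {rmorphism D -> B}).
Implicit Types (L M U I : set B).

(** The names prefixed by d are the notions above for the D-module [restr phi], stated for subsets
    of B so that the product of B and the action of D apply to the same terms. *)
Definition dsub M := @is_submod D (restr phi) M.
Definition dadj L (y : B) : set B := @adjoin D (restr phi) L y.
Definition dadjs L (ys : seq B) : set B := @adjoins D (restr phi) L ys.
Definition dspan (X : set B) : set B := @Defs.span D (restr phi) X.
Definition dcl L : set B := @cl D (restr phi) L.
Definition drk n L U := @rk D (restr phi) n L U.
Definition dfl (m : set D) n L U := @fl D m (restr phi) n L U.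
Definition dlen (m : set D) L U := @flen D m (restr phi) L U.

Lemma dsub0 M : dsub M -> M 0. Proof. exact: (@submod0 D (restr phi)). Qed.
Lemma dsubD M x y : dsub M -> M x -> M y -> M (x + y).
Proof. exact: (@submodD D (restr phi)). Qed.
Lemma dsubB M x y : dsub M -> M x -> M y -> M (x - y).
Proof. exact: (@submodB D (restr phi)). Qed.
Lemma dsubZ M a x : dsub M -> M x -> M (phi a * x).
Proof. exact: (@submodZ D (restr phi)). Qed.
Lemma dsubP M : M 0 -> (forall x y, M x -> M y -> M (x + y)) ->
  (forall a x, M x -> M (phi a * x)) -> dsub M.
Proof. by []. Qed.
Lemma dsub_zero : dsub [set 0]. Proof. exact: (@submod_zero D (restr phi)). Qed.
Lemma dsubT : dsub setT. Proof. exact: (@submodT D (restr phi)). Qed.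

Lemma dspan_sub X x : X x -> dspan X x. Proof. exact: (@span_sub D (restr phi)). Qed.
Lemma dspan_min X L : dsub L -> (forall x, X x -> L x) -> dspan X `<=` L.
Proof. exact: (@span_min D (restr phi)). Qed.
Lemma dspan_submod X : dsub (dspan X). Proof. exact: span_submod. Qed.

Lemma dadj_submod L y : dsub L -> dsub (dadj L y).
Proof. exact: (@adjoin_submod D (restr phi)). Qed.
Lemma dadjs_submod L ys : dsub L -> dsub (dadjs L ys).
Proof. exact: (@adjoins_submod D (restr phi)). Qed.
Lemma dadjs_min L ys U : dsub U -> L `<=` U -> (forall y, y \in ys -> U y) -> dadjs L ys `<=` U.
Proof. exact: (@adjoins_min D (restr phi)). Qed.
Lemma dadjs_mem L ys y : dsub L -> y \in ys -> dadjs L ys y.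
Proof. exact: (@adjoins_mem D (restr phi)). Qed.
Lemma sub_dadj L y : L `<=` dadj L y. Proof. exact: (@sub_adjoin D (restr phi)). Qed.
Lemma dadj_mem L y : dsub L -> dadj L y y.
Proof. exact: (@adjoin_mem D (restr phi)). Qed.
Lemma dadj_min L y U : dsub U -> L `<=` U -> U y -> dadj L y `<=` U.
Proof. exact: (@adjoin_min D (restr phi)). Qed.

Definition pr I M : set B := dspan [set z | exists x y, [/\ I x, M y & z = x * y]].

Lemma pr_submod I M : dsub (pr I M). Proof. exact: dspan_submod. Qed.
Lemma pr_mem I M x y : I x -> M y -> pr I M (x * y).
Proof. by move=> Ix My; apply: dspan_sub; exists x, y. Qed.
Lemma pr_min I M L : dsub L -> (forall x y, I x -> M y -> L (x * y)) -> pr I M `<=` L.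
Proof. by move=> hL IM; apply: dspan_min => // _ [x [y [Ix My ->]]]; apply: IM. Qed.
Lemma pr_mono I M I' M' : I `<=` I' -> M `<=` M' -> pr I M `<=` pr I' M'.
Proof.
by move=> II MM; apply: pr_min; [exact: pr_submod|move=> x y /II Ix /MM My; exact: pr_mem].
Qed.
Lemma pre_mul_submod M c : dsub M -> dsub [set x | M (c * x)].
Proof.
move=> hM; apply: dsubP => [|x y|a x] /=; first by rewrite mulr0; apply: dsub0.
  by rewrite mulrDr; apply: dsubD.
by rewrite mulrCA; apply: dsubZ.
Qed.
Lemma pr_stable I M c : (forall x, M x -> M (c * x)) ->
  forall x, pr I M x -> pr I M (c * x).
Proof.
move=> cM; apply: pr_min; first exact: pre_mul_submod (pr_submod I M).
by move=> x y Ix My /=; rewrite mulrCA; apply: pr_mem => //; apply: cM.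
Qed.

End OverD.

Section Stabilise.
Variables (D B : comNzRingType) (phi : {rmorphism D -> B}) (p : nat).
Hypotheses (pB : p \in [pchar B]).
Hypothesis hdom : forall a b : D, a * b = 0 -> a = 0 \/ b = 0.
Implicit Types (L M U I : set B).
Local Notation dsub := (dsub phi).
Local Notation dadjs := (dadjs phi).
Local Notation dadj := (dadj phi).
Local Notation dcl := (dcl phi).
Local Notation drk := (drk phi).
Local Notation dspan := (dspan phi).
Local Notation pr := (pr phi).

Lemma p_gt0 : (0 < p)%N. Proof. by rewrite prime_gt0 // (pcharf_prime pB). Qed.

Lemma dcl_submod L : dsub L -> dsub (dcl L).
Proof. exact: (@cl_submod D (restr phi)). Qed.

Definition frob L : set B := dspan [set z | exists2 x, L x & z = x ^+ p].

Lemma frob_submod L : dsub (frob L). Proof. exact: dspan_submod. Qed.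
Lemma frob_mem L x : L x -> frob L (x ^+ p).
Proof. by move=> Lx; apply: dspan_sub; exists x. Qed.
Lemma frob_min L U : dsub U -> (forall x, L x -> U (x ^+ p)) -> frob L `<=` U.
Proof. by move=> hU LU; apply: dspan_min => // _ [x Lx ->]; apply: LU. Qed.

Lemma frob_dadj L y : frob (dadj L y) `<=` dadj (frob L) (y ^+ p).
Proof.
apply: frob_min; first exact/dadj_submod/frob_submod.
move=> x [a La]; exists (a ^+ p); rewrite /GRing.scale /= /restr_scale.
by have := frob_mem La; rewrite /GRing.scale /= /restr_scale exprBp1 // exprMn -rmorphXn.
Qed.

Variable us : seq B.
Hypothesis hfin : forall x, dadjs [set 0] us x.

(** The D-subalgebra generated by the p^e-th powers, written as a span of powers of the module
    generators so that it is visibly finite over D. Additivity of Frobenius shows that it contains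
    all p^e-th powers and is closed under products. *)
Definition Ce e : set B := dadjs [set 0] [seq u ^+ (p ^ e) | u <- us].

Lemma Ce_submod e : dsub (Ce e). Proof. exact/dadjs_submod/dsub_zero. Qed.

Lemma Ce_mem e x : Ce e (x ^+ (p ^ e)).
Proof.
have := hfin x; rewrite /Ce; elim: us x => [|u vs IH] x /=.
  by move=> ->; rewrite expr0n expn_eq0 -leqn0 leqNgt p_gt0.
move=> [a /IH]; rewrite /GRing.scale /= /restr_scale exprBp // exprMn -rmorphXn.
by move=> h; exists (a ^+ (p ^ e)).
Qed.

Lemma Ce_min e U : dsub U -> (forall x, U (x ^+ (p ^ e))) -> Ce e `<=` U.
Proof.
move=> hU xU; apply: dadjs_min => //; first by move=> _ ->; apply: dsub0 hU.
by move=> _ /mapP[u _ ->].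
Qed.

Lemma Ce1 e : Ce e 1. Proof. by rewrite -(expr1n _ (p ^ e)); apply: Ce_mem. Qed.

Lemma CeM e x y : Ce e x -> Ce e y -> Ce e (x * y).
Proof.
move=> Cx; move: y; suff: Ce e `<=` [set y | Ce e (x * y)] by [].
apply: Ce_min; first exact: pre_mul_submod (Ce_submod e).
move=> y /=; rewrite mulrC; move: x Cx; suff: Ce e `<=` [set x | Ce e (y ^+ (p ^ e) * x)] by [].
apply: Ce_min; first exact: pre_mul_submod (Ce_submod e).
by move=> x /=; rewrite -exprMn; apply: Ce_mem.
Qed.

Lemma CeX e x n : Ce e x -> Ce e (x ^+ n).
Proof.
by move=> Cx; elim: n => [|n IH]; [rewrite expr0; exact: Ce1|rewrite exprS; exact: CeM].
Qed.

Lemma Ce_frob e : Ce e.+1 = frob (Ce e).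
Proof.
apply/seteqP; split.
  apply: Ce_min => [|x]; first exact: frob_submod.
  by rewrite expnSr exprM; apply: frob_mem; apply: Ce_mem.
apply: frob_min; first exact: Ce_submod.
suff: Ce e `<=` [set x | Ce e.+1 (x ^+ p)] by [].
apply: Ce_min => [|x]; last by rewrite /= -exprM -expnSr; apply: Ce_mem.
apply: dsubP => [|x y|a x] /=.
- by rewrite expr0n gtn_eqF ?p_gt0 //; apply: dsub0 (Ce_submod _).
- by rewrite exprDp1 //; apply: dsubD (Ce_submod _).
- by rewrite exprMn -rmorphXn; apply: dsubZ (Ce_submod _).
Qed.

(** Frobenius is additive and sends [phi a] to [phi (a ^+ p)], so generic generators y of U modulo L
    become generic generators y^p: the rank does not grow. *)
Lemma drk_frob n L U : drk n L U -> drk n (frob L) (frob U).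
Proof.
elim: n L => [|n IH] L /=.
  move=> UL; apply: frob_min; first exact/dcl_submod/frob_submod.
  move=> x /UL[c c0 Lx]; exists (c ^+ p); first exact: dom_exp.
  by have := frob_mem Lx; rewrite /GRing.scale /= /restr_scale exprMn -rmorphXn.
move=> [y /IH rn]; exists (y ^+ p); apply: rk_mono rn => //.
  exact/dadj_submod/frob_submod.
exact: frob_dadj.
Qed.

(** Rank bounds are natural numbers, so a least one is attained at some e; minimality is later used
    by comparison with e + 1. *)
Lemma stable_exponent : exists e r, drk r [set 0] (Ce e) /\
  forall e' r', drk r' [set 0] (Ce e') -> (r <= r')%N.
Proof.
have r0 : drk (size [seq u ^+ (p ^ 0) | u <- us]) [set 0] (Ce 0).
  by apply: rk_gen => x.
have ex : exists r, `[< exists e, drk r [set 0] (Ce e) >].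
  by eexists; apply/asboolP; exists 0%N; exact: r0.
have [r /asboolP[e re] rmin] := ex_minnP ex.
exists e, r; split=> // e' r' re'; apply: rmin; apply/asboolP; by exists e'.
Qed.

Section Stable.
Variables (e r : nat).
Hypothesis hr : drk r [set 0] (Ce e).
Hypothesis rmin : forall e' r', drk r' [set 0] (Ce e') -> (r <= r')%N.
Let C := Ce e.

Lemma stable_torsion : exists2 c : D, c != 0 & forall z, C z -> dcl [set 0] z -> phi c * z = 0.
Proof. exact: (@rk_torsion D (restr phi) hdom r _ _ (@dsub_zero _ _ phi) hr). Qed.

(** [frob C] is the next algebra [Ce e.+1]. A generator of C outside its closure would force this
    algebra to have smaller rank than the minimum; so the finitely many generators lie in the
    closure, and they share a denominator. *)
Lemma stable_frob : exists2 c : D, c != 0 & forall z, C z -> frob C (phi c * z).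
Proof.
apply: (@cl_unif D (restr phi) hdom (frob C)); first exact: frob_submod.
move=> y yin; have Cy : C y by apply: dadjs_mem => //; exact: dsub_zero.
apply: contrapT => nCy.
have s1 : [set 0] `<=` frob C by move=> _ ->; apply: dsub0 (frob_submod _).
have s2 : frob C `<=` C.
  by apply: frob_min; [exact: Ce_submod|move=> x; exact: CeX].
have [n' en rn'] := @rk_strict D (restr phi) hdom r [set 0] C (frob C) y (@dsub_zero _ _ phi)
  (frob_submod _) s1 s2 Cy nCy hr.
have /rmin : drk n' [set 0] (Ce e.+1) by rewrite Ce_frob.
by rewrite en ltnn.
Qed.

(** If z is not torsion, C has rank at most r - 1 modulo Dz, hence by Frobenius [Ce e.+1] has rank
    at most r - 1 modulo D z^p. Were z^p torsion, this would bound its full rank, below the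
    minimum. *)
Lemma stable_pow z : C z -> dcl [set 0] (z ^+ p) -> dcl [set 0] z.
Proof.
move=> Cz zp; apply: contrapT => nz.
have [n' en rn'] := @rk_drop D (restr phi) hdom r [set 0] C z (@dsub_zero _ _ phi) Cz nz hr.
have /rmin : drk n' [set 0] (Ce e.+1).
  rewrite Ce_frob; apply: (@rk_cl D (restr phi) hdom _ _ _ _ (@dsub_zero _ _ phi) _ (drk_frob rn')).
  apply: frob_min; first exact: dcl_submod (@dsub_zero _ _ phi).
  move=> x [a]; rewrite /GRing.scale /= /restr_scale => /eqP; rewrite subr_eq0 => /eqP ->.
  by rewrite exprMn -rmorphXn; apply: dsubZ zp; apply: dcl_submod; exact: dsub_zero.
by rewrite en ltnn.
Qed.

(** The generic fibre of C is reduced: the exponent is raised to p^n, and [stable_pow] takes n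
    successive p-th roots. *)
Lemma stable_nilp z n : C z -> z ^+ n = 0 -> dcl [set 0] z.
Proof.
move=> Cz zn0.
have : dcl [set 0] (z ^+ (p ^ n)).
  have /subnK <- : (n <= p ^ n)%N by apply/ltnW/ltn_expl/prime_gt1/(pcharf_prime pB).
  rewrite exprD zn0 mulr0; apply: dsub0; apply: dcl_submod; exact: dsub_zero.
elim: n {zn0} => [|n IH]; first by rewrite expn0 expr1.
by rewrite expnSr exprM => /stable_pow h; apply/IH/h/CeX.
Qed.

End Stable.
End Stabilise.

(** * Generic idempotents of the subalgebra of powers *)

Section Separable.
Variables (D B : comNzRingType) (phi : {rmorphism D -> B}).
Hypothesis hdom : forall a b : D, a * b = 0 -> a = 0 \/ b = 0.
Implicit Types (L M U I K : set B).
Local Notation dsub := (dsub phi).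
Local Notation dadjs := (dadjs phi).
Local Notation dadj := (dadj phi).
Local Notation dcl := (dcl phi).
Local Notation drk := (drk phi).
Local Notation dspan := (dspan phi).
Local Notation pr := (pr phi).

Variable C : set B.
Hypotheses (hC : dsub C) (C1 : C 1) (CM : forall x y, C x -> C y -> C (x * y)).

Lemma C_D a : C (phi a). Proof. by rewrite -[phi a]mulr1; apply: dsubZ hC _. Qed.

Lemma C_X x n : C x -> C (x ^+ n).
Proof. by move=> Cx; elim: n => [|n IH]; rewrite ?expr0 // exprS; apply: CM. Qed.

Definition cmod M := dsub M /\ forall c x, C c -> M x -> M (c * x).

Hypothesis htor :
  exists2 c : D, c != 0 & forall z, C z -> dcl [set 0] z -> phi c * z = 0.
Hypothesis hnil : forall z n, C z -> z ^+ n = 0 -> dcl [set 0] z.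
Hypothesis hrk : exists r, drk r [set 0] C.

Lemma pow_set_submod x : dsub [set z | exists2 b, C b & z = x * b].
Proof.
apply: dsubP => [|_ _ [b Cb ->] [b' Cb' ->]|a _ [b Cb ->]].
- by exists 0; [apply: dsub0 hC|rewrite mulr0].
- by exists (b + b'); [exact: dsubD hC _ _|rewrite mulrDr].
- by exists (phi a * b); [exact: dsubZ hC _|rewrite mulrCA].
Qed.

(** The modules x^j C decrease, and every generically strict inclusion costs a unit of rank; so some
    x^j is torsion modulo x^{j+1} C. *)
Lemma pow_dependent x : C x ->
  exists j (c : D) b, [/\ c != 0, C b & phi c * x ^+ j = x ^+ j.+1 * b].
Proof.
move=> Cx; pose V j : set B := [set z | exists2 b, C b & z = x ^+ j * b].
have hV j : dsub (V j) by apply: pow_set_submod.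
have [r hr] := hrk.
have : drk r [set 0] (V 0%N).
  by apply: rk_subset hr => _ [b Cb ->]; rewrite expr0 mul1r.
elim: r 0%N {hr} => [|r IH] j hr.
  have : V j (x ^+ j) by exists 1; rewrite ?mulr1.
  move=> /hr[c c0 h]; exists j, c, 0; split=> //; first exact: dsub0 hC.
  by rewrite mulr0.
have [[c c0 [b Cb h]]|ncl] := pselect (dcl (V j.+1) (x ^+ j)).
  by exists j, c, b.
apply: (IH j.+1).
have Vj : V j (x ^+ j) by exists 1; rewrite ?mulr1.
have s1 : [set 0] `<=` V j.+1 by move=> _ ->; apply: dsub0 (hV _).
have s2 : V j.+1 `<=` V j.
  by move=> _ [b Cb ->]; exists (x * b); [exact: CM|rewrite exprSr mulrA].
by have [n' [->]] := @rk_strict D (restr phi) hdom _ _ _ _ _ (@dsub_zero _ _ phi) (hV _) s1 s2 Vj ncl hr.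
Qed.

(* Von Neumann regularity of [C] with the nonzero elements of [D] inverted. *)
Lemma generic_regular x : C x ->
  exists (c : D) y, [/\ c != 0, C y & phi c * x = x ^+ 2 * y].
Proof.
move=> Cx; have [j [c [b [c0 Cb h]]]] := pow_dependent Cx.
(* The relation says that x^j kills c - xb, so z is nilpotent, hence torsion; clearing its
   denominator gives the claim. *)
pose z := x * (phi c - x * b).
have Cw : C (phi c - x * b) by apply: (dsubB hC); [exact: C_D|exact: CM].
have Cz : C z by apply: CM.
have xw : x ^+ j * (phi c - x * b) = 0.
  by rewrite mulrBr mulrA -exprSr -h mulrC subrr.
have zn : z ^+ j.+1 = 0.
  have -> : z ^+ j.+1 = (x ^+ j * (phi c - x * b)) * (x * (phi c - x * b) ^+ j).
    by rewrite exprS exprMn /z; ring.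
  by rewrite xw mul0r.
have [c' c'0 hz] := hnil Cz zn.
exists (c' * c), (phi c' * b); split; [exact: dom_neq0|exact: dsubZ hC _|].
move: hz; rewrite /GRing.scale /= /restr_scale /z mulrBr mulrBr => /eqP.
rewrite subr_eq0 => /eqP; rewrite rmorphM => e.
by rewrite -mulrA [phi c * x]mulrC e; ring.
Qed.

(* [eps / c] is an idempotent of the generic fibre that generates [K]. *)
Lemma generic_idempotent K : cmod K -> K `<=` C ->
  exists (c : D) eps, [/\ c != 0, K eps & forall a, K a -> eps * a = phi c * a].
Proof.
move=> [hK KC] KsC.
(* The part of K on which eps / c acts as the identity. It is enlarged until it is generically all
   of K, by induction on the rank of K modulo it. *)
pose X (eps : B) (c : D) : set B := [set a | K a /\ eps * a = phi c * a].
have hX eps c : dsub (X eps c).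
  apply: dsubP => [|x y [Kx ex] [Ky ey]|a x [Kx ex]].
  - by split; rewrite ?mulr0 //; apply: dsub0 hK.
  - by split; [exact: dsubD hK _ _|rewrite !mulrDr ex ey].
  - by split; [exact: dsubZ hK _|rewrite mulrCA ex mulrCA].
suff : exists (c : D) eps, [/\ c != 0, K eps & K `<=` dcl (X eps c)].
  (* The defect eps a - c a is torsion in C, killed uniformly by c1; multiplying c and eps by c1
     makes the generic identity exact. *)
  move=> [c [eps [c0 Ke sub]]]; have [c1 c10 ht] := htor.
  exists (c1 * c), (phi c1 * eps); split; [exact: dom_neq0|exact: dsubZ hK _|].
  move=> a Ka; apply/eqP; rewrite -subr_eq0 rmorphM -!mulrA -mulrBr -mulrBl; apply/eqP.
  apply: ht; first by apply: CM (KsC _ Ka); apply: (dsubB hC); [exact: KsC|exact: C_D].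
  have [c2 c20 [_ h]] := sub _ Ka; exists c2 => //.
  move: h; rewrite /GRing.scale /= /restr_scale => h.
  by rewrite mulrBl mulrBr !(mulrCA (phi c2)) h subrr.
have [r hr] := hrk.
have : drk r (X 0 1) K.
  apply: (@rk_subset D (restr phi) _ _ C K KsC); apply: (rk_mono hdom _ _ hr); first exact: hX.
  by move=> _ ->; apply: dsub0 (hX _ _).
have : K 0 by apply: dsub0 hK.
have : (1 : D) != 0 by exact: oner_neq0.
elim: r (0 : B) (1 : D) {hr} => [|r IH] eps c c0 Ke hr; first by exists c, eps.
have [sub|/nonsubset [x [Kx nx]]] := pselect (K `<=` dcl (X eps c)); first by exists c, eps.
have [r' [<-] rr] := @rk_drop D (restr phi) hdom _ _ _ _ (hX eps c) Kx nx hr.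
have [c' [y [c'0 Cy hxy]]] := generic_regular (KsC _ Kx).
pose eps' := x * y.
have Ke' : K eps' by rewrite /eps' mulrC; apply: KC.
have ex : eps' * x = phi c' * x by rewrite hxy /eps' expr2 mulrAC.
(* With u = eps / c and u' = eps' / c', this is u + u' - uu' over the denominator cc': it acts as 1
   wherever u or u' does, in particular on x. *)
apply: (IH (phi c' * eps + phi c * eps' - eps * eps') (c' * c)).
- exact: dom_neq0.
- apply: (dsubB hK); last by apply: KC => //; apply: KsC.
  by apply: (dsubD hK); apply: (dsubZ _ hK).
apply: rk_mono rr => //; first exact: hX.
apply: dadj_min; first exact: hX.
  move=> a [Ka ea]; split=> //; rewrite rmorphM.
  transitivity ((phi c' - eps') * (eps * a) + phi c * (eps' * a)); first by ring.
  by rewrite ea; ring.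
split=> //; rewrite rmorphM.
transitivity ((phi c - eps) * (eps' * x) + phi c' * (eps * x)); first by ring.
by rewrite ex; ring.
Qed.

End Separable.

(** * Comparison of lengths over the subalgebra of powers *)

Section Filtration.
Variables (D B : comNzRingType) (phi : {rmorphism D -> B}) (p : nat).
Hypothesis pB : p \in [pchar B].
Hypothesis hdom : forall a b : D, a * b = 0 -> a = 0 \/ b = 0.
Implicit Types (L M U I K X : set B).
Local Notation dsub := (dsub phi).
Local Notation dadjs := (dadjs phi).
Local Notation dadj := (dadj phi).
Local Notation dcl := (dcl phi).
Local Notation drk := (drk phi).
Local Notation dspan := (dspan phi).
Local Notation pr := (pr phi).
Local Notation frob := (frob phi p).

Variables (xs : seq D).
Let d := size xs.
Let n : set D := gpow xs 1.
Hypothesis hres : forall a, ~ n a -> exists b, n (a * b - 1).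
Hypothesis htorsion : forall c : D, c != 0 -> exists k, forall N,
  @fl D n D^o (k * N ^ d.-1) (adjoin (gpow xs N : set D^o) c) setT.

Local Notation dln := (dfl phi n).
Local Notation len := (dlen phi n).

Definition dsum X Y : set B := [set z | exists x y, [/\ X x, Y y & z = x + y]].
Lemma dsum_submod X Y : dsub X -> dsub Y -> dsub (dsum X Y).
Proof. exact: (@sum_submod D (restr phi)). Qed.
Lemma dsum_subl X Y : dsub Y -> X `<=` dsum X Y.
Proof. exact: (@sum_subl D (restr phi)). Qed.
Lemma dsum_subr X Y : dsub X -> Y `<=` dsum X Y.
Proof. exact: (@sum_subr D (restr phi)). Qed.
Lemma dsum_min X Y U : dsub U -> X `<=` U -> Y `<=` U -> dsum X Y `<=` U.
Proof. exact: (@sum_min D (restr phi)). Qed.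
Lemma dsum0 Y : dsum [set 0] Y = Y.
Proof.
apply/seteqP; split=> [_ [_ [y [-> Yy ->]]]|y Yy]; first by rewrite add0r.
by exists 0, y; rewrite add0r.
Qed.

Lemma dfl_mono k L L' U : L `<=` L' -> dln k L U -> dln k L' U.
Proof. exact: (@fl_mono D n (restr phi)). Qed.
Lemma dlen_le k L U : dln k L U -> (len L U <= k)%N.
Proof. exact: (@flen_le D n (restr phi)). Qed.
Lemma dlenP k L U : dln k L U -> dln (len L U) L U.
Proof. exact: (@flenP D n (restr phi)). Qed.

Lemma dfl_rel (G : B -> B -> Prop) a b L U L' U' :
  dsub L' ->
  (forall x x' y y', G x y -> G x' y' -> G (x + x') (y + y')) ->
  (forall c x y, G x y -> G (phi c * x) (phi c * y)) ->
  (forall x, U x -> exists2 y, U' y & G x y) ->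
  (forall x y, L x -> G x y -> L' y) ->
  dln a L U -> dln b (dsum L' [set y | exists2 x, U x & G x y]) U' ->
  dln (a + b) L' U'.
Proof. exact: (@fl_rel D n (restr phi) (restr phi)). Qed.

Variable C : set B.
Hypotheses (hC : dsub C) (C1 : C 1) (CM : forall x y, C x -> C y -> C (x * y)).
Variable cs : seq B.
Hypothesis hcs : C = dadjs [set 0] cs.
Hypothesis hgen : forall K, cmod phi C K -> K `<=` C ->
  exists (c : D) eps, [/\ c != 0, K eps & forall a, K a -> eps * a = phi c * a].
Hypothesis hfrob : exists2 c : D, c != 0 & forall z, C z -> frob C (phi c * z).

Variable b : nat -> set B.
Hypotheses (hb : forall e, cmod phi C (b e)) (bC : forall e, b e `<=` C).
Hypothesis b_frob : forall e z, b e z -> b e.+1 (z ^+ p).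
Variable w : nat.
Hypothesis b_low : forall e a, gpow xs (w * p ^ e) a -> b e (phi a).

Local Notation err e := (p ^ (e * d.-1))%N.
Local Notation cm := (cmod phi C).

Lemma err_pow k e : (k * (w * p ^ e) ^ d.-1 = (k * w ^ d.-1) * err e)%N.
Proof. by rewrite expnMn expnM mulnA. Qed.

(** Modulo L the module is generated by [ys] over D/(c, (xs)^(w p^e)), whose length is O(p^{e(d-1)})
    by [htorsion]. *)
Lemma fl_torsion ys c : c != 0 -> exists k, forall e L, dsub L ->
  (forall y, y \in ys -> L (phi c * y)) ->
  (forall y x, y \in ys -> b e x -> L (x * y)) ->
  dln (k * err e) L (dadjs [set 0] ys).
Proof.
move=> c0; have [k hk] := htorsion c0; exists (size ys * (k * w ^ d.-1))%N => e L hL cL bL.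
rewrite -mulnA -err_pow.
apply: (@fl_gen D n (restr phi) L _ _ ys _ hL _ _ _ _ (hk _)).
- exact: dadjs_submod (dsub_zero _).
- by move=> y; apply: dadjs_mem; exact: dsub_zero.
- move=> y a yin [a' ha]; rewrite /GRing.scale /= /restr_scale -(subrK (a' * c) a).
  rewrite rmorphD mulrDl rmorphM -mulrA; apply: (dsubD hL); last by apply: (dsubZ _ hL); exact: cL.
  by apply: bL => //; apply: b_low.
- by apply: adjoins_mono => _ ->; apply: dsub0 hL.
Qed.

Lemma fl_fin ys e L : dsub L -> (forall y x, y \in ys -> b e x -> L (x * y)) ->
  exists k, dln k L (dadjs [set 0] ys).
Proof.
move=> hL bL; have := @fl_gpow D n xs (w * p ^ e) (@subset_refl _ _) => f0; eexists.
apply: (@fl_gen D n (restr phi) L _ _ ys _ hL _ _ _ _ f0).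
- exact: dadjs_submod (dsub_zero _).
- by move=> y; apply: dadjs_mem; exact: dsub_zero.
- by move=> y a yin ha; apply: bL => //; apply: b_low.
- by apply: adjoins_mono => _ ->; apply: dsub0 hL.
Qed.

Lemma mul_set_submod M c : dsub M -> dsub [set z | exists2 x, M x & z = c * x].
Proof.
move=> hM; apply: dsubP => [|_ _ [x Mx ->] [y My ->]|a _ [x Mx ->]].
- by exists 0; [exact: dsub0 hM|rewrite mulr0].
- by exists (x + y); [exact: dsubD hM _ _|rewrite mulrDr].
- by exists (phi a * x); [exact: dsubZ hM _|rewrite mulrCA].
Qed.

Definition fgen M := exists ys, M = dadjs [set 0] ys.

Definition ext M v : set B := [set z | exists x a, [/\ M x, C a & z = x + a * v]].

Lemma ext_cmod M v : cm M -> cm (ext M v).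
Proof.
move=> [hM MC]; split.
  apply: dsubP.
  - by exists 0, 0; rewrite mul0r addr0; split=> //; [exact: dsub0 hM|exact: dsub0 hC].
  - move=> _ _ [x [a [Mx Ca ->]]] [x' [a' [Mx' Ca' ->]]]; exists (x + x'), (a + a').
    by rewrite mulrDl addrACA; split=> //; [exact: dsubD hM _ _|exact: dsubD hC _ _].
  - move=> c _ [x [a [Mx Ca ->]]]; exists (phi c * x), (phi c * a).
    by rewrite mulrDr mulrA; split=> //; [exact: dsubZ hM _|exact: dsubZ hC _].
move=> c _ Cc [x [a [Mx Ca ->]]]; exists (c * x), (c * a).
by rewrite mulrDr mulrA; split=> //; [exact: MC|exact: CM].
Qed.

Lemma sub_ext M v : M `<=` ext M v.
Proof. by move=> x Mx; exists x, 0; rewrite mul0r addr0; split=> //; apply: dsub0 hC. Qed.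

Lemma ext_mem M v : cm M -> ext M v v.
Proof. by move=> [hM _]; exists 0, 1; rewrite mul1r add0r; split=> //; apply: dsub0 hM. Qed.

Lemma ext_fgen M v : cm M -> fgen M -> fgen (ext M v).
Proof.
move=> cM [ys Mys]; have [hM _] := cM; exists ([seq c * v | c <- cs] ++ ys).
have h0 := dsub_zero phi; apply/seteqP; split.
  move=> _ [x [a [Mx Ca ->]]]; have hU := dadjs_submod ([seq c * v | c <- cs] ++ ys) h0.
  apply: (dsubD hU).
    move: Mx; rewrite Mys; apply: dadjs_min => //; first by move=> _ ->; apply: dsub0 hU.
    by move=> y yin; apply: dadjs_mem => //; rewrite mem_cat yin orbT.
  move: a Ca; rewrite hcs.
  suff : dadjs [set 0] cs `<=` [set a | dadjs [set 0] ([seq c * v | c <- cs] ++ ys) (v * a)].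
    by move=> h a /h /=; rewrite mulrC.
  apply: dadjs_min; first exact: pre_mul_submod hU.
    by move=> _ -> /=; rewrite mulr0; apply: dsub0 hU.
  move=> c cin /=; apply: dadjs_mem => //; rewrite mulrC mem_cat; apply/orP; left.
  by apply/mapP; exists c.
have hE := (ext_cmod v cM).1; apply: dadjs_min => //.
  by move=> _ ->; apply: dsub0 hE.
move=> y; rewrite mem_cat => /orP[/mapP[c cin ->]|yin].
  exists 0, c; rewrite add0r; split=> //; first exact: dsub0 hM.
  by rewrite hcs; apply: dadjs_mem.
by apply: sub_ext; rewrite Mys; apply: dadjs_mem.
Qed.

Lemma fgen_fin M e L : fgen M -> dsub L -> (forall x y, b e x -> M y -> L (x * y)) ->
  exists k, dln k L M.
Proof.
move=> [ys ->] hL bL; apply: (@fl_fin ys e) => // y x yin bx; apply: bL => //.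
by apply: dadjs_mem => //; exact: dsub_zero.
Qed.

Lemma fgen_torsion M c : c != 0 -> fgen M -> exists k, forall e L, dsub L ->
  (forall y, M y -> L (phi c * y)) -> (forall x y, b e x -> M y -> L (x * y)) ->
  dln (k * err e) L M.
Proof.
move=> c0 [ys ->]; have [k hk] := fl_torsion ys c0; exists k => e L hL cL bL.
have ysM y : y \in ys -> dadjs [set 0] ys y.
  by move=> yin; apply: dadjs_mem => //; exact: dsub_zero.
by apply: hk => // [y /ysM /cL|y x /ysM yM bx] //; apply: bL.
Qed.

Section Step.
Variables (M : set B) (v : B).
Hypotheses (cM : cm M) (gM : fgen M).
Let hM : dsub M := cM.1.
Let K : set B := [set a | C a /\ M (a * v)].

Lemma stepK_cmod : cm K.
Proof.
split.
  apply: dsubP.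
  - by split; [exact: dsub0 hC|rewrite mul0r; exact: dsub0 hM].
  - by move=> x y [Cx Mx] [Cy My]; split; [exact: dsubD hC _ _|rewrite mulrDl; exact: dsubD hM _ _].
  - by move=> a x [Cx Mx]; split; [exact: dsubZ hC _|rewrite -mulrA; exact: dsubZ hM _].
by move=> c x Cc [Cx Mx]; split; [exact: CM|rewrite -mulrA; apply: cM.2].
Qed.

Let hK : dsub K := stepK_cmod.1.

Lemma Kb_fin e : exists k, dln k (dsum K (b e)) C.
Proof.
apply: (@fgen_fin C e); first by exists cs.
  by apply: dsum_submod => //; case: (hb e).
move=> x y bx Cy; apply: (dsum_subr hK); rewrite mulrC; exact: (hb e).2.
Qed.

Lemma pr_fin M' X e : fgen M' -> dsub X -> exists k, dln k (dsum X (pr (b e) M')) M'.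
Proof.
move=> gM' hX; apply: (@fgen_fin M' e) => //; first exact: dsum_submod (pr_submod _ _ _).
by move=> x y bx My; apply: (dsum_subr hX); apply: pr_mem.
Qed.

(** Right exactness: a |-> av maps C/(K + b_e) onto the quotient of M + Cv by M + b_e (M + Cv). The
    submodule X is carried along so that lengths modulo a fixed ideal are bounded as well. *)
Lemma step_upper X e : dsub X -> (X `<=` M) ->
  (len (dsum X (pr (b e) (ext M v))) (ext M v) <=
   len (dsum X (pr (b e) M)) M + len (dsum K (b e)) C)%N.
Proof.
move=> hX XM; apply: dlen_le.
have [k1 /dlenP f1] := pr_fin e gM hX; have [k2 /dlenP f2] := Kb_fin e.
pose L1 := dsum M (pr (b e) (ext M v)); pose L0 := dsum X (pr (b e) (ext M v)).
have hE := (ext_cmod v cM).1.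
have hL1 : dsub L1 by apply: dsum_submod (pr_submod _ _ _).
have hL0 : dsub L0 by apply: dsum_submod (pr_submod _ _ _).
have prE : pr (b e) (ext M v) `<=` ext M v.
  by apply: pr_min => // x y /bC Cx; apply: (ext_cmod v cM).2.
apply: (@fl_trans _ _ (restr phi) _ _ _ L1).
- by apply: dsum_min => //; exact: sub_ext.
- rewrite -[len _ M]addn0.
  apply: (@dfl_rel (fun x y => x = y) _ _ _ _ _ _ hL0 _ _ _ _ f1) => //.
  + by move=> x x' y y' -> ->.
  + by move=> c x y ->.
  + by move=> x Mx; exists x => //; apply: dsum_subl (pr_submod _ _ _) _ _.
  + move=> x _ [u [z [Xu hz ->]]] <-; apply: (dsubD hL0).
      exact: (dsum_subl (pr_submod _ _ _)).
    apply: (dsum_subr hX); move: z hz; apply: pr_mono => //; exact: sub_ext.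
  + move=> _ [x [z [Mx hz ->]]]; exists z, x; rewrite addrC; split=> //; last by exists x.
    exact: (dsum_subr hX).
rewrite -[len _ C]addn0.
apply: (@dfl_rel (fun a y => C a /\ y = a * v) _ _ _ _ _ _ hL1 _ _ _ _ f2).
- by move=> x x' _ _ [Cx ->] [Cx' ->]; split; [exact: dsubD hC _ _|rewrite mulrDl].
- by move=> c x _ [Cx ->]; split; [exact: dsubZ hC _|rewrite mulrA].
- move=> a Ca; exists (a * v) => //; exists 0, a; rewrite add0r; split=> //; exact: dsub0 hM.
- move=> _ _ [a [a' [[Ca Ma] ba' ->]]] [_ ->]; exists (a * v), (a' * v); rewrite mulrDl; split=> //.
  by apply: pr_mem => //; apply: ext_mem.
- move=> _ [x [a [Mx Ca ->]]]; exists x, (a * v); split=> //; last by exists a.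
  exact: (dsum_subl (pr_submod _ _ _)).
Qed.

(** Left exactness up to torsion. Generically K is generated by the idempotent eps / c, so M + Cv
    splits into M and C/K up to the denominator c. The projections, multiplied by c, are x + av |->
    cx + eps av, which lands in M because eps v does, and, up to sign, x + av |-> (eps - c)a. *)
Lemma step_lower : exists k, forall e,
  (len (pr (b e) M) M + len (dsum K (b e)) C <=
   len (pr (b e) (ext M v)) (ext M v) + k * err e)%N.
Proof.
have [c [eps [c0 [Ceps Meps] heps]]] := hgen stepK_cmod (fun x h => h.1).
have [k1 hk1] := fgen_torsion c0 gM.
have gC : fgen C by exists cs.
have [k2 hk2] := fgen_torsion (dom_exp hdom 2 c0) gC.
exists (k1 + k2)%N => e.
have cE := ext_cmod v cM; have hE := cE.1.
have [_ bCmul] := hb e; have hbe := (hb e).1.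
have bM x y : b e x -> C y -> b e (x * y) by move=> bx Cy; rewrite mulrC; apply: bCmul.
have hKb : dsub (dsum K (b e)) by apply: dsum_submod.
(* The kernel of the second projection modulo K + b_e. The length is cut at L1; the lower part is
   compared with M/b_e M, the upper one with C/(K + b_e). *)
pose L1 : set B := [set z | exists x a,
   [/\ M x, C a, z = x + a * v & dsum K (b e) ((eps - phi c) * a)]].
pose L0 := pr (b e) (ext M v).
(* An element has several expressions x + av, but the difference of two coefficients a lies in K,
   where eps acts as c; so both projections are well defined. *)
have uniq x a x' a' : M x -> C a -> M x' -> C a' -> x + a * v = x' + a' * v ->
    eps * (a - a') = phi c * (a - a') /\ x' - x = (a - a') * v.
  move=> Mx Ca Mx' Ca' e1.
  have e2 : x' - x = (a - a') * v.
    have -> : x' - x = (x' + a' * v) - (x + a * v) + (a - a') * v by ring.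
    by rewrite e1 subrr add0r.
  split=> //; apply: heps; split; first exact: dsubB hC _ _.
  by rewrite -e2; apply: dsubB hM _ _.
have hL1 : dsub L1.
  apply: dsubP.
  - exists 0, 0; rewrite mul0r mulr0 addr0; split=> //; [exact: dsub0 hM|exact: dsub0 hC|exact: dsub0 hKb].
  - move=> _ _ [x [a [Mx Ca -> ha]]] [x' [a' [Mx' Ca' -> ha']]]; exists (x + x'), (a + a').
    rewrite mulrDl addrACA mulrDr; split=> //; [exact: dsubD hM _ _|exact: dsubD hC _ _|exact: dsubD hKb _ _].
  - move=> t _ [x [a [Mx Ca -> ha]]]; exists (phi t * x), (phi t * a).
    rewrite mulrDr mulrA mulrCA; split=> //; [exact: dsubZ hM _|exact: dsubZ hC _|exact: dsubZ hKb _].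
have L1E : L1 `<=` ext M v by move=> _ [x [a [Mx Ca -> _]]]; exists x, a.
have L0L1 : L0 `<=` L1.
  apply: pr_min => // x _ bx [y [a [My Ca ->]]]; have Cx := bC bx.
  exists (x * y), (x * a); rewrite mulrDr mulrA; split=> //; [exact: cM.2|exact: CM|].
  apply: (dsum_subr hK); rewrite mulrCA; apply: bM => //; apply: CM => //.
  by apply: (dsubB hC) => //; apply: C_D.
have [k0 f0] : exists k, dln k L0 (ext M v).
  have [k] := pr_fin e (ext_fgen v cM gM) (dsub_zero phi); rewrite dsum0; by exists k.
have -> : len L0 (ext M v) = (len L0 L1 + len L1 (ext M v))%N.
  exact: (@flen_add D n (restr phi) hres k0 L0 L1 _ (pr_submod _ _ _) hL1 hE L0L1 L1E f0).
have f01 := dlenP (@fl_sub D n (restr phi) hres k0 L0 L1 _ (pr_submod _ _ _) hL1 L0L1 L1E f0).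
have f1E := dlenP (dfl_mono L0L1 f0).
have low1 : (len (pr (b e) M) M <= len L0 L1 + k1 * err e)%N.
  apply: dlen_le.
  apply: (@dfl_rel (fun z y => exists x a, [/\ M x, C a, z = x + a * v & y = phi c * x + eps * a * v])
     _ _ _ _ _ _ (pr_submod _ _ _) _ _ _ _ f01).
  - move=> _ _ _ _ [x [a [Mx Ca -> ->]]] [x' [a' [Mx' Ca' -> ->]]]; exists (x + x'), (a + a').
    by split; [exact: dsubD hM _ _|exact: dsubD hC _ _|ring|ring].
  - move=> t _ _ [x [a [Mx Ca -> ->]]]; exists (phi t * x), (phi t * a).
    by split; [exact: dsubZ hM _|exact: dsubZ hC _|ring|ring].
  - move=> _ [x [a [Mx Ca -> _]]]; exists (phi c * x + eps * a * v); last by exists x, a.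
    apply: (dsubD hM); first exact: dsubZ hM _.
    by rewrite mulrAC mulrC; apply: cM.2 => //.
  - move=> z0 y0 L0z [x [a [Mx Ca ez ->]]].
    suff [x' [a' [Mx' Ca' ez' h]]] : exists x a, [/\ M x, C a, z0 = x + a * v &
        pr (b e) M (phi c * x + eps * a * v)].
      have [e1 e2] : _ /\ _ := uniq x a x' a' Mx Ca Mx' Ca' (etrans (esym ez) ez').
      have -> // : phi c * x + eps * a * v = phi c * x' + eps * a' * v.
      apply/eqP; rewrite -subr_eq0; apply/eqP.
      transitivity ((eps * (a - a')) * v - phi c * (x' - x)); first by ring.
      by rewrite e1 e2; ring.
    have hpr := pr_submod phi (b e) M.
    move: z0 L0z {ez}; apply: pr_min.
      apply: dsubP.
      - exists 0, 0; rewrite !(mulr0, mul0r, addr0); split=> //; [exact: dsub0 hM|exact: dsub0 hC|exact: dsub0 hpr].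
      - move=> _ _ [y [u [My Cu -> hy]]] [y' [u' [My' Cu' -> hy']]]; exists (y + y'), (u + u').
        split; [exact: dsubD hM _ _|exact: dsubD hC _ _|by ring|].
        have -> : phi c * (y + y') + eps * (u + u') * v =
          (phi c * y + eps * u * v) + (phi c * y' + eps * u' * v) by ring.
        exact: dsubD hpr _ _.
      - move=> t _ [y [u [My Cu -> hy]]]; exists (phi t * y), (phi t * u).
        split; [exact: dsubZ hM _|exact: dsubZ hC _|by ring|].
        have -> : phi c * (phi t * y) + eps * (phi t * u) * v = phi t * (phi c * y + eps * u * v) by ring.
        exact: dsubZ hpr _.
    move=> y _ by_ [z [u [Mz Cu ->]]]; have Cy := bC by_; exists (y * z), (y * u).
    split; [exact: cM.2|exact: CM|by ring|].
    have -> : phi c * (y * z) + eps * (y * u) * v = y * (phi c * z + u * (eps * v)) by ring.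
    apply: pr_mem => //; apply: (dsubD hM); first exact: dsubZ hM _.
    exact: cM.2.
  have hU : dsub (dsum (pr (b e) M) [set z | exists2 x, M x & z = phi c * x]).
    by apply: dsum_submod (pr_submod _ _ _) _; apply: mul_set_submod.
  apply: dfl_mono (hk1 e _ hU _ _).
  - apply: (sum_mono (N := restr phi)) => // _ [x Mx ->]; exists x.
      exists x, 0; rewrite !(mul0r, mulr0, addr0); split=> //; [exact: dsub0 hC|exact: dsub0 hKb].
    by exists x, 0; rewrite !(mul0r, mulr0, addr0); split=> //; exact: dsub0 hC.
  - by move=> y My; apply: (dsum_subr (pr_submod _ _ _)); exists y.
  - move=> x y bx My; apply: dsum_subl; first exact: mul_set_submod.
    exact: pr_mem.
have low2 : (len (dsum K (b e)) C <= len L1 (ext M v) + k2 * err e)%N.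
  apply: dlen_le.
  apply: (@dfl_rel (fun z y => exists x a, [/\ M x, C a, z = x + a * v & y = (eps - phi c) * a])
     _ _ _ _ _ _ hKb _ _ _ _ f1E).
  - move=> _ _ _ _ [x [a [Mx Ca -> ->]]] [x' [a' [Mx' Ca' -> ->]]]; exists (x + x'), (a + a').
    by split; [exact: dsubD hM _ _|exact: dsubD hC _ _|ring|ring].
  - move=> t _ _ [x [a [Mx Ca -> ->]]]; exists (phi t * x), (phi t * a).
    by split; [exact: dsubZ hM _|exact: dsubZ hC _|ring|ring].
  - move=> _ [x [a [Mx Ca ->]]]; exists ((eps - phi c) * a); last by exists x, a.
    by apply: CM => //; apply: (dsubB hC) => //; apply: C_D.
  - move=> _ _ [x [a [Mx Ca -> h]]] [x' [a' [Mx' Ca' e1 ->]]].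
    have [e2 _] := uniq _ _ _ _ Mx Ca Mx' Ca' e1.
    suff -> : (eps - phi c) * a' = (eps - phi c) * a by [].
    apply/eqP; rewrite -subr_eq0; apply/eqP.
    transitivity (phi c * (a - a') - eps * (a - a')); first by ring.
    by rewrite e2 subrr.
  have hU : dsub (dsum (dsum K (b e)) [set z | exists2 a, C a & z = (eps - phi c) * a]).
    by apply: dsum_submod => //; apply: mul_set_submod.
  apply: dfl_mono (hk2 e _ hU _ _).
  - apply: (sum_mono (N := restr phi)) => // _ [a Ca ->]; exists (a * v).
      by exists 0, a; rewrite add0r; split=> //; exact: dsub0 hM.
    by exists 0, a; rewrite add0r; split=> //; exact: dsub0 hM.
  (* The cokernel is killed by c^2, because c^2 = eps (2c - eps) + (eps - c)^2 and eps lies in K. *)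
  - move=> y Cy; exists (eps * (phi c * y + phi c * y - eps * y)), ((eps - phi c) * ((eps - phi c) * y)).
    split; last by rewrite rmorphXn; ring.
      apply: dsum_subl => //; rewrite mulrC; apply: stepK_cmod.2 => //.
      by apply: (dsubB hC); [apply: (dsubD hC); apply: CM => //; exact: C_D|exact: CM].
    exists ((eps - phi c) * y) => //; apply: CM => //.
    by apply: (dsubB hC) => //; apply: C_D.
  - move=> x y bx Cy; apply: dsum_subl; first exact: mul_set_submod.
    by apply: (dsum_subr hK); apply: bM.
have := leq_add low1 low2; rewrite mulnDl addnACA; exact.
Qed.

End Step.

Section FrobeniusBound.
Variable K : set B.
Hypotheses (cK : cm K) (KC : K `<=` C).

(** A step generated by y, with every x of [xs] carrying y into L, becomes a step generated by y^p
    and killed by every x^p; its length is at most p^d, the bound for D modulo the p-th powers of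
    [xs]. The t further steps fill the gap between [frob C] and C. *)
Lemma fl_frob k t L L' : dsub L' -> L' `<=` C -> frob L `<=` L' -> dln k L C ->
  dln t (dsum L' (frob C)) C -> dln (p ^ d * k + t) L' C.
Proof.
elim: k L L' => [|k IH] L L' hL' LC FL.
  move=> /= CL ft; rewrite muln0 add0n; apply: dfl_mono ft.
  apply: dsum_min => //; apply: frob_min => // x /CL Lx; apply: FL; exact: frob_mem.
move=> [y [Cy ny fk]] ft; rewrite mulnS -addnA.
have hL'' := dadj_submod (y ^+ p) hL'.
have CX x m : C x -> C (x ^+ m) by apply: C_X.
have UC : dadj L' (y ^+ p) `<=` C by apply: dadj_min => //; exact: CX.
have hT : dln (p ^ d * k + t) (dadj L' (y ^+ p)) C.
  apply: (IH (dadj L y)) => //.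
    apply: subset_trans (@frob_dadj D B phi p pB L y) _.
    exact: (@adjoin_mono D (restr phi)).
  by apply: dfl_mono ft; apply: (sum_mono (N := restr phi)) => //; apply: sub_dadj.
apply: (@fl_trans D n (restr phi) _ _ L' _ _ UC _ hT).
have f1 : @fl D n D^o 1 (adjoins [set 0 : D^o] xs) setT.
  apply: fl1; first exact: (adjoins_submod _ (@submod_zero D D^o)).
  exact: gpow1_adjoins.
have := fl_exprs p (@submod_zero D D^o) f1; rewrite muln1 => fp.
rewrite -[(p ^ d)%N]mul1n.
apply: (@fl_gen D n (restr phi) L' _ _ [:: y ^+ p] _ hL' hL'' _ _ _ fp).
- by move=> z; rewrite inE => /eqP ->; apply: dadj_mem.
- move=> z a; rewrite inE => /eqP -> {z}; move: a.
  suff : adjoins [set 0 : D^o] [seq (x ^+ p : D^o) | x <- xs] `<=` [set a | L' (phi a * y ^+ p)] by [].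
  apply: adjoins_min.
  - split=> [|a a' /= h h'|a a' /= h].
    + by rewrite /= rmorph0 mul0r; exact: dsub0 hL'.
    + by rewrite rmorphD mulrDl; exact: dsubD hL' _ _.
    + by rewrite /GRing.scale /= rmorphM -mulrA; exact: dsubZ hL' _.
  - by move=> _ -> /=; rewrite rmorph0 mul0r; exact: dsub0 hL'.
  - move=> _ /mapP[x xin ->] /=; rewrite rmorphXn -exprMn; apply: FL; apply: frob_mem.
    exact: ny _ (gpow1_mem xin).
- by [].
Qed.

(** The p-th powers of K + b_e lie in K + b_{e+1}, and the gap between [frob C] and C is torsion, so
    it costs only the error term. *)
Lemma kappa_frob : exists k, forall e,
  (len (dsum K (b e.+1)) C <= p ^ d * len (dsum K (b e)) C + k * err e.+1)%N.
Proof.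
have [c c0 hc] := hfrob; have gC : fgen C by exists cs.
have [k hk] := fgen_torsion c0 gC; exists k => e; apply: dlen_le.
have [hK hKC] := cK; have hbe := (hb e.+1).1.
have fin : exists k0, dln k0 (dsum K (b e)) C.
  apply: (@fgen_fin C e) => //; first by apply: dsum_submod => //; case: (hb e).
  by move=> x y bx Cy; apply: (dsum_subr hK); rewrite mulrC; exact: (hb e).2.
have [k0 /dlenP f0] := fin.
have hS : dsub (dsum K (b e.+1)) by apply: dsum_submod.
apply: (fl_frob hS _ _ f0).
- by apply: dsum_min => //; exact: bC.
- apply: frob_min => // _ [x [y [Kx by_ ->]]]; rewrite exprDp1 //.
  exists (x ^+ p), (y ^+ p); split=> //; last exact: b_frob.
  have /prednK <- := p_gt0 pB; rewrite exprSr; apply: hKC => //; apply: C_X => //; exact: KC.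
- apply: hk; first exact: dsum_submod (frob_submod _ _ _).
  + by move=> y /hc h; apply: dsum_subr.
  + move=> x y bx Cy; apply: (dsum_subl (frob_submod _ _ _)); apply: (dsum_subr hK).
  by rewrite mulrC; exact: (hb e.+1).2.
Qed.

End FrobeniusBound.

(* Adjoining the generators [v] one at a time: each step multiplies a quotient
   C / K with K an ideal of C, and K is generically cut out by an idempotent. *)
Lemma filtration M0 (vs : seq B) : cm M0 -> fgen M0 -> exists M, exists g : nat -> nat, exists k,
  [/\ [/\ cm M, fgen M, M0 `<=` M & forall v, v \in vs -> M v],
   forall e, (g e.+1 <= p ^ d * g e + k * err e.+1)%N,
   forall e, (len (pr (b e) M0) M0 + g e <= len (pr (b e) M) M + k * err e)%N &
   forall X e, dsub X -> X `<=` M0 ->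
     (len (dsum X (pr (b e) M)) M <= len (dsum X (pr (b e) M0)) M0 + g e)%N].
Proof.
move=> cM0 gM0; elim: vs => [|v vs [M [g [k [[cM gM M0M vM] gS gl gu]]]]].
  by exists M0, (fun=> 0%N), 0%N; split=> [|e|e|X e _ _]; first (by split); rewrite ?muln0 ?mul0n ?addn0.
pose K := [set a | C a /\ M (a * v)].
have cK := stepK_cmod v cM; have [k1 hk1] := kappa_frob cK (fun x h => h.1).
have [k2 hk2] := step_lower v cM gM.
exists (ext M v), (fun e => g e + len (dsum K (b e)) C)%N, (k + k1 + k2)%N; split.
- split; [exact: ext_cmod|exact: ext_fgen|exact: subset_trans M0M (@sub_ext _ _)|].
  move=> z; rewrite inE => /orP[/eqP ->|/vM]; [exact: ext_mem|exact: sub_ext].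
- move=> e; rewrite mulnDr; apply: leq_trans (leq_add (gS e) (hk1 e)) _.
  by rewrite addnACA -mulnDl leq_add2l leq_mul2r leq_addr orbT.
- move=> e; rewrite addnA; apply: leq_trans (leq_add (gl e) (leqnn _)) _.
  rewrite addnAC; apply: leq_trans (leq_add (hk2 e) (leqnn _)) _.
  by rewrite -addnA -mulnDl leq_add2l leq_mul2r addnC addnAC leq_addr orbT.
- move=> X e hX XM0; have XM := subset_trans XM0 M0M.
  apply: leq_trans (step_upper v cM gM e hX XM) _.
  by rewrite addnA leq_add2r; apply: gu.
Qed.

End Filtration.

(** * Frobenius powers against ordinary powers *)

Section FrobeniusPowers.
Variable A : comNzRingType.
Implicit Types (I : set A) (gs : seq A).

Lemma ideal_gen_ideal (X : set A) : is_ideal (ideal_gen X).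
Proof. exact: span_submod. Qed.
Lemma ideal_gen_mem (X : set A) x : X x -> ideal_gen X x.
Proof. exact: (@span_sub A A^o). Qed.
Lemma ideal_gen_min (X I : set A) : is_ideal I -> (forall x, X x -> I x) -> ideal_gen X `<=` I.
Proof. exact: (@span_min A A^o). Qed.
Lemma pre_ideal I c : is_ideal I -> is_ideal [set x | I (c * x)].
Proof.
move=> hI; split=> [|x y|a x] /=; first by rewrite mulr0; apply: idl0.
  by rewrite mulrDr; apply: idlD.
by rewrite /GRing.scale /= mulrCA; apply: idlM.
Qed.

Lemma gpow_cons g gs N I : is_ideal I ->
  (forall i y, (i <= N)%N -> gpow gs (N - i) y -> I (g ^+ i * y)) -> gpow (g :: gs) N `<=` I.
Proof.
move=> hI hgI.
pose U n := ideal_gen [set z : A | exists i y, [/\ (i <= n)%N, gpow gs (n - i) y & z = g ^+ i * y]].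
suff : gpow (g :: gs) N `<=` U N.
  by move/subset_trans; apply; apply: ideal_gen_min => // _ [i [y [iN hy ->]]]; apply: hgI.
apply: gpow_min => [n||n h a hin].
- exact: ideal_gen_ideal.
- apply/seteqP; split=> // x _; rewrite -[x]mulr1; apply: (idlM _ (ideal_gen_ideal _)).
  by apply: ideal_gen_mem; exists 0%N, 1; split=> //; rewrite expr0 mulr1.
- move: a; suff : U n `<=` [set a | U n.+1 (h * a)] by [].
  have hU := ideal_gen_ideal [set z : A | exists i y, [/\ (i <= n.+1)%N, gpow gs (n.+1 - i) y & z = g ^+ i * y]].
  apply: ideal_gen_min; first exact: pre_ideal.
  move=> _ [i [y [iN hy ->]]] /=; apply: ideal_gen_mem.
  move: hin; rewrite inE => /orP[/eqP ->|hgs].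
    by exists i.+1, y; rewrite exprS mulrA.
  exists i, (h * y); rewrite mulrCA; split=> //; first exact: leqW.
  by rewrite subSn // gpowS; apply: gmul_mem => //; exact: gpow_ideal.
Qed.

(* Pigeonhole on exponents. *)
Lemma gpow_frob q N gs : (0 < q)%N ->
  gpow gs (q * (N + size gs)) `<=` ideal_gen [set z | exists2 y, gpow gs N y & z = y ^+ q].
Proof.
move=> q0; elim: gs N => [|g gs IH] N.
  case: N => [|N] z.
    move=> _; rewrite -[z]mulr1; apply: (idlM _ (ideal_gen_ideal _)).
    by apply: ideal_gen_mem; exists 1; rewrite ?expr1n.
  rewrite addn0; have -> : (q * N.+1 = (q * N.+1).-1.+1)%N by lia.
  by move=> ->; apply: idl0; apply: ideal_gen_ideal.
apply: gpow_cons; first exact: ideal_gen_ideal.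
move=> i y hi hy; have hG := ideal_gen_ideal [set z | exists2 y, gpow (g :: gs) N y & z = y ^+ q].
have g1 : g \in g :: gs by rewrite inE eqxx.
have ei := divn_eq i q; have := ltn_pmod i q0 => ri.
(* Either g alone supplies qN factors, or it supplies the quotient of i by q and [gs] the rest. The
   remainder of i modulo q is lost, once per generator; this is why [size gs] is added to N. *)
have [Ni|iN] := leqP N (i %/ q).
  have -> : g ^+ i * y = (g ^+ (i - q * N) * y) * (g ^+ N) ^+ q.
    rewrite mulrAC -exprM -exprD; congr (g ^+ _ * _).
    by rewrite mulnC subnK //; nia.
  apply: (idlM _ hG); apply: ideal_gen_mem; exists (g ^+ N) => //.
  by have := gpow_exp N (gpow1_mem g1); rewrite mul1n.
have hy' : gpow gs (q * (N - i %/ q + size gs)) y.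
  by apply: gpow_decr hy => /=; nia.
have -> : g ^+ i * y = g ^+ (i %% q) * (g ^+ (i %/ q * q) * y).
  by rewrite mulrA -exprD; congr (g ^+ _ * _); lia.
apply: (idlM _ hG).
move: y {hy} hy' => y /IH; move: y.
suff : ideal_gen [set z | exists2 y, gpow gs (N - i %/ q) y & z = y ^+ q] `<=`
  [set y | ideal_gen [set z | exists2 y, gpow (g :: gs) N y & z = y ^+ q] (g ^+ (i %/ q * q) * y)] by [].
apply: ideal_gen_min; first exact: pre_ideal.
move=> _ [y hy ->] /=; rewrite exprM -exprMn; apply: ideal_gen_mem; exists (g ^+ (i %/ q) * y) => //.
rewrite -[N](subnKC (ltnW iN)); apply: gpow_mul.
  by have := gpow_exp (i %/ q) (gpow1_mem g1); rewrite mul1n.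
apply: gpow_sub hy; apply: gpow1_min; first exact: gpow_ideal.
by move=> h hin; apply: gpow1_mem; rewrite inE hin orbT.
Qed.

End FrobeniusPowers.

(** * Almost decreasing lengths over a power series ring *)

Section Core.
Variables (D B : comNzRingType) (phi : {rmorphism D -> B}) (p : nat).
Hypothesis pB : p \in [pchar B].
Hypothesis hdom : forall a b : D, a * b = 0 -> a = 0 \/ b = 0.
Variables (xs : seq D).
Let d := size xs.
Let n : set D := gpow xs 1.
Hypothesis hres : forall a, ~ n a -> exists b, n (a * b - 1).
Hypothesis htorsion : forall c : D, c != 0 -> exists k, forall N,
  @fl D n D^o (k * N ^ d.-1) (adjoin (gpow xs N : set D^o) c) setT.
Variable us : seq B.
Hypothesis hfin : forall x, dadjs phi [set 0] us x.
Variable (fa : nat -> set B) (w : nat).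
Hypothesis fa_ideal : forall e, is_ideal (fa e).
Hypothesis fa_frob : forall e z, fa e z -> fa e.+1 (z ^+ p).
Hypothesis fa_low : forall e a, gpow xs (w * p ^ e) a -> fa e (phi a).
Hypothesis fa_shift : forall e0, exists2 x : D, x != 0 & forall e z, fa (e + e0)%N z ->
  ideal_gen [set t | exists2 y, fa e y & t = y ^+ (p ^ e0)] (phi x * z).

Local Notation err e := (p ^ (e * d.-1))%N.
Local Notation len := (dlen phi n).
Local Notation dln := (dfl phi n).

Lemma ideal_dsub (I : set B) : is_ideal I -> dsub phi I.
Proof.
move=> hI; apply: dsubP; [exact: idl0|by move=> x y; exact: idlD|].
by move=> a x; exact: idlM.
Qed.

Lemma fa_frobs e0 e z : fa e z -> fa (e + e0) (z ^+ (p ^ e0)).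
Proof.
elim: e0 => [|e0 IH]; first by rewrite addn0.
by move=> /IH h; rewrite addnS expnSr exprM; apply: fa_frob.
Qed.

(** [g] and [g'] add up the lengths of the quotients C/(K_i + b_e) met when B is reached by
    adjoining the module generators, starting from 0 and from K respectively. The upper and lower
    bounds of the filtration enclose the length of B/b_e B by [g]; started at K, they give the last
    two estimates. *)
Lemma core (K : set B) : is_ideal K -> (exists gs, K = gpow gs 1) ->
  exists e0 k, exists g g' : nat -> nat, 
   [/\ forall e, (g e.+1 <= p ^ d * g e + k * err e.+1)%N,
       forall e, (len (fa (e + e0)) setT <= g e)%N,
       forall e, (g e <= len (fa (e + e0)) setT + k * err e)%N,
       forall e, (len (pr phi (fa (e + e0)) K) K + g' e <= len (fa (e + e0)) setT + k * err e)%N &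
       forall e, (len (dsum K (fa (e + e0))) setT <= g' e)%N].
Proof.
move=> hK [gs Kgs]; have [e0 [r [hr rmin]]] := stable_exponent phi p us.
pose C := Ce phi p us e0; exists e0.
have hC : dsub phi C by apply: Ce_submod.
have C1 : C 1 by apply: (Ce1 pB hfin).
have CM x y : C x -> C y -> C (x * y) by apply: (CeM pB hfin).
have htor := stable_torsion hdom hr.
have hnil z k : C z -> z ^+ k = 0 -> dcl phi [set 0] z.
  exact: (stable_nilp pB hdom hfin hr rmin).
have hfr := stable_frob pB hdom hfin hr rmin.
have hgen := generic_idempotent hdom hC C1 CM htor hnil (ex_intro _ r hr).
pose q0 := (p ^ e0)%N.
have q0_gt0 : (0 < q0)%N by rewrite expn_gt0 (p_gt0 pB).
pose b e := pr phi [set t | exists2 y, fa e y & t = y ^+ q0] C.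
have bC e : b e `<=` C.
  by apply: pr_min => // _ y [x _ ->] Cy; apply: CM => //; apply: (Ce_mem pB hfin).
have hb e : cmod phi C (b e).
  by split; [exact: pr_submod|move=> c x Cc; apply: pr_stable => y; exact: CM].
have b_frob e z : b e z -> b e.+1 (z ^+ p).
  move: z; suff : b e `<=` [set z | b e.+1 (z ^+ p)] by [].
  apply: pr_min.
    apply: dsubP => [|x y|a x] /=.
    - by rewrite expr0n gtn_eqF ?(p_gt0 pB) //; exact: dsub0 (pr_submod _ _ _).
    - by rewrite (exprDp1 pB); exact: dsubD (pr_submod _ _ _).
    - by rewrite exprMn -rmorphXn; exact: dsubZ (pr_submod _ _ _).
  move=> _ y [x fx ->] Cy /=; rewrite exprMn exprAC; apply: pr_mem; last exact: (CeX pB hfin).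
  by exists (x ^+ p) => //; apply: fa_frob.
(* The summand d is the loss in [gpow_frob], one unit for each of the d variables. *)
pose w' := (q0 * (w + d))%N.
have b_low e a : gpow xs (w' * p ^ e) a -> b e (phi a).
  move=> ha; have : gpow xs (q0 * (w * p ^ e + size xs)) a.
    apply: gpow_decr ha; rewrite /w' -mulnA leq_mul2l mulnDl leq_add2l -/d leq_pmulr ?orbT //.
    by rewrite expn_gt0 (p_gt0 pB).
  move/(gpow_frob q0_gt0); move: a {ha}.
  suff : ideal_gen [set z | exists2 y, gpow xs (w * p ^ e) y & z = y ^+ q0] `<=` [set a | b e (phi a)] by [].
  apply: ideal_gen_min.
    split=> [|x y|a x] /=.
    - by rewrite rmorph0; exact: dsub0 (pr_submod _ _ _).
    - by rewrite rmorphD; exact: dsubD (pr_submod _ _ _).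
    - by rewrite /GRing.scale /= rmorphM; exact: dsubZ (pr_submod _ _ _).
  move=> _ [y hy ->] /=; rewrite -[phi _]mulr1; apply: pr_mem => //.
  by exists (phi y); [exact: fa_low|rewrite rmorphXn].
have cB M : is_ideal M -> cmod phi C M.
  by move=> hM; split; [exact: ideal_dsub|move=> c x _; exact: idlM].
have gB M : (exists gs, M = gpow gs 1) -> fgen phi M.
  move=> [ms Mms]; exists [seq u * m | u <- us, m <- ms].
  have h0 := dsub_zero phi; have hU := dadjs_submod [seq u * m | u <- us, m <- ms] h0.
  apply/seteqP; split; rewrite Mms.
    pose S := dadjs phi [set 0] [seq u * m | u <- us, m <- ms].
    have mS m x : m \in ms -> S (m * x).
      move=> min; suff : dadjs phi [set 0] us `<=` [set z | S (m * z)] by apply.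
      apply: dadjs_min; first exact: pre_mul_submod.
        by move=> _ -> /=; rewrite mulr0; exact: dsub0 hU.
      by move=> u uin /=; apply: dadjs_mem => //; rewrite mulrC; apply: allpairs_f.
    apply: gpow1_min => [|m min]; last by rewrite -[m]mulr1; apply: mS.
    split=> [|x y|c x]; [exact: dsub0 hU|exact: dsubD hU|].
    move: x; suff : S `<=` [set x | S (c * x)] by [].
    apply: dadjs_min; first exact: pre_mul_submod.
      by move=> _ -> /=; rewrite mulr0; exact: dsub0 hU.
    by move=> _ /allpairsP[[u m] /= [uin min ->]]; rewrite mulrA mulrC; apply: mS.
  apply: dadjs_min; first exact/ideal_dsub/gpow_ideal.
    by move=> _ ->; apply: idl0; exact: gpow_ideal.
  move=> _ /allpairsP[[u m] /= [uin min ->]].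
  exact: (@idlM B (gpow ms 1) u m (gpow_ideal _ _) (gpow1_mem min)).
have dfa e : is_ideal (fa e) by apply: fa_ideal.
have b_fa e M : is_ideal M -> pr phi (b e) M `<=` pr phi (fa (e + e0)) M.
  move=> hM; apply: pr_min; first exact: pr_submod.
  move=> x y bx My; move: x bx.
  suff : b e `<=` [set x | pr phi (fa (e + e0)) M (y * x)] by move=> h x /h /=; rewrite mulrC.
  apply: pr_min; first exact: pre_mul_submod (pr_submod _ _ _).
  move=> _ c [x fx ->] Cc /=; rewrite mulrCA; apply: pr_mem; first exact: fa_frobs.
  by rewrite mulrC; apply: idlM.
have [x x0 hx] := fa_shift e0.
have fa_b e z : fa (e + e0) z -> pr phi (b e) setT (phi x * z).
  move=> /hx; apply: ideal_gen_min.
    split=> [|u v|a u]; [exact: dsub0 (pr_submod _ _ _)|exact: dsubD (pr_submod _ _ _)|].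
    by apply: (@pr_stable D B phi (b e) setT a).
  move=> _ [y fy ->]; rewrite -[_ ^+ _]mulr1; apply: pr_mem => //.
  by rewrite -[_ ^+ _]mulr1; apply: pr_mem => //; exists y.
have prT e : pr phi (fa e) setT `<=` fa e.
  by apply: pr_min; [exact: ideal_dsub|move=> u v fu _; exact: (idlMr _ (dfa e) fu)].
have gT : exists gs : seq B, [set: B] = gpow gs 1.
  exists [:: 1]; apply/seteqP; split=> // z _; rewrite -[z]mul1r.
  by apply: (gmul_mem (@idlT B)) => //; rewrite inE eqxx.
have cT := cB _ (@idlT B); have fgT := gB _ gT.
have fin e : exists k, dln k (pr phi (b e) setT) setT.
  have [k hk] := pr_fin b_low e fgT (dsub_zero phi).
  by exists k; move: hk; rewrite dsum0.
have [k0 hk0] := fgen_torsion htorsion b_low x0 fgT.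
have fin' e : exists k, dln k (fa (e + e0)) setT.
  have [k fk] := fin e; exists k.
  by apply: dfl_mono fk; apply: subset_trans (b_fa e _ (@idlT B)) (prT _).
(* Multiplication by [phi x] maps B modulo [fa (e + e0)] to B modulo b_e B; its cokernel is killed
   by x and hence has the size of the error term. *)
have shift e : (len (pr phi (b e) setT) setT <= len (fa (e + e0)) setT + k0 * err e)%N.
  apply: dlen_le; have [_ /dlenP f] := fin' e; have hpr := pr_submod phi (b e) setT.
  apply: (@dfl_rel D B phi xs (fun z y => y = phi x * z) _ _ _ _ _ _ hpr _ _ _ _ f).
  - by move=> u v _ _ -> ->; rewrite mulrDr.
  - by move=> c u _ ->; rewrite mulrCA.
  - by move=> u _; exists (phi x * u).
  - by move=> u _ fu ->; apply: fa_b.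
  - have hxT := mul_set_submod (phi x) (dsubT phi).
    have hU := dsum_submod hpr hxT.
    apply: dfl_mono (hk0 e _ hU _ _).
    + by apply: (sum_mono (N := restr phi)) => // _ [u _ ->]; exists u.
    + by move=> y _; apply: (dsum_subr hpr); exists y.
    + by move=> u y bu _; apply: (dsum_subl hxT); apply: pr_mem.
have upper e : (len (fa (e + e0)) setT <= len (pr phi (b e) setT) setT)%N.
  have [_ /dlenP f] := fin e; apply: dlen_le; apply: dfl_mono f.
  exact: subset_trans (b_fa e _ (@idlT B)) (prT _).
have hcs : C = dadjs phi [set 0] [seq u ^+ (p ^ e0) | u <- us] by [].
have filt M0 := @filtration D B phi p pB hdom xs hres htorsion C hC C1 CM _ hcs hgen hfr b hb bC b_frob w' b_low M0 us.
have usT M1 : cmod phi C M1 -> (forall v, v \in us -> M1 v) -> M1 = setT.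
  move=> [hM1 _] uM; apply/seteqP; split=> // z _; move: (hfin z).
  by apply: dadjs_min => // _ ->; apply: dsub0 hM1.
have len0 X Y : Y `<=` X -> len X Y = 0%N.
  by move=> YX; apply/eqP; rewrite -leqn0; apply: (@dlen_le D B phi xs 0).
have h0 := dsub_zero phi.
have fg0 : fgen phi [set 0] by exists [::].
have [M [g [k [[cM _ _ usM] gS gl gu]]]] := filt _ (cB _ (@submod_zero B B^o)) fg0.
have {cM usM} eM := usT _ cM usM; rewrite {}eM in gl gu.
have [M' [g' [k' [[cM' _ _ usM'] _ gl' gu']]]] := filt _ (cB _ hK) (gB _ (ex_intro _ gs Kgs)).
have {cM' usM'} eM' := usT _ cM' usM'; rewrite {}eM' in gl' gu'.
exists (k0 + k + k')%N, g, g'.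
have err_le j e : (j <= k0 + k + k')%N -> (j * err e <= (k0 + k + k') * err e)%N.
  by move=> hj; rewrite leq_mul2r hj orbT.
split=> e.
- apply: leq_trans (gS e) _; rewrite leq_add2l; apply: err_le; lia.
- apply: leq_trans (upper e) _; have := gu _ e h0 (@subset_refl _ _); rewrite !dsum0.
  by rewrite [X in (_ <= X + _)%N]len0 // => _ ->; exact: dsub0 (pr_submod _ _ _).
- have := gl e; have := shift e; have := err_le (k0 + k)%N e (leq_addr _ _).
  rewrite -/d -/n !mulnDl; lia.
- have [_ /dlenP f] := pr_fin b_low e (gB _ (ex_intro _ gs Kgs)) h0; rewrite dsum0 in f.
  have h1 := dlen_le (dfl_mono (b_fa e K hK) f).
  have h2 : (k0 + k' <= k0 + k + k')%N by lia.
  move: h1 (gl' e) (shift e) (err_le _ e h2); rewrite -/d -/n !mulnDl; lia.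
- have hKd := ideal_dsub hK.
  have [_ /dlenP f] := pr_fin b_low e fgT hKd.
  apply: leq_trans (dlen_le (dfl_mono _ f)) _.
    apply: (sum_mono (N := restr phi)) => //.
    exact: subset_trans (b_fa e _ (@idlT B)) (prT _).
  have := gu' _ e hKd (@subset_refl _ _).
  by rewrite [X in (_ <= X + _)%N]len0 //; apply: dsum_subl (pr_submod _ _ _).
Qed.

End Core.

Definition pser (R : comNzRingType) : Type := nat -> R.

(** * Power series rings *)

Section PowerSeries.
Variable R : comNzRingType.
Local Notation S := (pser R).
Implicit Types f g h : S.

HB.instance Definition _ := gen_eqMixin S.
HB.instance Definition _ := gen_choiceMixin S.

Definition pser_add f g : S := fun n => f n + g n.
Definition pser_opp f : S := fun n => - f n.
Definition pser_mul f g : S := fun n => \sum_(i < n.+1) f i * g (n - i)%N.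
Definition pser_const (c : R) : S := fun n => if n is 0%N then c else 0.

Fact pser_addA : associative pser_add.
Proof. by move=> f g h; apply/funext => n; rewrite /pser_add addrA. Qed.
Fact pser_addC : commutative pser_add.
Proof. by move=> f g; apply/funext => n; rewrite /pser_add addrC. Qed.
Fact pser_add0 : left_id ((fun=> 0) : S) pser_add.
Proof. by move=> f; apply/funext => n; rewrite /pser_add add0r. Qed.
Fact pser_addN : left_inverse ((fun=> 0) : S) pser_opp pser_add.
Proof. by move=> f; apply/funext => n; rewrite /pser_add addNr. Qed.
HB.instance Definition _ := GRing.isZmodule.Build S pser_addA pser_addC pser_add0 pser_addN.

Definition ptrunc n f : {poly R} := \poly_(i < n) f i.

Lemma coef_ptrunc n f i : (i < n)%N -> (ptrunc n f)`_i = f i.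
Proof. by rewrite /ptrunc coef_poly => ->. Qed.

(** Coefficients below n depend only on truncations, so the ring laws follow from those of
    polynomials. *)
Lemma pser_mulE f g n i : (i < n)%N -> pser_mul f g i = (ptrunc n f * ptrunc n g)`_i.
Proof.
move=> ilt; rewrite coefM; apply: eq_bigr => j _; rewrite !coef_ptrunc //.
  by apply: leq_ltn_trans ilt; apply: leq_subr.
by apply: leq_ltn_trans ilt; rewrite -ltnS.
Qed.

Fact pser_mulA : associative pser_mul.
Proof.
move=> f g h; apply/funext => n; transitivity ((ptrunc n.+1 f * (ptrunc n.+1 g * ptrunc n.+1 h))`_n).
  rewrite coefM; apply: eq_bigr => j _; rewrite coef_ptrunc // (@pser_mulE _ _ n.+1) //.
  by rewrite ltnS leq_subr.
rewrite mulrA coefM; apply: eq_bigr => j _; rewrite (@pser_mulE _ _ n.+1) // coef_ptrunc //.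
by rewrite ltnS leq_subr.
Qed.
Fact pser_mulC : commutative pser_mul.
Proof.
by move=> f g; apply/funext => n; rewrite !(@pser_mulE _ _ n.+1) // mulrC.
Qed.
Fact pser_mul1 : left_id (pser_const 1) pser_mul.
Proof.
move=> f; apply/funext => n; rewrite /pser_mul big_ord_recl mul1r subn0 big1 ?addr0 // => i _.
by rewrite mul0r.
Qed.
Fact pser_mulD : left_distributive pser_mul (+%R : S -> S -> S).
Proof.
move=> f g h; apply/funext => n; rewrite /pser_mul -[RHS]big_split; apply: eq_bigr => i _.
exact: mulrDl.
Qed.
Fact pser_1neq0 : (pser_const 1 : S) != 0.
Proof. by apply/eqP => /(congr1 (fun f : S => f 0%N)) /eqP; rewrite oner_eq0. Qed.
HB.instance Definition _ := GRing.Zmodule_isComNzRing.Build S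
  pser_mulA pser_mulC pser_mul1 pser_mulD pser_1neq0.

Lemma pserD f g n : (f + g) n = f n + g n. Proof. by []. Qed.
Lemma pserB f g n : (f - g) n = f n - g n. Proof. by []. Qed.
Lemma pserM f g n : (f * g) n = \sum_(i < n.+1) f i * g (n - i)%N. Proof. by []. Qed.
Lemma pser0 n : (0 : S) n = 0. Proof. by []. Qed.
Lemma pser_sum I (r : seq I) (P : pred I) (F : I -> S) n :
  (\sum_(i <- r | P i) F i) n = \sum_(i <- r | P i) F i n.
Proof. by apply: (big_ind2 (fun (f : S) c => f n = c)) => // f _ g _ <- <-. Qed.

Fact pser_const_zmod : zmod_morphism pser_const.
Proof. by move=> a b; apply/funext => -[|n] //; rewrite pserB /= subrr. Qed.
Fact pser_const_monoid : monoid_morphism pser_const.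
Proof.
split=> // a b; apply/funext => n; rewrite pserM big_ord_recl big1 /= ?addr0.
  by case: n => //= n; rewrite mulr0.
by move=> i _; rewrite mul0r.
Qed.
HB.instance Definition _ := GRing.isZmodMorphism.Build R S pser_const pser_const_zmod.
HB.instance Definition _ := GRing.isMonoidMorphism.Build R S pser_const pser_const_monoid.

Definition pserX : S := fun n => (n == 1%N)%:R.
Definition pshift f : S := fun n => f n.+1.

Lemma pserXM f n : (pserX * f) n = if n is n'.+1 then f n' else 0.
Proof.
rewrite pserM; case: n => [|n]; first by rewrite big_ord1 mul0r.
rewrite big_ord_recl mul0r add0r big_ord_recl mul1r big1 ?addr0 ?subn1 //.
by move=> i _; rewrite mul0r.
Qed.

Lemma pserXnM f m n : (pserX ^+ m * f) n = if (n < m)%N then 0 else f (n - m)%N.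
Proof.
elim: m n => [|m IH] n; first by rewrite expr0 mul1r subn0.
by rewrite exprS -mulrA pserXM; case: n => // n; rewrite IH.
Qed.

Lemma pser_shift f : f = pser_const (f 0%N) + pserX * pshift f.
Proof. by apply/funext => -[|n]; rewrite pserD pserXM /= ?addr0 ?add0r. Qed.

Lemma pser_constM c f n : (pser_const c * f) n = c * f n.
Proof.
by rewrite pserM big_ord_recl subn0 big1 ?addr0 // => i _; rewrite mul0r.
Qed.

Hypothesis hdom : forall a b : R, a * b = 0 -> a = 0 \/ b = 0.

Lemma pser_lead f : f != 0 -> exists n, f n != 0 /\ exists g, f = pserX ^+ n * g /\ g 0%N = f n.
Proof.
move=> f0; have ex : exists n, f n != 0.
  apply: contrapT => nex; move/eqP: f0; apply; apply/funext => n; apply/eqP.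
  by apply: contrapT => /negP h; apply: nex; exists n.
have [n fn nmin] := ex_minnP ex; exists n; split=> //; exists (fun i => f (i + n)%N); split=> //.
apply/funext => i; rewrite pserXnM; case: ltnP => [ilt|le]; last by rewrite subnK.
by apply/eqP; apply: contraLR ilt => /nmin; rewrite -leqNgt.
Qed.

Lemma pser_dom f g : f * g = 0 -> f = 0 \/ g = 0.
Proof.
move=> fg; have [->|f0] := eqVneq f 0; [by left|have [->|g0] := eqVneq g 0; [by right|exfalso]].
have [m [fm [f' [ef f'0]]]] := pser_lead f0; have [n [gn [g' [eg g'0]]]] := pser_lead g0.
have : (f * g) (m + n)%N = 0 by rewrite fg.
rewrite ef eg mulrACA -exprD pserXnM ltnn subnn pserM big_ord1 subnn f'0 g'0.
by move/hdom => [] /eqP; apply/negP.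
Qed.

Variable xs : seq R.
Let Xs := pserX :: [seq pser_const x | x <- xs].

(** X counts for one factor, so coefficient i needs only N - i factors from [xs]; for i >= N the
    truncated difference is 0 and there is no condition. *)
Lemma gpow_pser N f : gpow Xs N f <-> forall i, gpow xs (N - i) (f i).
Proof.
split.
  move: f; suff : gpow Xs N `<=` [set f | forall i, gpow xs (N - i) (f i)] by [].
  have hI n : is_ideal [set f : S | forall i, gpow xs (n - i) (f i)].
    split=> [i|f g hf hg i|f g hg i]; rewrite /GRing.scale /=.
    - exact: idl0 (gpow_ideal _ _).
    - exact: idlD (gpow_ideal _ _) (hf i) (hg i).
    - rewrite pserM; apply: idl_sum; first exact: gpow_ideal.
      move=> j _; apply: (idlM _ (gpow_ideal _ _)); apply: gpow_decr (hg _); lia.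
  apply: (gpow_min hI) => [|n g a]; first by apply/seteqP.
  rewrite inE => /orP[/eqP ->|/mapP[x xin ->]] ha i.
    by rewrite pserXM; case: i => [|i]; [exact: idl0 (gpow_ideal _ _)|exact: ha].
  rewrite pser_constM; have [ni|ni] := leqP n.+1 i.
    by have -> : (n.+1 - i = 0)%N by lia.
  by rewrite subSn // gpowS; apply: gmul_mem => //; exact: gpow_ideal.
have cst n x : gpow xs n x -> gpow Xs n (pser_const x).
  suff : gpow xs n `<=` [set x | gpow Xs n (pser_const x)] by apply.
  apply: (@gpow_min _ _ (fun n => [set x | gpow Xs n (pser_const x)])) => //.
    move=> m; split=> [|a b|a b] /=.
    - rewrite rmorph0; exact: idl0 (gpow_ideal _ _).
    - rewrite rmorphD; exact: idlD (gpow_ideal _ _).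
    - rewrite /GRing.scale /= rmorphM; exact: idlM (gpow_ideal _ _).
  move=> m g a gin ha; change (gmul Xs (gpow Xs m) (pser_const (g * a))).
  rewrite rmorphM; apply: gmul_mem => //; first exact: gpow_ideal.
  by rewrite inE map_f ?orbT.
elim: N f => [//|N IH] f hf.
rewrite (pser_shift f); apply: (idlD (gpow_ideal _ _)).
  by apply: cst; have := hf 0%N; rewrite subn0.
rewrite gpowS; apply: gmul_mem; [exact: gpow_ideal|by rewrite inE eqxx|].
by apply: IH => i; apply: hf i.+1.
Qed.

End PowerSeries.

(** A filtration instead of the powers of an ideal: on a completion [M n] is a condition on
    representatives, and its comparison with extended ideals is a separate fact. [filt_lim] is
    completeness for sequences that no longer change modulo [M n] from index n on. *)
Record complete_filtration (B : comNzRingType) (M : nat -> set B) : Prop := {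
  filt_ideal : forall n, is_ideal (M n);
  filt0 : M 0%N = setT;
  filt_decr : forall n, M n.+1 `<=` M n;
  filt_mul : forall i j a b, M i a -> M j b -> M (i + j)%N (a * b);
  filt_sep : forall z, (forall n, M n z) -> z = 0;
  filt_lim : forall z : nat -> B, (forall n, M n (z n.+1 - z n)) ->
    exists l, forall n, M n (l - z n) }.

Section Filtered.
Variables (B : comNzRingType) (M : nat -> set B).
Hypothesis hM : complete_filtration M.

Lemma filt_le i j : (i <= j)%N -> M j `<=` M i.
Proof.
move=> /subnK <-; elim: (j - i)%N => // k IH.
exact: subset_trans (filt_decr hM (n := _)) IH.
Qed.

Lemma filt_eq x y : (forall n, M n (x - y)) -> x = y.
Proof. by move=> h; apply/eqP; rewrite -subr_eq0; apply/eqP/(filt_sep hM). Qed.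

Lemma filt_exp i a n : M i a -> M (i * n)%N (a ^+ n).
Proof.
move=> Ma; elim: n => [|n IH]; first by rewrite muln0 (filt0 hM).
by rewrite exprS mulnS; apply: (filt_mul hM).
Qed.

Lemma filt_gpow xs : (forall x, x \in xs -> M 1%N x) -> forall n, gpow xs n `<=` M n.
Proof.
move=> xM; apply: gpow_min; [exact: filt_ideal hM|exact: filt0 hM|].
by move=> n g a /xM hg ha; rewrite -add1n; apply: (filt_mul hM).
Qed.

End Filtered.

(* What is used of D = k[[xs]]; [psr_torsion] expresses that D / (c) has
   dimension smaller than D. *)
Record power_series_ring (k : fieldType) (D : comNzRingType)
    (xs : seq D) (kap : {rmorphism k -> D}) : Prop := {
  psr_dom : forall a b : D, a * b = 0 -> a = 0 \/ b = 0;
  psr_neq0 : forall x, x \in xs -> x != 0;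
  psr_res : forall a, exists c, gpow xs 1 (a - kap c);
  psr_sum : forall v : nat -> D, (forall j, gpow xs j (v j)) ->
    exists s, forall N, gpow xs N (s - \sum_(j < N) v j);
  psr_torsion : forall c : D, c != 0 -> exists K, forall N,
    @fl D (gpow xs 1) D^o (K * size xs * N ^ (size xs).-1)
      (adjoin (gpow xs N : set D^o) c) setT;
  psr_eval : forall (B : comNzRingType) (M : nat -> set B), complete_filtration M ->
    forall (psi : {rmorphism k -> B}) (ys : seq B), size ys = size xs ->
    (forall y, y \in ys -> M 1%N y) ->
    exists phi : {rmorphism D -> B}, (forall c, phi (kap c) = psi c) /\ map phi xs = ys }.

(** Without variables the factor [size xs] makes the bound in [psr_torsion] equal to 0, as it should
    be: a nonzero c is a unit of k. *)
Lemma power_series_ring0 (k : fieldType) : @power_series_ring k k [::] idfun.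
Proof.
split.
- by move=> a b /eqP; rewrite mulf_eq0 => /orP[] /eqP; [left|right].
- by [].
- by move=> a; exists a; rewrite subrr; apply: idl0 (gpow_ideal _ _).
- move=> v hv; exists (v 0%N) => -[|N] //; rewrite big_ord_recl big1 ?addr0 ?subrr.
    exact: idl0 (gpow_ideal _ _).
  by move=> i _; have := hv (lift ord0 i).
- move=> c c0; exists 0%N => N z _; exists (z / c); rewrite /GRing.scale /= divfK // subrr.
  exact: idl0 (gpow_ideal _ _).
- by move=> B M hM psi [] // _ _; exists psi.
Qed.

Section AddVariable.
Variables (k : fieldType) (D : comNzRingType) (xs : seq D) (kap : {rmorphism k -> D}).
Hypothesis hD : power_series_ring xs kap.
Let hdom := psr_dom hD.
Local Notation S := (pser D).
Let Xs : seq S := pserX D :: [seq pser_const x | x <- xs].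

Lemma pser_sum_complete (v : nat -> S) : (forall j, gpow Xs j (v j)) ->
  exists s, forall N, gpow Xs N (s - \sum_(j < N) v j).
Proof.
move=> hv; have hv' j i : gpow xs (j - i) (v j i) by exact: (gpow_pser _ _ _).1.
have /choice[s' hs'] : forall i, exists s, forall N, gpow xs N (s - \sum_(j < N) v (j + i)%N i).
  by move=> i; apply: (@psr_sum _ _ _ _ hD (fun j => v (j + i)%N i)) => j; have := hv' (j + i)%N i; rewrite addnK.
(* Coefficient i receives a finite sum from the terms of index below i, which need not be small, and
   a convergent series of D from the others. *)
exists (fun i => \sum_(j < i) v j i + s' i) => N; apply/gpow_pser => i.
rewrite pserB pser_sum.
have [Ni|/ltnW iN] := leqP N i; first by have -> : (N - i = 0)%N by apply/eqP; rewrite subn_eq0.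
have -> : \sum_(j < N) v j i = \sum_(j < i) v j i + \sum_(j < N - i) v (j + i)%N i.
  rewrite -!(big_mkord xpredT (fun j => v j i)) (@big_cat_nat _ _ _ i) //=; congr (_ + _).
  by rewrite -{1}[i]add0n big_addn big_mkord.
rewrite [X in gpow _ _ X](_ : _ = s' i - \sum_(j < N - i) v (j + i)%N i); last by ring.
exact: hs'.
Qed.

(** Write f = X^t g with g(0) nonzero. The quotient by X^t contributes t N^d. Modulo g, the power
    X^N vanishes, so the length is at most N times that of D/(g(0), (xs)^N), which is known by
    induction on the variables. *)
Lemma pser_torsion (f : S) : f != 0 -> exists K, forall N,
    @fl S (gpow Xs 1) S^o (K * size Xs * N ^ (size Xs).-1)
      (adjoin (gpow Xs N : set S^o) f) setT.
Proof.
move=> f0; have [t [ft [g [ef g0]]]] := pser_lead f0.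
rewrite -g0 in ft; have [K hK] := psr_torsion hD ft.
exists (t + K)%N => N /=; rewrite size_map.
set d := size xs in hK *.
pose L : set S^o := gpow Xs N; have hL : is_ideal L by apply: gpow_ideal.
have XXs : pserX D \in Xs by rewrite inE eqxx.
have m1 b : gpow Xs 1 b -> exists2 a, gpow xs 1 a & forall L' : set S^o, is_ideal L' -> L' (pserX D) -> L' (b - pser_const a).
  move=> /gpow_pser /(_ 0%N) h; exists (b 0%N) => // L' hL' LX.
  by rewrite {1}(pser_shift b) addrAC subrr add0r; apply: idlMr.
have B1 b : exists a, forall L' : set S^o, is_ideal L' -> L' (pserX D) -> L' (b - pser_const a).
  exists (b 0%N) => L' hL' LX.
  by rewrite {1}(pser_shift b) addrAC subrr add0r; apply: idlMr.
have cst a : gpow xs N a -> L (pser_const a).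
  move=> ha; apply/gpow_pser => -[|i]; rewrite ?subn0 //=; exact: idl0 (gpow_ideal _ _).
have push (L0 : set D^o) (L' : set S^o) n : is_ideal L' -> L' (pserX D) ->
    (forall a, L0 a -> L' (pser_const a)) ->
    @fl D (gpow xs 1) D^o n L0 setT -> @fl S (gpow Xs 1) S^o n L' setT.
  move=> hL' LX L0L; apply: (@fl_push D S _ _ (@pser_const D)) => //.
    by move=> b; have [a ha] := B1 b; exists a; apply: ha.
  by move=> b /m1[a ha h]; exists a => //; apply: h.
have fX : @fl S (gpow Xs 1) S^o (t * N ^ d) (adjoin L (pserX D ^+ t : S^o)) setT.
  apply: fl_expr => //; apply: (push (gpow xs N)).
  - exact: adjoin_submod.
  - exact: adjoin_mem.
  - by move=> a ha; apply: sub_adjoin; apply: cst.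
  - exact: fl_gpow.
have fg : @fl S (gpow Xs 1) S^o (N * (K * d * N ^ d.-1)) (adjoin L (g : S^o)) setT.
  have hLg : is_ideal (adjoin L (g : S^o)) by apply: adjoin_submod.
  have hLgX : is_ideal (adjoin (adjoin L (g : S^o)) (pserX D)) by apply: adjoin_submod.
  have := @push (adjoin (gpow xs N : set D^o) (g 0%N)) (adjoin (adjoin L (g : S^o)) (pserX D)) _ hLgX
    (adjoin_mem _ hLg) _ (hK N).
  move=> /(_ _)/fl_expr -/(_ N hLg); move=> h; apply: fl_mono (h _) => {h}.
    apply: adjoin_min => //; apply: sub_adjoin.
    by have := gpow_exp N (gpow1_mem XXs); rewrite mul1n.
  move=> a [c ha]; rewrite -(subrK (c * g 0%N) a) rmorphD rmorphM; apply: (idlD hLgX).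
    by do 2 apply: sub_adjoin; apply: cst.
  apply: (idlM _ hLgX).
  have e : pser_const (g 0%N) = g - pserX D * pshift g by rewrite {2}(pser_shift g) addrK.
  suff : adjoin (adjoin L (g : S^o)) (pserX D) (pser_const (g 0%N)) by [].
  rewrite e; apply: (idlB hLgX); first by apply: sub_adjoin; apply: adjoin_mem.
  by apply: (idlMr _ hLgX); apply: adjoin_mem.
have := fl_mul hL fX fg; rewrite -ef; apply: fl_leq => //; first exact: adjoin_submod.
case: (d) => [|d'] /=; first by rewrite !(muln0, mul0n, addn0, muln1, expn0) leq_addr.
by rewrite mulnCA -expnS -mulnDl leq_mul2r; apply/orP; right; nia.
Qed.

(** The image of f is the limit of its truncations evaluated at y. Limits are unique, so each
    morphism law has to be checked only modulo every [M n]. *)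
Lemma pser_eval (B : comNzRingType) (M : nat -> set B) : complete_filtration M ->
    forall (psi : {rmorphism k -> B}) (ys : seq B), size ys = size Xs ->
    (forall y, y \in ys -> M 1%N y) ->
    exists phi : {rmorphism S -> B},
      (forall c, phi (pser_const (kap c)) = psi c) /\ map phi Xs = ys.
Proof.
move=> hM psi [//|y ys] /= [sys] ysM; rewrite size_map in sys.
have My : M 1%N y by apply: ysM; rewrite inE eqxx.
have [|phi0 [phi0k phi0x]] := psr_eval hD hM psi sys.
  by move=> z zin; apply: ysM; rewrite inE zin orbT.
have hMi n := filt_ideal hM n.
pose ev (f : S) n := (map_poly phi0 (ptrunc n f)).[y].
have evS (f : S) n : ev f n.+1 = ev f n + phi0 (f n) * y ^+ n.
  have E m : ev f m = \sum_(i < m) phi0 (f i) * y ^+ i.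
    rewrite /ev (@horner_coef_wide _ m).
      by apply: eq_bigr => i _; rewrite coef_map coef_ptrunc.
    by apply: leq_trans (size_poly _ _) (size_poly _ _).
  by rewrite !E big_ord_recr.
have Myn n : M n (y ^+ n).
  elim: n => [|n IH]; first by rewrite (filt0 hM).
  by rewrite exprS -add1n; apply: (filt_mul hM).
have /choice[lim hlim] : forall f, exists l, forall n, M n (l - ev f n).
  move=> f; apply: (filt_lim hM) => n.
  by rewrite evS addrAC subrr add0r; apply: (idlM _ (hMi _)).
have limE f z : (forall n, M n (z - ev f n)) -> lim f = z.
  move=> hz; apply: (filt_eq hM) => n.
  have -> : lim f - z = (lim f - ev f n) - (z - ev f n) by ring.
  exact: idlB (hMi _) _ _.
have limZ : zmod_morphism lim.
  move=> f g; apply: limE => n.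
  have -> : ev (f - g) n = ev f n - ev g n.
    rewrite /ev -hornerN -hornerD -rmorphB; congr (map_poly _ _).[_].
    by apply/polyP => i; rewrite coefB !coef_poly; case: ifP; rewrite ?subrr.
  have -> : lim f - lim g - (ev f n - ev g n) = (lim f - ev f n) - (lim g - ev g n) by ring.
  exact: idlB (hMi _) _ _.
have limM : monoid_morphism lim.
  split.
    apply: limE => n; case: n => [|n]; first by rewrite (filt0 hM).
    have -> : ev 1 n.+1 = 1; last by rewrite subrr; apply: idl0.
    have -> : 1 = (1 : {poly B}).[y] by rewrite hornerC.
    rewrite /ev; congr (_.[_]); rewrite -(rmorph1 (map_poly phi0)); congr (map_poly _ _).
    by apply/polyP => i; rewrite coef_poly coef1; case: i => [|i] //=; case: ifP.
  move=> f g; apply: limE => n.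
  (* The product of the truncations differs from the truncated product by terms of degree at least
     n, hence by a multiple of y^n. *)
  have [r hr] : exists r, ev f n * ev g n = ev (f * g) n + r * y ^+ n.
    exists (map_poly phi0 (drop_poly n (ptrunc n f * ptrunc n g))).[y].
    rewrite /ev -hornerM -rmorphM -{1}(poly_take_drop n (ptrunc n f * ptrunc n g)).
    rewrite rmorphD rmorphM /= map_polyXn hornerD hornerM hornerXn; congr (_ + _).
    congr (map_poly _ _).[_]; apply/polyP => i; rewrite coef_take_poly coef_poly.
    by case: ifP => // ilt; rewrite -pser_mulE.
  have -> : lim f * lim g - ev (f * g) n =
    (lim f - ev f n) * lim g + ev f n * (lim g - ev g n) + r * y ^+ n.
    have -> : ev (f * g) n = ev f n * ev g n - r * y ^+ n by rewrite hr addrK.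
    by ring.
  apply: (idlD (hMi _)); last exact: idlM (hMi _) _.
  by apply: (idlD (hMi _)); [exact: idlMr (hMi _) _|exact: idlM (hMi _) _].
pose phi : {rmorphism S -> B} := HB.pack lim
  (GRing.isZmodMorphism.Build _ _ _ limZ) (GRing.isMonoidMorphism.Build _ _ _ limM).
have phiC c : phi (pser_const c) = phi0 c.
  apply: limE => n; case: n => [|n]; first by rewrite (filt0 hM).
  have -> : ev (pser_const c) n.+1 = phi0 c; last by rewrite subrr; apply: idl0.
  have -> : phi0 c = (phi0 c)%:P.[y] by rewrite hornerC.
  rewrite /ev -map_polyC; congr (map_poly _ _).[_].
  by apply/polyP => i; rewrite coef_poly coefC; case: i => [|i] //=; case: ifP.
exists phi; split=> [c|]; first by rewrite phiC.
congr (_ :: _); last first.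
  by rewrite -phi0x -map_comp; apply: eq_map => x /=; exact: phiC.
apply: limE => n; case: n => [|[|n]]; first by rewrite (filt0 hM).
  by rewrite evS /ev /ptrunc poly_def big_ord0 rmorph0 horner0 add0r rmorph0 mul0r subr0.
have -> : ev (pserX D) n.+2 = y; last by rewrite subrr; apply: idl0.
rewrite -[RHS](hornerX y) -(map_polyX phi0); congr (map_poly _ _).[_].
by apply/polyP => i; rewrite coef_poly coefX; case: i => [|[|i]] //=; case: ifP.
Qed.

Lemma power_series_ringS : power_series_ring Xs (@pser_const D \o kap).
Proof.
split.
- exact: pser_dom.
- move=> x; rewrite inE => /orP[/eqP ->|/mapP[z zin ->]].
    by apply/eqP => /(congr1 (fun f : S => f 1%N)) /eqP; rewrite oner_eq0.
  have := psr_neq0 hD zin; apply: contra => /eqP /(congr1 (fun f : S => f 0%N)) /= ->.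
  by rewrite pser0.
- move=> f; have [c hc] := psr_res hD (f 0%N); exists c; apply/gpow_pser => -[|i].
    by rewrite pserB.
  by rewrite subSS sub0n.
- exact: pser_sum_complete.
- exact: pser_torsion.
- exact: pser_eval.
Qed.

End AddVariable.

Lemma power_series_ring_exists (k : fieldType) d : exists (D : comNzRingType) (xs : seq D)
  (kap : {rmorphism k -> D}), size xs = d /\ power_series_ring xs kap.
Proof.
elim: d => [|d [D [xs [kap [sxs hD]]]]].
  by exists k, [::], idfun; split=> //; exact: power_series_ring0.
exists (pser D), (pserX D :: [seq pser_const x | x <- xs]), (@pser_const D \o kap).
by split; [rewrite /= size_map sxs|exact: power_series_ringS].
Qed.

(** * Subrings, quotients and completions *)

Section Subring.
Variables (A : comNzRingType) (P : set A).

Definition subring_axioms :=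
  [/\ P 1, forall x y, P x -> P y -> P (x - y) & forall x y, P x -> P y -> P (x * y)].

(* The proof argument lets canonical structure inference find the axioms. *)
Definition subring_pred (_ : subring_axioms) : pred A := fun x => `[< P x >].

Variable hP : subring_axioms.

Lemma subring_pred_closed : subring_closed (subring_pred hP).
Proof.
have [P1 PB PM] := hP.
split=> [|x y /asboolP Px /asboolP Py|x y /asboolP Px /asboolP Py]; apply/asboolP => //.
  exact: PB.
exact: PM.
Qed.

HB.instance Definition _ := GRing.isSubringClosed.Build A (subring_pred hP) subring_pred_closed.

Record subring := Subring { subring_val :> A; subring_valP : subring_val \in subring_pred hP }.

HB.instance Definition _ := [isSub for subring_val].
HB.instance Definition _ := [Choice of subring by <:].
HB.instance Definition _ := [SubChoice_isSubComNzRing of subring by <:].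

Fact subring_val_zmod : zmod_morphism subring_val. Proof. by []. Qed.
Fact subring_val_monoid : monoid_morphism subring_val. Proof. by []. Qed.
HB.instance Definition _ := GRing.isZmodMorphism.Build subring A subring_val subring_val_zmod.
HB.instance Definition _ := GRing.isMonoidMorphism.Build subring A subring_val subring_val_monoid.

Lemma subring_exists : exists (S : comNzRingType) (i : {rmorphism S -> A}),
  injective i /\ forall x, P x <-> exists y, i y = x.
Proof.
exists subring, subring_val; split; first exact: val_inj.
move=> x; split=> [Px|[y <-]]; last by have /asboolP := subring_valP y.
have xin : x \in subring_pred hP by apply/asboolP.
by exists (Subring xin).
Qed.

End Subring.

Section QuotientRing.
Variables (A : comNzRingType) (I : set A).
Hypotheses (hI : is_ideal I) (I1 : ~ I 1).

Definition ideal_set (_ : unit) : pred A := fun x => `[< I x >].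

Lemma ideal_set_closed u : idealr_closed (ideal_set u).
Proof.
split; first by apply/asboolP; exact: idl0.
  by apply/asboolP.
by move=> a x y /asboolP Ix /asboolP Iy; apply/asboolP; apply: (idlD hI) => //; apply: (idlM _ hI).
Qed.

Lemma quotient_exists : exists (Q : comNzRingType) (q : {rmorphism A -> Q}),
  (forall y, exists x, q x = y) /\ forall x, q x = 0 <-> I x.
Proof.
pose f1 := isIdealr.Build A (ideal_set tt) (ideal_set_closed tt).
pose J : idealr A := HB.pack (ideal_set tt) f1.
pose q : {rmorphism A -> Quotient.quot J} := \pi_(Quotient.quot J).
exists (Quotient.quot J), q; split=> [y|x]; first by exists (repr y); exact: reprK.
have E : q x = q 0 <-> I x.
  split=> [/eqP|Ix]; first by rewrite -Quotient.idealrBE subr0 => /asboolP.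
  by apply/eqP; rewrite -Quotient.idealrBE subr0; apply/asboolP.
by rewrite rmorph0 in E.
Qed.

End QuotientRing.

(** * Completion by rapidly Cauchy sequences *)

Section Completion.
Variables (A : comNzRingType) (gs : seq A).
Hypothesis proper : ~ gpow gs 1 1.

Record completion_of (B : comNzRingType) (M : nat -> set B) (iota : {rmorphism A -> B}) : Prop := {
  cpl_filt : complete_filtration M;
  cpl_mem : forall n a, M n (iota a) <-> gpow gs n a;
  cpl_dense : forall n b, exists a, M n (b - iota a) }.

(** The term z n is already final modulo (gs)^n, so it alone decides whether the limit lies in
    [M n]. *)
Definition fast (z : nat -> A) := forall n, gpow gs n (z n.+1 - z n).

Lemma fast_le z i j : fast z -> (i <= j)%N -> gpow gs i (z j - z i).
Proof.
move=> hz /subnK <-; elim: (j - i)%N => [|k IH]; first by rewrite subrr; apply: idl0 (gpow_ideal _ _).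
rewrite -(subrKA (z (k + i)%N)); apply: (idlD (gpow_ideal _ _)) => //.
by rewrite addSn; apply: gpow_decr (hz _); rewrite leq_addl.
Qed.

Lemma completion_exists : exists (B : comNzRingType) (M : nat -> set B) (iota : {rmorphism A -> B}),
  completion_of M iota.
Proof.
have hg n := gpow_ideal gs n.
have [|F [i [inj_i hF]]] := @subring_exists (nat -> A : comNzRingType) [set z | fast z].
  split=> [n|x y hx hy n|x y hx hy n] /=.
  - by rewrite subrr; apply: idl0.
  - suff : gpow gs n ((x n.+1 - y n.+1) - (x n - y n)) by [].
    have -> : (x n.+1 - y n.+1) - (x n - y n) = (x n.+1 - x n) - (y n.+1 - y n) by ring.
    exact: idlB.
  - suff : gpow gs n (x n.+1 * y n.+1 - x n * y n) by [].
    have -> : x n.+1 * y n.+1 - x n * y n = (x n.+1 - x n) * y n.+1 + x n * (y n.+1 - y n) by ring.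
    by apply: (idlD (hg n)); [exact: idlMr|exact: idlM].
have fi (f : F) : fast (i f) by apply/hF; exists f.
pose N : set F := [set f | forall n, gpow gs n (i f n)].
have hN : is_ideal N.
  split=> [n|x y hx hy n|a x hx n].
  - by rewrite rmorph0; apply: idl0.
  - by rewrite rmorphD; apply: idlD (hx n) (hy n).
  - by rewrite /GRing.scale /= rmorphM; apply: idlM (hx n).
have N1 : ~ N 1 by move=> /(_ 1%N); rewrite rmorph1.
have [B [q [qs qk]]] := quotient_exists hN N1.
pose M n : set B := [set b | exists2 f, q f = b & gpow gs n (i f n)].
have ME n f : M n (q f) <-> gpow gs n (i f n).
  split=> [[g qg hg']|h]; last by exists f.
  have : N (f - g) by apply/qk; rewrite rmorphB qg subrr.
  move=> /(_ n) h; rewrite -(subrK (i g n) (i f n)); apply: (idlD (hg n)) => //.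
  by move: h; rewrite rmorphB.
have cst_fast a : fast (fun=> a) by move=> n; rewrite subrr; apply: idl0.
have /choice[cst hcst] : forall a, exists f : F, i f = (fun=> a).
  by move=> a; have /hF := cst_fast a.
have cz : zmod_morphism cst.
  by move=> a b; apply: inj_i; rewrite rmorphB !hcst.
have cm : monoid_morphism cst.
  by split=> [|a b]; apply: inj_i; rewrite ?rmorph1 ?rmorphM !hcst.
pose c : {rmorphism A -> F} := HB.pack cst
  (GRing.isZmodMorphism.Build _ _ _ cz) (GRing.isMonoidMorphism.Build _ _ _ cm).
exists B, M, (q \o c); split.
- split.
  + move=> n; split.
    * by exists 0; rewrite rmorph0 //; exact: idl0.
    * move=> _ _ [f <- hf] [g <- hg']; exists (f + g); rewrite rmorphD //; exact: idlD hf hg'.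
    * move=> b _ [f <- hf]; have [g <-] := qs b; exists (g * f); rewrite rmorphM //.
      exact: idlM hf.
  + by apply/seteqP; split=> // b _; have [f <-] := qs b; exists f.
  + move=> n _ [f <- hf]; apply/ME; rewrite -(subKr (i f n.+1) (i f n)).
    by apply: (idlB (hg n)); [exact: gpow_decr hf|exact: fi].
  + move=> j k _ _ [f <- hf] [g <- hg']; rewrite -rmorphM; apply/ME; rewrite rmorphM.
    apply: gpow_mul.
      by rewrite -(subrK (i f j) (i f _)); apply: (idlD (hg j)) => //; apply: fast_le => //; apply: leq_addr.
    by rewrite -(subrK (i g k) (i g _)); apply: (idlD (hg k)) => //; apply: fast_le => //; apply: leq_addl.
  + move=> z hz; have [f ef] := qs z; rewrite -ef in hz *; apply/qk => n; exact/ME.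
  + move=> z hz; have /choice[f hf] := fun n => qs (z n).
    (* The limit is the diagonal: the n-th term of the n-th representative. *)
    have hl : fast (fun n => i (f n) n).
      move=> n; rewrite -(subrKA (i (f n.+1) n)); apply: (idlD (hg n)); first exact: fi.
      by have := hz n; rewrite -!hf -rmorphB => /ME; rewrite rmorphB.
    have /hF[l el] := hl; exists (q l) => n; rewrite -hf -rmorphB; apply/ME.
    rewrite rmorphB el; suff : gpow gs n (i (f n) n - i (f n) n) by [].
    by rewrite subrr; apply: idl0.
- by move=> n a; rewrite /= (ME n (c a)) /= hcst.
- move=> n b; have [f <-] := qs b; exists (i f n); rewrite /= -rmorphB; apply/ME.
  rewrite rmorphB /= hcst; suff : gpow gs n (i f n - i f n) by [].
  by rewrite subrr; apply: idl0.
Qed.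

Section CompletionTheory.
Variables (B : comNzRingType) (M : nat -> set B) (iota : {rmorphism A -> B}).
Hypothesis hB : completion_of M iota.
Let hM := cpl_filt hB.
Let hMi n := filt_ideal hM n.

Lemma gpow_add_sub xs t i : gpow gs t `<=` gpow xs 1 -> gpow gs (t + i) `<=` gmul xs (gpow gs i).
Proof.
move=> sub; elim: i => [|i IH]; first by rewrite addn0; exact: sub.
rewrite addnS; have hI : is_ideal (gmul xs (gpow gs i.+1)) by apply: gmul_ideal; apply: gpow_ideal.
apply: gmul_min => // g a gin /IH; move: a.
suff : gmul xs (gpow gs i) `<=` [set a | gmul xs (gpow gs i.+1) (g * a)] by [].
apply: gmul_min; first exact: pre_ideal.
move=> x a xin ha /=; rewrite mulrCA; apply: gmul_mem => //; first by apply: gmul_ideal; apply: gpow_ideal.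
by apply: gmul_mem => //; exact: gpow_ideal.
Qed.

(** Each generator in [xs] gets its own series of coefficients, with i-th term in (gs)^i; these
    series converge in B, and b is the combination of their sums. *)
Lemma sum_in_extension xs (dl : nat -> A) b :
  (forall i, gmul xs (gpow gs i) (dl i)) ->
  (forall n, M n (b - iota (\sum_(i < n) dl i))) -> gpow (map iota xs) 1 b.
Proof.
elim: xs dl b => [|x xs IH] dl b hdl hb /=.
  apply: (filt_sep hM) => n; have := hb n; rewrite big1 ?rmorph0 ?subr0 // => i _.
  exact: hdl.
have /choice[a ha] := hdl; have /choice[dl' hdl'] := ha.
have [s hs] : exists s, forall n, M n (s - iota (\sum_(i < n) a i)).
  apply: (filt_lim hM (z := fun n => iota (\sum_(i < n) a i))) => n.
  rewrite -rmorphB big_ord_recr /= addrAC subrr add0r; apply/(cpl_mem hB).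
  by have [] := hdl' n.
exists s, (b - iota x * s); split=> //; last by rewrite addrC subrK.
apply: (IH dl') => [i|n]; first by have [] := hdl' i.
have -> : \sum_(i < n) dl' i = \sum_(i < n) dl i - x * \sum_(i < n) a i.
  rewrite mulr_sumr -sumrB; apply: eq_bigr => i _; have [_ _ ->] := hdl' i.
  by rewrite addrAC subrr add0r.
rewrite rmorphB rmorphM.
have -> : b - iota x * s - (iota (\sum_(i < n) dl i) - iota x * iota (\sum_(i < n) a i)) =
  (b - iota (\sum_(i < n) dl i)) - iota x * (s - iota (\sum_(i < n) a i)) by ring.
apply: (idlB (hMi _)) => //; exact: idlM.
Qed.

(** An element b of [M t] is the sum of the successive differences of approximations from A taken t
    steps ahead; the i-th difference lies in (gs)^(t+i), hence in the product of (xs) with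
    (gs)^i. *)
Lemma filt_sub_extension xs t : gpow gs t `<=` gpow xs 1 -> M t `<=` gpow (map iota xs) 1.
Proof.
move=> sub b Mb; have /choice[a ha] := fun n => cpl_dense hB (t + n) b.
have hd n m : (m <= n)%N -> gpow gs (t + m) (a n - a m).
  move=> mn; apply/(cpl_mem hB); rewrite rmorphB.
  have -> : iota (a n) - iota (a m) = (b - iota (a m)) - (b - iota (a n)) by ring.
  by apply: (idlB (hMi _)) => //; apply: (filt_le hM _ (ha n)); rewrite leq_add2l.
apply: (@sum_in_extension xs (fun i => if i is 0%N then a 1%N else a i.+1 - a i)).
  move=> i; apply: (gpow_add_sub sub); case: i => [|i]; last exact: hd.
  rewrite addn0; apply/(cpl_mem hB); rewrite -(subKr b (iota _)); apply: (idlB (hMi _)) => //.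
  by apply: (filt_le hM _ (ha 1%N)); rewrite leq_addr.
case=> [|n]; first by rewrite (filt0 hM).
suff -> : \sum_(i < n.+1) (if val i is 0%N then a 1%N else a i.+1 - a i) = a n.+1.
  by apply: (filt_le hM _ (ha _)); rewrite leq_addl.
elim: n => [|n IH]; first by rewrite big_ord1.
by rewrite big_ord_recr /= IH addrC subrK.
Qed.

End CompletionTheory.
End Completion.

Section GeneratedSubring.
Variables (A : comNzRingType) (p : nat).
Hypothesis pA : p \in [pchar A].
Implicit Types (C P : set A) (ss : seq A).
Local Notation subring_ax := (@subring_axioms A).

Lemma sub1 P : subring_ax P -> P 1. Proof. by case. Qed.
Lemma subB P x y : subring_ax P -> P x -> P y -> P (x - y). Proof. by case=> _ + _; apply. Qed.
Lemma subM P x y : subring_ax P -> P x -> P y -> P (x * y). Proof. by case=> _ _; apply. Qed.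
Lemma sub0 P : subring_ax P -> P 0. Proof. by move=> hP; rewrite -(subrr 1); apply: subB => //; exact: sub1. Qed.
Lemma subN P x : subring_ax P -> P x -> P (- x).
Proof. by move=> hP Px; rewrite -sub0r; apply: subB => //; exact: sub0. Qed.
Lemma subD P x y : subring_ax P -> P x -> P y -> P (x + y).
Proof. by move=> hP Px Py; rewrite -[y]opprK; apply: subB => //; exact: subN. Qed.
Lemma subX P x n : subring_ax P -> P x -> P (x ^+ n).
Proof.
move=> hP Px; elim: n => [|n IH]; first by rewrite expr0; exact: sub1.
by rewrite exprS; apply: subM.
Qed.
Lemma sub_sum P I (r : seq I) (Q : pred I) (F : I -> A) : subring_ax P ->
  (forall i, Q i -> P (F i)) -> P (\sum_(i <- r | Q i) F i).
Proof.
move=> hP hF; elim/big_ind: _ => //; first exact: sub0.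
by move=> x y; apply: subD.
Qed.

Definition gensub (X : set A) : set A := smallest subring_ax X.

Lemma gensub_axioms X : subring_ax (gensub X).
Proof.
split=> [P [hP _]|x y hx hy P hPX|x y hx hy P hPX]; first exact: sub1.
  by apply: subB; [exact: hPX.1|exact: hx|exact: hy].
by apply: subM; [exact: hPX.1|exact: hx|exact: hy].
Qed.
Lemma gensub_sub X x : X x -> gensub X x.
Proof. by move=> Xx P [_]; apply. Qed.
Lemma gensub_min X P : subring_ax P -> (forall x, X x -> P x) -> gensub X `<=` P.
Proof. by move=> hP XP x; apply. Qed.

(** The ring C^p[ss]; with C the whole of a field k it is the subfield k^p(ss). *)
Definition Rg C ss : set A := gensub ([set x ^+ p | x in C] `|` [set` ss]).

Lemma Rg_axioms C ss : subring_ax (Rg C ss). Proof. exact: gensub_axioms. Qed.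
Lemma Rg_pow C ss x : C x -> Rg C ss (x ^+ p).
Proof. by move=> Cx; apply: gensub_sub; left; exists x. Qed.
Lemma Rg_mem C ss s : s \in ss -> Rg C ss s.
Proof. by move=> hs; apply: gensub_sub; right. Qed.
Lemma Rg_min C ss P : subring_ax P -> (forall x, C x -> P (x ^+ p)) ->
  (forall s, s \in ss -> P s) -> Rg C ss `<=` P.
Proof. by move=> hP h1 h2; apply: gensub_min => // _ [[x Cx <-]|/h2//]; apply: h1. Qed.
Lemma Rg_mono C C' ss ss' : C `<=` C' -> {subset ss <= ss'} -> Rg C ss `<=` Rg C' ss'.
Proof.
move=> CC sss; apply: Rg_min; first exact: Rg_axioms.
  by move=> x /CC; apply: Rg_pow.
by move=> s /sss; apply: Rg_mem.
Qed.

Lemma Rg_nil C z : subring_ax C -> Rg C [::] z -> exists2 w, C w & z = w ^+ p.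
Proof.
move=> hC; move: z; suff : Rg C [::] `<=` [set z | exists2 w, C w & z = w ^+ p] by [].
apply: Rg_min => [|x Cx|//]; last by exists x.
split=> [|_ _ [x Cx ->] [y Cy ->]|_ _ [x Cx ->] [y Cy ->]].
- by exists 1; [exact: sub1|rewrite expr1n].
- by exists (x - y); [exact: subB|rewrite (exprBp1 pA)].
- by exists (x * y); [exact: subM|rewrite exprMn].
Qed.

(** As s^p lies in C^p, collecting exponents modulo p reduces a polynomial in s over [Rg C ss] to
    degree below p. *)
Lemma Rg_cons C s ss z : C s -> Rg C (s :: ss) z ->
  exists c : nat -> A, (forall i, Rg C ss (c i)) /\ z = \sum_(i < p) c i * s ^+ i.
Proof.
move=> Cs; have hR := Rg_axioms C ss.
have p0 : (0 < p)%N by apply: p_gt0 pA.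
pose T := [set z | exists q : {poly A}, (forall i, Rg C ss q`_i) /\ z = q.[s]].
have hT : Rg C (s :: ss) `<=` T.
  apply: Rg_min.
  - split.
    + by exists 1; split=> [i|]; rewrite ?hornerC // coef1; case: eqP => _; [exact: sub1 hR|exact: sub0 hR].
    + move=> _ _ [q [hq ->]] [r [hr ->]]; exists (q - r); rewrite hornerD hornerN; split=> // i.
      by rewrite coefB; exact: subB hR _ _.
    + move=> _ _ [q [hq ->]] [r [hr ->]]; exists (q * r); rewrite hornerM; split=> // i.
      by rewrite coefM; apply: (@sub_sum (Rg C ss)) => // j _; exact: subM hR _ _.
  - move=> x Cx; exists (x ^+ p)%:P; rewrite hornerC; split=> // i.
    by rewrite coefC; case: eqP => _; [exact: Rg_pow|exact: sub0 hR].
  - move=> x; rewrite inE => /orP[/eqP ->|xin].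
      exists 'X; rewrite hornerX; split=> // i.
      by rewrite coefX; case: eqP => _; [exact: sub1 hR|exact: sub0 hR].
    exists x%:P; rewrite hornerC; split=> // i.
    by rewrite coefC; case: eqP => _; [exact: Rg_mem|exact: sub0 hR].
move=> /hT[q [hq ->]]; rewrite horner_coef.
exists (fun r => \sum_(i < size q | (i %% p)%N == r) q`_i * (s ^+ p) ^+ (i %/ p)); split.
  by move=> r; apply: (@sub_sum (Rg C ss)) => // i _; apply: (subM hR) => //; apply: (subX _ hR); exact: Rg_pow.
rewrite (partition_big (fun i : 'I_(size q) => Ordinal (ltn_pmod i p0)) predT) //=.
apply: eq_bigr => r _; rewrite mulr_suml; apply: eq_big => i; first by rewrite -val_eqE.
move=> /eqP <- /=; rewrite -mulrA -exprM -exprD; congr (_ * s ^+ _).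
by rewrite mulnC -divn_eq.
Qed.

End GeneratedSubring.

(** * Coefficient fields in characteristic p *)

Section PurelyInseparable.
Variables (k : fieldType) (p : nat).
Hypothesis pk : p \in [pchar k].
Variable G : set k.
Hypotheses (hG : subring_axioms G) (Gp : forall x, G (x ^+ p)).

Lemma subfield_inv x : G x -> G x^-1.
Proof.
move=> Gx; have [->|x0] := eqVneq x 0; first by rewrite invr0; exact: sub0.
have -> : x^-1 = x ^+ p.-1 * (x^-1) ^+ p.
  have /prednK {2}<- := p_gt0 pk.
  by rewrite exprSr mulrA -exprMn divff // expr1n mul1r.
by apply: subM => //; exact: subX.
Qed.

(* The minimal polynomial of s over G divides X^p - s^p = (X - s)^p. *)
Lemma inseparable_free s (q : {poly k}) : ~ G s -> (forall i, G q`_i) ->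
  (size q <= p)%N -> q.[s] = 0 -> q = 0.
Proof.
move=> nGs Gq sq qs; apply/eqP; apply: contrapT => /negP q0.
have [S [i [inj_i hS]]] := subring_exists hG.
have mi0 (f : {poly S}) : map_poly i f = 0 -> f = 0.
  move=> h; apply/polyP => j; apply: inj_i; rewrite coef0 rmorph0.
  by have /(congr1 (fun r : {poly k} => r`_j)) := h; rewrite coef_map coef0.
have szi (f : {poly S}) : size (map_poly i f) = size f by apply: size_map_inj_poly => //; exact: rmorph0.
have lift (f : {poly k}) : (forall j, G f`_j) -> exists f' : {poly S}, map_poly i f' = f.
  move=> Gf; have /choice[c hc] : forall j, exists y, i y = f`_j by move=> j; apply/hS.
  exists (\poly_(j < size f) c j); apply/polyP => j; rewrite coef_map coef_poly.
  by case: ltnP => [_|sj]; [exact: hc|rewrite [RHS]nth_default //; exact: rmorph0].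
have [q' eq'] := lift q Gq.
have ex : exists n, `[< exists h : {poly S}, [/\ h != 0, (map_poly i h).[s] = 0 & size h = n] >].
  exists (size q'); apply/asboolP; exists q'; split=> //; last by rewrite eq'.
  by apply: contra q0 => /eqP q'0; rewrite -eq' q'0 rmorph0.
have [n /asboolP[h [h0 hs hn]] nmin] := ex_minnP ex.
have np : (n <= p)%N.
  apply: leq_trans (nmin (size q') _) _; last by rewrite -szi eq'.
  apply/asboolP; exists q'; split=> //; last by rewrite eq'.
  by apply: contra q0 => /eqP q'0; rewrite -eq' q'0 rmorph0.
have [c hc] : exists c, i c = (i (lead_coef h))^-1.
  by apply/hS; apply: subfield_inv; apply/hS; exists (lead_coef h).
have cl : c * lead_coef h = 1.
  apply: (inj_i); rewrite rmorphM rmorph1 hc mulVf // -(rmorph0 i) (inj_eq inj_i).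
  by rewrite lead_coef_eq0.
pose h' := c *: h.
have lh : h'`_(size h).-1 = 1 by rewrite coefZ -lead_coefE.
have sh : size h' = size h.
  apply/eqP; rewrite eqn_leq size_scale_leq -(prednK (n := size h)) ?lt0n ?size_poly_eq0 //.
  rewrite ltnNge; apply/negP => /(nth_default 0) e.
  by move/eqP: lh; rewrite [_`_ _]e eq_sym oner_eq0.
have mon : h' \is monic by rewrite monicE lead_coefE sh lh.
have h's : (map_poly i h').[s] = 0 by rewrite map_polyZ hornerZ hs mulr0.
have [t ht] : exists t, i t = s ^+ p by apply/hS.
pose f : {poly S} := 'X^p - t%:P.
have mf : map_poly i f = ('X - s%:P) ^+ p.
  have pkX : p \in [pchar {poly k}] by rewrite pchar_poly.
  by rewrite (exprBp1 pkX) rmorphB /= map_polyXn map_polyC /= ht polyC_exp.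
have := Pdiv.RingMonic.rdivp_eq mon f.
set Q := Pdiv.Ring.rdivp f h'; set r := Pdiv.Ring.rmodp f h' => eqf.
have r0 : r = 0.
  apply/eqP; apply: contrapT => /negP rn0.
  have : (size r < n)%N by rewrite -hn -sh Pdiv.Ring.ltn_rmodp -size_poly_eq0 sh size_poly_eq0.
  rewrite ltnNge => /negP; apply; apply: nmin; apply/asboolP; exists r; split=> //.
  have : (map_poly i f).[s] = 0.
    by rewrite mf horner_exp hornerXsubC subrr expr0n gtn_eqF // (p_gt0 pk).
  by rewrite eqf rmorphD rmorphM hornerD hornerM h's mulr0 add0r.
have dv : map_poly i h' %| ('X - s%:P) ^+ p.
  by rewrite -mf eqf r0 addr0 rmorphM dvdp_mull.
have mon' : map_poly i h' \is monic by rewrite monic_map.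
have /dvdp_exp_XsubCP[e ep] := dv.
rewrite eqp_monic ?monic_exp ?monicXsubC // => /eqP he.
have en : n = e.+1 by rewrite -hn -sh -szi he size_exp_XsubC.
have e0 : (0 < e)%N.
  rewrite lt0n; apply/eqP => e0; move: h's; rewrite he e0 expr0 hornerC => /eqP.
  by rewrite oner_eq0.
(* The minimal polynomial is (X - s)^e, and its second coefficient -es recovers s, since 0 < e < p
   makes e invertible. *)
have sum : (map_poly i h')`_e.-1 = - (s *+ e).
  have := @coefPn_prod_XsubC k (nseq e s); rewrite size_nseq big_nseq big_nseq.
  by rewrite iter_addr_0 iter_mulr_1 -he -lt0n => /(_ e0).
have eu : e%:R != 0 :> k.
  have : (e < p)%N by rewrite -ltnS -en ltnS in np *; exact: np.
  by move=> elt; rewrite -(dvdn_pcharf pk) gtnNdvd.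
apply: nGs; have -> : s = (- (map_poly i h')`_e.-1) * (e%:R)^-1.
  by rewrite sum opprK -[s *+ e]mulr_natr mulfK.
apply: (subM hG).
  by apply: (subN hG); apply/hS; exists h'`_e.-1; rewrite coef_map.
by apply: subfield_inv; elim: (e) => [|m IH]; [exact: sub0|rewrite -natr1; apply: subD => //; exact: sub1].
Qed.
End PurelyInseparable.

(** * Existence of p-bases *)

Section PBasis.
Variables (k : fieldType) (p : nat).
Hypothesis pk : p \in [pchar k].
Local Notation F ss := (@Rg k p setT ss).

Lemma F_pow ss x : F ss (x ^+ p). Proof. exact: Rg_pow. Qed.

Lemma free_coefs (G : set k) s (c : nat -> k) : subring_axioms G -> (forall x, G (x ^+ p)) ->
  ~ G s -> (forall i, G (c i)) -> \sum_(i < p) c i * s ^+ i = 0 ->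
  forall i, (i < p)%N -> c i = 0.
Proof.
move=> hG Gp nGs Gc sum0 i ip.
have /polyP/(_ i) : \poly_(i < p) c i = 0; last by rewrite coef_poly ip coef0.
apply: (inseparable_free pk hG Gp nGs).
- by move=> j; rewrite coef_poly; case: ifP => // _; exact: sub0.
- exact: size_poly.
- by rewrite horner_poly.
Qed.

(** Expand t in powers of s with coefficients in [F ss]. If s is not in [F (t :: ss)], its powers
    below p are independent over that field, so t equals the constant coefficient, which lies in
    [F ss]. *)
Lemma Rg_exchange ss s t : ~ F ss t -> ~ F (t :: ss) s -> ~ F (s :: ss) t.
Proof.
move=> nt ns /(Rg_cons pk (C := setT) I)[c [Fc et]]; apply: nt.
pose d i := if i is 0%N then c 0%N - t else c i.
have p0 := p_gt0 pk.
have Fd i : F (t :: ss) (d i).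
  have Fc' j : F (t :: ss) (c j).
    by apply: Rg_mono (Fc j) => // x xin; rewrite inE xin orbT.
  case: i => [|i] //=; apply: (subB (Rg_axioms _ _ _)) => //.
  by apply: Rg_mem; rewrite inE eqxx.
have : d 0%N = 0.
  apply: (free_coefs (Rg_axioms _ _ _) (@F_pow (t :: ss)) ns Fd _ p0).
  case: (p) p0 et => // q _; rewrite !big_ord_recl /= !mulr1 => ->.
  by ring.
by move=> /eqP; rewrite subr_eq0 => /eqP <-.
Qed.

Definition p_independent (L : set k) : Prop :=
  forall x xs, uniq (x :: xs) -> (forall y, y \in x :: xs -> L y) -> ~ F xs x.

(** Independence has finite character, so Zorn gives a maximal set; by exchange, an element outside
    its span could still be added. *)
Lemma p_basis_exists : exists L, p_independent L /\
  forall a, exists xs, [/\ uniq xs, forall y, y \in xs -> L y & F xs a].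
Proof.
have [Fam sub tot|L [indL maxL]] := @Zorn_bigcup k p_independent.
  move=> x xs ux xsL.
  suff [X FX Xxs] : exists2 X, Fam X & forall y, y \in x :: xs -> X y.
    exact: sub FX _ _ ux Xxs.
  elim: xs x {ux} xsL => [|z xs IH] x xsL.
    have [X FX Xx] := xsL x (mem_head _ _).
    by exists X => // y; rewrite inE => /eqP ->.
  have [|X FX Xzs] := IH z; first by move=> y yin; apply: xsL; rewrite inE yin orbT.
  have [Y FY Yx] := xsL x (mem_head _ _).
  have [XY|YX] := tot _ _ FX FY; [exists Y|exists X] => // y; rewrite inE => /orP[/eqP ->//|/Xzs].
  - exact: XY.
  - exact: YX.
  - by [].

exists L; split=> // a; apply: contrapT => nex.
have nLa : ~ L a.
  move=> La; apply: nex; exists [:: a]; split=> //; first by move=> y; rewrite inE => /eqP ->.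
  by apply: Rg_mem; rewrite inE.
have Fu xs : F (undup xs) = F xs.
  by apply/seteqP; split; apply: Rg_mono => // y; rewrite mem_undup.
have nF xs : (forall y, y \in xs -> L y) -> ~ F xs a.
  move=> xsL Fa; apply: nex; exists (undup xs); rewrite undup_uniq Fu; split=> // y.
  by rewrite mem_undup; exact: xsL.
apply: (maxL (L `|` [set a])).
  by split=> [x Lx|sub]; [left|apply: nLa; apply: sub; right].
move=> x xs /andP[xxs uxs] xsL.
have [eax|nax] := eqVneq x a.
  rewrite eax; apply: nF => y yin.
  have [|//|e] := xsL y; first by rewrite inE yin orbT.
  by move: xxs; rewrite eax -e yin.
have Lx : L x by have [//|e] := xsL x (mem_head _ _); rewrite e eqxx in nax.
have [axs|naxs] := boolP (a \in xs); last first.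
  apply: (indL _ _ _ _); first by rewrite /= xxs.
  move=> y yin; have [//|e] := xsL y yin; move: yin; rewrite inE e (negPf naxs) orbF eq_sym.
  by rewrite (negPf nax).
have xsL' y : y \in rem a xs -> L y.
  rewrite mem_rem_uniq // inE => /andP[ya yin].
  by have [|//|e] := xsL y; [rewrite inE yin orbT|rewrite e eqxx in ya].
move=> Fx; have : F (a :: rem a xs) x.
  by apply: Rg_mono Fx => // y; rewrite (perm_mem (perm_to_rem axs)).
apply: (Rg_exchange _ _).
  apply: (indL _ _ _ _); first by rewrite /= rem_uniq // andbT; apply: contra xxs; apply: mem_rem.
  by move=> y; rewrite inE => /orP[/eqP ->//|/xsL'].
by apply: nF => y; rewrite inE => /orP[/eqP ->//|/xsL'].
Qed.

End PBasis.

(** * Lifting the residue field into a complete ring *)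

Section CoefficientField.
Variables (B : comNzRingType) (M : nat -> set B) (k : fieldType) (g : {rmorphism B -> k}) (p : nat).
Hypothesis hM : complete_filtration M.
Hypothesis pB : p \in [pchar B].
Hypotheses (g_surj : forall c, exists b, g b = c) (g_ker : forall b, g b = 0 <-> M 1%N b).
Let hMi n := filt_ideal hM n.

(* With l lifting a p-basis, the subrings C_n generated over B^(p^n) by the
   lifts decrease to a subring meeting M 1 only in 0. *)
Lemma coefficient_field : exists kap : {rmorphism k -> B}, forall c, g (kap c) = c.
Proof.
have pk : p \in [pchar k] by rewrite inE (pcharf_prime pB) -(rmorph_nat g) (pcharf0 pB) rmorph0 eqxx.
have [L [indL spanL]] := p_basis_exists pk.
have /choice[l hl] := g_surj.
pose S : set B := [set l x | x in L].
pose C := fix C n := if n is n'.+1 then gensub ([set x ^+ p | x in C n'] `|` S) else [set: B].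
have hC n : subring_axioms (C n) by case: n => [|n] //; exact: gensub_axioms.
have CS n x : L x -> C n (l x).
  by move=> Lx; case: n => [|n] //; apply: gensub_sub; right; exists x.
have Cp n x : C n x -> C n.+1 (x ^+ p) by move=> Cx; apply: gensub_sub; left; exists x.
have C_decr n : C n.+1 `<=` C n.
  elim: n => [//|n IH]; apply: gensub_min; first exact: hC.
  by move=> _ [[x /IH Cx <-]|[x Lx <-]]; [exact: Cp|exact: CS].
have C_le n m : (n <= m)%N -> C m `<=` C n.
  move=> /subnK <-; elim: (m - n)%N => // j IH; exact: subset_trans (@C_decr _) IH.
have C_onto n a : exists2 c, C n c & g c = a.
  elim: n a => [|n IH] a; first by exists (l a).
  have [xs [_ xsL Fa]] := spanL a; move: a Fa.
  suff : Rg p setT xs `<=` [set a | exists2 c, C n.+1 c & g c = a] by [].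
  apply: Rg_min.
  - split; first by exists 1; [exact: sub1 (hC _)|rewrite rmorph1].
      by move=> _ _ [x Cx <-] [y Cy <-]; exists (x - y); [exact: subB (hC _) _ _|rewrite rmorphB].
    by move=> _ _ [x Cx <-] [y Cy <-]; exists (x * y); [exact: subM (hC _) _ _|rewrite rmorphM].
  - by move=> x _; have [c Cc <-] := IH x; exists (c ^+ p); [exact: Cp|rewrite rmorphXn].
  - by move=> x /xsL Lx; exists (l x) => //; exact: CS.
have C_Rg n z : C n.+1 z -> exists xs, [/\ uniq xs, forall y, y \in xs -> L y & Rg p (C n) (map l xs) z].
  move: z; apply: gensub_min.
  - have join xs ys x y : (forall z, z \in xs -> L z) -> (forall z, z \in ys -> L z) ->
      Rg p (C n) (map l xs) x -> Rg p (C n) (map l ys) y ->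
      exists zs, [/\ uniq zs, forall z, z \in zs -> L z, Rg p (C n) (map l zs) x & Rg p (C n) (map l zs) y].
      move=> xsL ysL hx hy; exists (undup (xs ++ ys)); split; first exact: undup_uniq.
      + by move=> z; rewrite mem_undup mem_cat => /orP[/xsL|/ysL].
      + apply: Rg_mono hx => // _ /mapP[z zin ->]; apply: map_f.
        by rewrite mem_undup mem_cat zin.
      + apply: Rg_mono hy => // _ /mapP[z zin ->]; apply: map_f.
        by rewrite mem_undup mem_cat zin orbT.
    split; first by exists [::]; split=> //; exact: sub1 (Rg_axioms _ _ _).
      move=> x y [xs [_ xsL hx]] [ys [_ ysL hy]].
      have [zs [uz zsL hx' hy']] := join _ _ _ _ xsL ysL hx hy.
      by exists zs; split=> //; exact: subB (Rg_axioms _ _ _) hx' hy'.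
    move=> x y [xs [_ xsL hx]] [ys [_ ysL hy]].
    have [zs [uz zsL hx' hy']] := join _ _ _ _ xsL ysL hx hy.
    by exists zs; split=> //; exact: subM (Rg_axioms _ _ _) hx' hy'.
  - move=> _ [[x Cx <-]|[x Lx <-]]; first by exists [::]; split=> //; exact: Rg_pow.
    exists [:: x]; split=> //; first by move=> y; rewrite inE => /eqP ->.
    by apply: Rg_mem; rewrite inE.
(* Write z as a polynomial in finitely many lifts, of degree below p in each, over p-th powers from
   C n. Its image in k is 0, so p-independence makes every coefficient vanish in k. The coefficients
   are thus p-th powers of elements of C n lying in M 1, to which the induction applies. *)
have C_M n z : C n z -> M 1%N z -> M (p ^ n) z.
  elim: n z => [//|n IH] z /C_Rg[xs [uxs xsL hz]] /g_ker gz.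
  elim: xs uxs xsL z hz gz => [_ _ z|x xs IHx].
    move=> /(Rg_nil pB (hC n))[w Cw ->]; rewrite rmorphXn => /eqP; rewrite expf_eq0 => /andP[_ /eqP gw].
    by rewrite expnSr; apply: (filt_exp hM); apply: IH => //; apply/g_ker.
  move=> /= /andP[xxs uxs] xsL w /(Rg_cons pB (CS n x (xsL x (mem_head _ _))))[c [hc ->]].
  rewrite rmorph_sum => gw.
  have xsL' y : y \in xs -> L y by move=> yin; apply: xsL; rewrite inE yin orbT.
  have gF y : Rg p (C n) (map l xs) y -> Rg p setT xs (g y).
    move: y; suff : Rg p (C n) (map l xs) `<=` [set y | Rg p setT xs (g y)] by [].
    have hR := @Rg_axioms k p setT xs.
    apply: Rg_min.
    - split=> [|u v hu hv|u v hu hv] /=; first by rewrite rmorph1; exact: sub1 hR.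
        by rewrite rmorphB; exact: subB hR hu hv.
      by rewrite rmorphM; exact: subM hR hu hv.
    - by move=> u _ /=; rewrite rmorphXn; exact: Rg_pow.
    - by move=> _ /mapP[u uin ->] /=; rewrite hl; exact: Rg_mem.
  have gc0 i : (i < p)%N -> g (c i) = 0.
    apply: (free_coefs pk (Rg_axioms p setT xs) (@F_pow k p xs) _ (c := fun i => g (c i))) => //.
    - by apply: (indL _ _ _ xsL); rewrite /= xxs.
    - by move=> j; apply: gF.
    - by rewrite -[RHS]gw; apply: eq_bigr => j _; rewrite rmorphM rmorphXn hl.
  apply: idl_sum => // i _; apply: (idlMr _ (hMi _)); apply: IHx => //; exact: gc0.
(* The limit of the C n. It meets M 1 only in 0 by the previous step, and it maps onto k because any
   choice of lifts of one element in the C n is a Cauchy sequence. *)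
pose W : set B := [set z | forall n, exists2 c, C n c & M (p ^ n) (z - c)].
have p1 : (1 < p)%N by apply: prime_gt1; apply: pcharf_prime pB.
have M_pow n : M (p ^ n) `<=` M n by apply: (filt_le hM); apply: ltnW; apply: ltn_expl.
have M_pow1 n : M (p ^ n) `<=` M 1%N by apply: (filt_le hM); rewrite expn_gt0 (ltnW p1).
have hW : subring_axioms W.
  split=> [n|x y hx hy n|x y hx hy n].
  - by exists 1; [exact: sub1 (hC _)|rewrite subrr; exact: idl0].
  - have [c Cc Mc] := hx n; have [d Cd Md] := hy n; exists (c - d); first exact: subB (hC _) _ _.
    have -> : x - y - (c - d) = (x - c) - (y - d) by ring.
    exact: idlB.
  - have [c Cc Mc] := hx n; have [d Cd Md] := hy n; exists (c * d); first exact: subM (hC _) _ _.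
    have -> : x * y - c * d = (x - c) * y + c * (y - d) by ring.
    by apply: (idlD (hMi _)); [exact: idlMr|exact: idlM].
have W0 z : W z -> g z = 0 -> z = 0.
  move=> Wz gz; apply: (filt_sep hM) => n; apply: M_pow; have [c Cc Mc] := Wz n.
  rewrite -(subrK c z); apply: (idlD (hMi _)) => //; apply: C_M => //.
  rewrite -(subKr z c); apply: (idlB (hMi _)); [exact/g_ker|exact: M_pow1 Mc].
have W_onto a : exists2 z, W z & g z = a.
  have /choice[c hc] : forall n, exists c, C n c /\ g c = a.
    by move=> n; have [c ? ?] := C_onto n a; exists c.
  have Mc n m : (n <= m)%N -> M (p ^ n) (c m - c n).
    move=> nm; apply: C_M.
      by apply: (subB (hC _)) => //; [apply: C_le (hc m).1|exact: (hc n).1].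
    by apply/g_ker; rewrite rmorphB (hc m).2 (hc n).2 subrr.
  have [z hz] : exists z, forall n, M n (z - c n).
    by apply: (filt_lim hM) => n; apply: M_pow; apply: Mc.
  exists z => [n|].
    exists (c n); first exact: (hc n).1.
    have np : (n <= p ^ n)%N by apply: ltnW; apply: ltn_expl.
    by rewrite -(subrKA (c (p ^ n)%N)); apply: (idlD (hMi _)) => //; exact: Mc.
  by rewrite -(hc 1%N).2; apply/eqP; rewrite -subr_eq0 -rmorphB; apply/eqP/g_ker.
have /choice[kp hkp] : forall a, exists z, W z /\ g z = a.
  by move=> a; have [z ? ?] := W_onto a; exists z.
have Wu z a : W z -> g z = a -> kp a = z.
  move=> Wz gz; apply/eqP; rewrite -subr_eq0; apply/eqP; apply: W0.
    by apply: (subB hW) => //; exact: (hkp a).1.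
  by rewrite rmorphB gz (hkp a).2 subrr.
have kz : zmod_morphism kp.
  move=> a b; apply: Wu; last by rewrite rmorphB !(hkp _).2.
  by apply: (subB hW) => //; exact: (hkp _).1.
have km : monoid_morphism kp.
  split=> [|a b]; first by apply: Wu; [exact: sub1 hW|rewrite rmorph1].
  apply: Wu; last by rewrite rmorphM !(hkp _).2.
  by apply: (subM hW) => //; exact: (hkp _).1.
pose kap : {rmorphism k -> B} := HB.pack kp
  (GRing.isZmodMorphism.Build _ _ _ kz) (GRing.isMonoidMorphism.Build _ _ _ km).
by exists kap => c; exact: (hkp c).2.
Qed.

End CoefficientField.

(** * Systems of parameters and the Artin-Rees property *)

Section Noetherian.
Variable A : comNzRingType.
Hypothesis noethA : noetherian A.
Implicit Types (I J K P Q : set A).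

Lemma fingen I : is_ideal I -> exists gs, I = gpow gs 1.
Proof. by move=> /noethA[s ->]; exists s; rewrite gpow1_gen. Qed.

Lemma noetherian_max (F : set A -> Prop) I0 : F I0 -> (forall I, F I -> is_ideal I) ->
  exists I, F I /\ forall J, F J -> I `<=` J -> J `<=` I.
Proof.
move=> FI0 Fid; apply: contrapT => nmax.
have step (I : {I | F I}) : exists J : {I | F I}, sval I `<` sval J.
  case: I => I FI /=; apply: contrapT => nJ; apply: nmax; exists I; split=> // J FJ IJ.
  by apply: contrapT => nJI; apply: nJ; exists (exist _ J FJ).
have /choice[f hf] := step.
pose c := fix c n := if n is n'.+1 then f (c n') else exist _ I0 FI0.
pose U : set A := [set x | exists n, sval (c n) x].
have cS n : sval (c n) `<=` sval (c n.+1) by case: (hf (c n)).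
have c_le n m : (n <= m)%N -> sval (c n) `<=` sval (c m).
  by move=> /subnK <-; elim: (m - n)%N => // j IH; exact: subset_trans IH (@cS _).
have cI n : is_ideal (sval (c n)) by apply: Fid; exact: (svalP (c n)).
have hU : is_ideal U.
  split.
  - by exists 0%N; exact: (idl0 (cI 0%N)).
  - move=> x y [n hx] [m hy]; exists (maxn n m); apply: (idlD (cI _)).
      exact: c_le _ _ (leq_maxl _ _) _ hx.
    exact: c_le _ _ (leq_maxr _ _) _ hy.
  - by move=> a x [n hx]; exists n; exact: (idlM a (cI n) hx).
have [gs Ugs] := fingen hU.
have [N hN] : exists N, forall g, g \in gs -> sval (c N) g.
  have : forall g, g \in gs -> U g by move=> g hg; rewrite Ugs; exact: gpow1_mem.
  elim: (gs) => [|g hs IH] hg; first by exists 0%N.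
  have [|N hN] := IH; first by move=> h hin; apply: hg; rewrite inE hin orbT.
  have [n hn] := hg g (mem_head _ _); exists (maxn n N) => h; rewrite inE => /orP[/eqP ->|/hN].
    exact: c_le _ _ (leq_maxl _ _) _ hn.
  exact: c_le _ _ (leq_maxr _ _) _.
have [_] := hf (c N); apply => x hx.
have Ux : U x by exists N.+1.
by move: Ux; rewrite Ugs; apply: (gpow1_min (cI N)).
Qed.

(** The product of the listed ideals is contained in I, expressed on elements; the empty product is
    the whole ring. *)
Fixpoint prodin (Ps : seq (set A)) (I : set A) : Prop :=
  if Ps is P :: Ps' then forall x, P x -> prodin Ps' [set y | I (x * y)] else I 1.

Lemma prodin_mono Ps I J : I `<=` J -> prodin Ps I -> prodin Ps J.
Proof.
elim: Ps I J => [|P Ps IH] I J IJ /=; first exact: IJ.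
by move=> h x /h; apply: IH => y; apply: IJ.
Qed.

Lemma prodin_cat Ps Qs I J : prodin Ps I -> (forall i, I i -> prodin Qs [set y | J (i * y)]) ->
  prodin (Ps ++ Qs) J.
Proof.
elim: Ps I J => [|P Ps IH] I J /=.
  by move=> I1 /(_ 1 I1); apply: prodin_mono => y /=; rewrite mul1r.
move=> h hQ x /h hx; apply: (IH _ _ hx) => i /hQ; apply: prodin_mono => y /=.
by rewrite mulrA.
Qed.

(** A maximal counterexample J is proper and not prime, say xy lies in J with x and y outside;
    concatenating the lists for J + (x) and J + (y) gives one for J. *)
Lemma prime_decomposition I : is_ideal I -> exists Ps,
  (forall P, P \in Ps -> prime_ideal P /\ I `<=` P) /\ prodin Ps I.
Proof.
move=> hI; apply: contrapT => nI.
pose bad J := is_ideal J /\ ~ exists Ps,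
  (forall P, P \in Ps -> prime_ideal P /\ J `<=` P) /\ prodin Ps J.
have [J [[hJ nJ] Jmax]] : exists J, bad J /\ forall K, bad K -> J `<=` K -> K `<=` J.
  by apply: (@noetherian_max bad I) => // K [].
have good (K : set A) : is_ideal K -> J `<=` K -> ~ (K `<=` J) -> exists Ps,
    (forall P, P \in Ps -> prime_ideal P /\ K `<=` P) /\ prodin Ps K.
  by move=> hK JK nKJ; apply: contrapT => nK; apply/nKJ/Jmax.
apply: nJ; have [J1|nJ1] := pselect (J 1); first by exists [::].
have [pr|npr] := pselect (forall x y, J (x * y) -> J x \/ J y).
  exists [:: J]; split; first by move=> P; rewrite inE => /eqP ->; split.
  by move=> x Jx /=; rewrite mulr1.
move/existsNP: npr => [x /existsNP[y /not_implyP[Jxy /not_orP[nx ny]]]].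
have adj z : ~ J z -> exists Ps,
    (forall P, P \in Ps -> prime_ideal P /\ J `<=` P) /\ prodin Ps (adjoin (J : set A^o) z).
  move=> nz; have hJz : is_ideal (adjoin (J : set A^o) z) by apply: adjoin_submod.
  have JJz : J `<=` adjoin (J : set A^o) z by exact: (@sub_adjoin A A^o).
  have [|Ps [hPs pPs]] := good _ hJz JJz.
    by move=> /(_ z (adjoin_mem _ hJ)).
  exists Ps; split=> // P /hPs[prP sP]; split=> //; exact: subset_trans sP.
have [Ps [hPs pPs]] := adj _ nx; have [Qs [hQs pQs]] := adj _ ny.
exists (Ps ++ Qs); split.
  by move=> P; rewrite mem_cat => /orP[/hPs|/hQs].
apply: prodin_cat pPs _ => i [a ha]; apply: prodin_mono pQs => z [b hb] /=.
have -> : i * z = (i - a * x) * z + a * (x * (z - b * y)) + (a * b) * (x * y) by ring.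
apply: (idlD hJ); last exact: idlM.
by apply: (idlD hJ); [exact: idlMr|apply: idlM => //; exact: idlM].
Qed.

(** c accumulates elements outside P, one from each listed ideal that is not contained in P; their
    product stays outside P. *)
Lemma prodin_prime Ps P c : prime_ideal P -> ~ P c -> prodin Ps [set y | P (c * y)] ->
  exists2 Q, Q \in Ps & Q `<=` P.
Proof.
move=> [hP _ prP]; elim: Ps c => [|Q Ps IH] c nc /=; first by rewrite mulr1.
move=> h; have [QP|/nonsubset[x [Qx nPx]]] := pselect (Q `<=` P).
  by exists Q => //; rewrite mem_head.
have ncx : ~ P (c * x) by move=> /prP[].
have [|Q' Q'in sub] := IH _ ncx; last by exists Q' => //; rewrite inE Q'in orbT.
by apply: prodin_mono (h _ Qx) => y /=; rewrite mulrA.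
Qed.

Lemma prodin_gpow gs Ps I : is_ideal I -> (forall P, P \in Ps -> forall g, g \in gs -> P g) ->
  prodin Ps I -> gpow gs (size Ps) `<=` I.
Proof.
elim: Ps I => [|P Ps IH] I hI hPs /=.
  by move=> I1 x _; rewrite -[x]mulr1; apply: idlM.
move=> h; apply: gmul_min => // g a gin ha.
have Pg : P g by apply: (hPs P) => //; rewrite mem_head.
apply: (IH [set y | I (g * y)]) ha; [exact: pre_ideal| |exact: h].
by move=> Q Qin; apply: hPs; rewrite inE Qin orbT.
Qed.

Lemma prime_avoidance (Ps : seq (set A)) (m : set A) : is_ideal m ->
  (forall P, P \in Ps -> prime_ideal P /\ ~ (m `<=` P)) ->
  exists x, m x /\ forall P, P \in Ps -> ~ P x.
Proof.
move=> hm; have [n] := ubnP (size Ps); elim: n Ps => // n IH [|Q Ps] sz hPs.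
  by exists 0; split=> //; exact: idl0.
have hPs' P : P \in Ps -> prime_ideal P /\ ~ m `<=` P.
  by move=> Pin; apply: hPs; rewrite inE Pin orbT.
have [[[hQ Q1 prQ] mQ]] := (hPs Q (mem_head _ _), tt).
have [[Q' Q'in Q'Q]|ninc] := pselect (exists2 Q', Q' \in Ps & Q' `<=` Q).
  have [| |x [mx xav]] := IH (Q :: rem Q' Ps).
  - by rewrite /= size_rem // prednK //; case: (Ps) Q'in.
  - move=> P; rewrite inE => /orP[/eqP ->|/mem_rem/hPs'//]; exact: hPs (mem_head _ _).
  exists x; split=> // P; rewrite inE => /orP[/eqP ->|Pin]; first by apply: xav; rewrite mem_head.
  have [->|PQ'] := eqVneq P Q'.
    by move=> /Q'Q; apply: xav; rewrite mem_head.
  apply: xav; rewrite inE; apply/orP; right.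
  by move: Pin; rewrite (perm_mem (perm_to_rem Q'in)) inE (negPf PQ').
have [x [mx xav]] := IH Ps sz hPs'.
have [Qx|nQx] := pselect (Q x); last first.
  by exists x; split=> // P; rewrite inE => /orP[/eqP ->|/xav].
(* None of the remaining primes is contained in the prime Q, and neither is m; so some y lies in all
   of them and in m but not in Q. Adding y takes x out of Q and keeps it out of the others. *)
have [y [my nQy yPs]] : exists y, [/\ m y, ~ Q y & forall P, P \in Ps -> P y].
  have : forall P, P \in Ps -> is_ideal P /\ ~ P `<=` Q.
    move=> P Pin; split; first by case: (hPs' _ Pin) => -[].
    by move=> PQ; apply: ninc; exists P.
  elim: (Ps) => [|P Rs IHR] hR.
    by move/nonsubset: mQ => [y [my nQy]]; exists y.
  have [|y [my nQy yR]] := IHR; first by move=> R Rin; apply: hR; rewrite inE Rin orbT.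
  have [hP /nonsubset[z [Pz nQz]]] := hR P (mem_head _ _).
  exists (z * y); split; first exact: idlM.
    by move=> /prQ[].
  move=> R; rewrite inE => /orP[/eqP ->|Rin]; first exact: idlMr.
  apply: idlM; last exact: yR.
  by case: (hR R) => //; rewrite inE Rin orbT.
exists (x + y); split; first exact: idlD.
move=> P; rewrite inE => /orP[/eqP -> h|Pin h].
  by apply: nQy; rewrite -(addKr x y) addrC; apply: idlB.
have [[hP _ _] _] := hPs' _ Pin.
by apply: (xav _ Pin); rewrite -(addrK y x); apply: idlB => //; exact: yPs.
Qed.

Definition dim_le I d := forall n (c : nat -> set A),
  (forall i, (i <= n)%N -> prime_ideal (c i) /\ I `<=` c i) ->
  (forall i, (i < n)%N -> c i `<` c i.+1) -> (n <= d)%N.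

Variables (m : set A) (gs : seq A).
Hypotheses (mprime : prime_ideal m) (primem : forall P, prime_ideal P -> P `<=` m).
Hypothesis mgs : m = gpow gs 1.

(** Take x in m outside every prime other than m of a decomposition of I. A chain of primes above I
    + (x) starts above some member Q of the decomposition. If Q = m the chain has length 0;
    otherwise x separates Q from it and Q prolongs the chain downward. So the dimension drops. *)
Lemma system_of_parameters d I : is_ideal I -> I `<=` m -> dim_le I d ->
  exists xs, [/\ size xs = d, forall x, x \in xs -> m x &
    exists t, gpow gs t `<=` adjoins (I : set A^o) xs].
Proof.
elim: d I => [|d IH] I hI Im dimI.
  exists [::]; split=> //; have [Ps [hPs pPs]] := prime_decomposition hI.
  exists (size Ps); apply: prodin_gpow => // P /hPs[prP IP] g gin.
  apply: contrapT => nPg.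
  suff : (1 <= 0)%N by [].
  apply: (dimI 1%N (fun i => if i is 0%N then P else m)).
    by move=> [|i] _.
  move=> [|//] _; split; first exact: primem.
  by move=> mP; apply: nPg; apply: mP; rewrite mgs; exact: gpow1_mem.
have [Ps [hPs pPs]] := prime_decomposition hI.
have [hm _ _] := mprime.
have [|x [mx xav]] := @prime_avoidance [seq P <- Ps | P != m] m hm.
  move=> P; rewrite mem_filter => /andP[Pm /hPs[prP _]]; split=> // mP.
  by move/eqP: Pm; apply; apply/seteqP; split=> //; exact: primem.
pose J : set A := adjoin (I : set A^o) x.
have [| | |xs [sxs xsm [t ht]]] := IH J.
- exact: adjoin_submod.
- exact: (@adjoin_min A A^o _ _ _ hm Im mx).
- move=> n c hc ltc; have [prc Jc] := hc 0%N isT.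
  have Ic : I `<=` c 0%N by apply: subset_trans Jc; exact: (@sub_adjoin A A^o).
  have [| |Q Qin Qc] := @prodin_prime Ps (c 0%N) 1 prc; first by case: prc.
    by apply: prodin_mono pPs => y /Ic; rewrite /= mul1r.
  have [eQ|nQ] := eqVneq Q m.
    case: n hc ltc => // n hc ltc; have [c01 nc] := ltc 0%N isT; exfalso; apply: nc.
    by apply: subset_trans Qc; rewrite eQ; apply: primem; case: (hc 1%N isT).
  have Qx : ~ Q x by apply: xav; rewrite mem_filter nQ.
  have := dimI n.+1 (fun i => if i is i'.+1 then c i' else Q); apply.
    move=> [|i] ilt; first by case: (hPs _ Qin).
    have [pri Jci] := hc i ilt; split=> //.
    by apply: subset_trans Jci; exact: (@sub_adjoin A A^o).
  move=> [|i] ilt; last exact: ltc.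
  by split=> // cQ; apply: Qx; apply: cQ; apply: Jc; apply: adjoin_mem.
exists (x :: xs); split; first by rewrite /= sxs.
  by move=> z; rewrite inE => /orP[/eqP ->|/xsm].
by exists t; rewrite /= -adjoinsAC.
Qed.

End Noetherian.

Section ArtinRees.
Variable A : comNzRingType.
Hypothesis noethA : noetherian A.

Lemma gpow_radical (J : set A) gs : is_ideal J -> (forall g, g \in gs -> exists t, J (g ^+ t)) ->
  exists N, gpow gs N `<=` J.
Proof.
move=> hJ; elim: gs => [|g gs IH] hgs.
  by exists 1%N => _ ->; exact: idl0.
have [|N hN] := IH; first by move=> h hin; apply: hgs; rewrite inE hin orbT.
have [t ht] := hgs g (mem_head _ _); exists (t + N)%N; apply: gpow_cons => // i y ilt hy.
have [ti|it] := leqP t i.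
  by rewrite -(subnK ti) exprD mulrAC; apply: idlM.
by apply: idlM => //; apply: hN; apply: gpow_decr hy; lia.
Qed.

Definition idprod (I K : set A) : set A := ideal_gen [set z | exists x y, [/\ I x, K y & z = x * y]].

(* Since N is not controlled, maximality replaces the Rees algebra. *)
Lemma artin_rees gs (K : set A) N' : is_ideal K ->
  exists N, forall z, gpow gs N z -> K z -> idprod (gpow gs N') K z.
Proof.
move=> hK; pose L := idprod (gpow gs N') K; have hL : is_ideal L by apply: ideal_gen_ideal.
pose F J := [/\ is_ideal J, L `<=` J & forall z, J z -> K z -> L z].
have [J [[hJ LJ JK] Jmax]] : exists J, F J /\ forall I, F I -> J `<=` I -> I `<=` J.
  by apply: (@noetherian_max A noethA F L) => [|I []//]; split.
have [|N hN] := @gpow_radical J gs hJ; last by exists N => z /hN Jz Kz; exact: JK.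
move=> g gin.
(* The colon ideals (J : g^i) increase, and i0 is an index where they stop. Adding g^i0 to J keeps
   the trace on K inside L: if z = j + a g^i0 lies in K, then g^N' z lies in L, so a lies in (J :
   g^(N'+i0)) = (J : g^i0) and z in J. By maximality J contains g^i0. *)
pose Col i : set A := [set a | J (g ^+ i * a)].
have [I [[i0 eI] Imax]] : exists I, (exists i, I = Col i) /\
    forall I', (exists i, I' = Col i) -> I `<=` I' -> I' `<=` I.
  apply: (@noetherian_max A noethA (fun I => exists i, I = Col i) (Col 0%N)).
    by exists 0%N.
  by move=> _ [i ->]; exact: pre_ideal.
exists i0; suff : adjoin (J : set A^o) (g ^+ i0) `<=` J by apply; apply: adjoin_mem.
apply: Jmax; last exact: (@sub_adjoin A A^o).
split; first exact: adjoin_submod.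
  by apply: subset_trans LJ _; exact: (@sub_adjoin A A^o).
move=> z [a ha] Kz; apply: JK => //.
rewrite /GRing.scale /= in ha; rewrite -(subrK (a * g ^+ i0) z); apply: (idlD hJ) => //.
have : Col (N' + i0)%N a.
  rewrite /Col /= exprD.
  have -> : g ^+ N' * g ^+ i0 * a = g ^+ N' * z - g ^+ N' * (z - a * g ^+ i0) by ring.
  apply: (idlB hJ); last exact: idlM.
  apply: LJ; apply: ideal_gen_mem; exists (g ^+ N'), z; split=> //.
  by have := gpow_exp N' (gpow1_mem gin); rewrite mul1n.
move=> h; rewrite mulrC; suff : Col i0 a by [].
rewrite -eI; apply: Imax h; first by exists (N' + i0)%N.
rewrite eI => b /= Jb; rewrite /Col /= exprD -mulrA; exact: idlM.
Qed.

End ArtinRees.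

(** The target is only an additive set: the approximations it serves are not stable under
    multiplication by B. *)
Lemma gmul_add_min (A : comNzRingType) (gs : seq A) (L U : set A) : U 0 ->
  (forall x y, U x -> U y -> U (x + y)) ->
  (forall g a, g \in gs -> L a -> U (g * a)) -> gmul gs L `<=` U.
Proof.
move=> U0 UD; elim: gs => [|g gs IH] hg /=; first by move=> _ ->.
move=> _ [a [b [La hb ->]]]; apply: UD; first by apply: hg => //; rewrite mem_head.
by apply: IH hb => h c hin; apply: hg; rewrite inE hin orbT.
Qed.

(** * Noetherian local rings of characteristic p *)

Section CompleteFiniteness.
Variables (k : fieldType) (D B : comNzRingType) (Xs : seq D) (kap : {rmorphism k -> D}).
Hypothesis hD : power_series_ring Xs kap.
Variables (M : nat -> set B).
Hypothesis hM : complete_filtration M.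
Variable phi : {rmorphism D -> B}.
Hypothesis phiX : forall y, y \in map phi Xs -> M 1%N y.
Let hMi n := filt_ideal hM n.

Lemma phi_filt n a : gpow Xs n a -> M n (phi a).
Proof.
move: a; suff : gpow Xs n `<=` [set a | M n (phi a)] by [].
apply: (@gpow_min _ _ (fun n => [set a | M n (phi a)])).
- move=> j; split=> [|x y hx hy|a x hx] /=.
  + by rewrite rmorph0; apply: idl0.
  + by rewrite rmorphD; apply: idlD.
  + by rewrite /GRing.scale /= rmorphM; apply: idlM.
- by apply/seteqP; split=> // x _; rewrite /= (filt0 hM).
- move=> j g a gin ha /=; rewrite rmorphM -add1n; apply: (filt_mul hM) => //.
  by apply: phiX; apply: map_f.
Qed.

(** Keeping all coefficients in (Xs)^N lets a series of such combinations be summed in D,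
    coefficient by coefficient. *)
Fixpoint approx (us : seq B) (N : nat) : set B :=
  if us is u :: us' then [set z | exists2 a, gpow Xs N a & approx us' N (z - phi a * u)]
  else [set 0].

Lemma approx0 us N : approx us N 0.
Proof.
elim: us => [|u us IH] //=; exists 0; first exact: idl0 (gpow_ideal _ _).
by rewrite rmorph0 mul0r subr0.
Qed.
Lemma approxD us N x y : approx us N x -> approx us N y -> approx us N (x + y).
Proof.
elim: us x y => [|u us IH] x y /=; first by move=> -> ->; rewrite addr0.
move=> [a ha hx] [b hb hy]; exists (a + b); first exact: idlD (gpow_ideal _ _) ha hb.
have -> : x + y - phi (a + b) * u = (x - phi a * u) + (y - phi b * u) by rewrite rmorphD; ring.
exact: IH.
Qed.
Lemma approxM us N X z : X \in Xs -> approx us N z -> approx us N.+1 (phi X * z).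
Proof.
move=> Xin; elim: us z => [|u us IH] z /=; first by move=> ->; rewrite mulr0.
move=> [a ha hz]; exists (X * a); first by apply: gmul_mem => //; exact: gpow_ideal.
have -> : phi X * z - phi (X * a) * u = phi X * (z - phi a * u) by rewrite rmorphM; ring.
exact: IH.
Qed.

Lemma approx_sum us (dl : nat -> B) s : (forall N, approx us N (dl N)) ->
  (forall N, M N (s - \sum_(j < N) dl j)) -> dadjs phi [set 0] us s.
Proof.
elim: us dl s => [|u us IH] dl s hdl hs /=.
  apply: (filt_sep hM) => n; have := hs n; rewrite big1 ?subr0 // => i _; exact: hdl.
have /choice[a ha] : forall N, exists a, gpow Xs N a /\ approx us N (dl N - phi a * u).
  by move=> N; have [a h1 h2] := hdl N; exists a.
have [al hal] := psr_sum hD (fun N => (ha N).1).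
exists al; rewrite /GRing.scale /= /restr_scale.
apply: (IH (fun N => dl N - phi (a N) * u)) => [N|N]; first exact: (ha N).2.
have -> : \sum_(j < N) (dl j - phi (a j) * u) = \sum_(j < N) dl j - phi (\sum_(j < N) a j) * u.
  by rewrite sumrB -mulr_suml rmorph_sum.
have -> : s - phi al * u - (\sum_(j < N) dl j - phi (\sum_(j < N) a j) * u) =
  (s - \sum_(j < N) dl j) - phi (al - \sum_(j < N) a j) * u by rewrite rmorphB; ring.
by apply: (idlB (hMi _)) => //; apply: (idlMr _ (hMi _)); apply: phi_filt.
Qed.

(* Nakayama for complete modules. *)
Lemma complete_finite us : (forall b, dadjs phi (gpow (map phi Xs) 1) us b) ->
  forall b, dadjs phi [set 0] us b.
Proof.
move=> husb b; set ys := map phi Xs in husb *.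
have base (L : set B) vs z : dadjs phi L vs z -> exists2 l, L l & approx vs 0 (z - l).
  elim: vs z => [|v vs IH] z /=; first by exists z; rewrite ?subrr.
  move=> [a]; rewrite /GRing.scale /= /restr_scale => /IH[l Ll h].
  by exists l => //; exists a => //; rewrite addrAC.
(* Up to the next power of (ys), an element of (ys)^N is a combination of [us] with coefficients in
   (Xs)^N; iterating from b, the combinations add up to b. *)
have step N z : gpow ys N z -> exists z', gpow ys N.+1 z' /\ approx us N (z - z').
  elim: N z => [|N IH] z; first by move=> _; have [l hl h] := base _ _ _ (husb z); exists l.
  move: z; suff : gmul ys (gpow ys N) `<=` [set z | exists z', gpow ys N.+2 z' /\ approx us N.+1 (z - z')] by apply.
  apply: gmul_add_min => [|x y [x' [hx ax]] [y' [hy ay]]|_ a /mapP[X Xin ->] /IH[a' [ha aa]]] /=.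
  - exists 0; rewrite subrr; split; [exact: idl0 (gpow_ideal ys N.+2)|exact: approx0].
  - exists (x' + y'); split; first exact: idlD (gpow_ideal ys N.+2) hx hy.
    have -> : x + y - (x' + y') = (x - x') + (y - y') by ring.
    exact: approxD.
  - exists (phi X * a'); split.
      by apply: gmul_mem ha; [exact: (gpow_ideal ys N.+1)|exact: map_f].
    by rewrite -mulrBr; apply: approxM.
have /choice[f hf] : forall Nz : nat * B, exists z', gpow ys Nz.1 Nz.2 ->
    gpow ys Nz.1.+1 z' /\ approx us Nz.1 (Nz.2 - z').
  move=> [N z]; have [/step[z' h]|nz] := pselect (gpow ys N z); first by exists z'.
  by exists 0 => /nz.
pose z := fix z n := if n is n'.+1 then f (n', z n') else b.
have hz n : gpow ys n (z n) by elim: n => [//|n IH]; exact: (hf (n, z n) IH).1.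
apply: (@approx_sum us (fun n => z n - z n.+1)) => N; first exact: (hf (N, z N) (hz N)).2.
have -> : \sum_(j < N) (z j - z j.+1) = b - z N.
  elim: N => [|N IH]; first by rewrite big_ord0 subrr.
  by rewrite big_ord_recr IH /= addrA subrK.
by rewrite subKr; apply: (filt_gpow hM phiX).
Qed.

End CompleteFiniteness.

Lemma preimage_ideal (A B : comNzRingType) (f : {rmorphism A -> B}) (J : set B) :
  is_ideal J -> is_ideal [set x | J (f x)].
Proof.
move=> hJ; split=> [|x y|a x] /=; first by rewrite rmorph0; apply: idl0.
  by rewrite rmorphD; apply: idlD.
by rewrite /GRing.scale /= rmorphM; apply: idlM.
Qed.

(** * Extension of ideals to the completion *)

Section Extension.
Variables (A B : comNzRingType) (gs : seq A) (M : nat -> set B) (iota : {rmorphism A -> B}).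
Hypothesis hB : completion_of gs M iota.
Let hM := cpl_filt hB.
Let hMi n := filt_ideal hM n.

Definition extend (I : set A) : set B := ideal_gen [set iota x | x in I].

Lemma extend_ideal I : is_ideal (extend I). Proof. exact: ideal_gen_ideal. Qed.
Lemma extend_mem I x : I x -> extend I (iota x).
Proof. by move=> Ix; apply: ideal_gen_mem; exists x. Qed.
Lemma extend_min I (J : set B) : is_ideal J -> (forall x, I x -> J (iota x)) -> extend I `<=` J.
Proof. by move=> hJ IJ; apply: ideal_gen_min => // _ [x Ix <-]; apply: IJ. Qed.
Lemma extend_mono I J : I `<=` J -> extend I `<=` extend J.
Proof. by move=> IJ; apply: extend_min => [|x /IJ]; [exact: extend_ideal|exact: extend_mem]. Qed.

Lemma extend_gpow cs : extend (gpow cs 1) = gpow (map iota cs) 1.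
Proof.
apply/seteqP; split.
  apply: extend_min; first exact: gpow_ideal.
  suff : gpow cs 1 `<=` [set x | gpow (map iota cs) 1 (iota x)] by [].
  apply: gpow1_min => [|c cin]; last by apply: gpow1_mem; apply: map_f.
  exact: preimage_ideal (gpow_ideal _ _).
apply: gpow1_min; first exact: extend_ideal.
by move=> _ /mapP[c cin ->]; apply: extend_mem; apply: gpow1_mem.
Qed.

Lemma filt_sub_extend t I : (exists cs, I = gpow cs 1) -> gpow gs t `<=` I -> M t `<=` extend I.
Proof. by move=> [cs ->] sub; rewrite extend_gpow; apply: (filt_sub_extension hB sub). Qed.

Lemma extend_approx I N b : is_ideal I -> extend I b -> exists2 a, I a & M N (b - iota a).
Proof.
move=> hI; move: b; suff : extend I `<=` [set b | exists2 a, I a & M N (b - iota a)] by [].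
apply: extend_min => [|x Ix]; last by exists x; rewrite ?subrr //; exact: idl0.
split=> [|x y [a Ia ha] [b Ib hb]|c x [a Ia ha]].
- by exists 0; [exact: idl0|rewrite rmorph0 subrr; exact: idl0].
- exists (a + b); first exact: idlD.
  by rewrite rmorphD opprD addrACA; exact: idlD.
- have [c' hc] := cpl_dense hB N c; exists (c' * a); first exact: idlM.
  have -> : c *: (x : B^o) - iota (c' * a) = c * (x - iota a) + (c - iota c') * iota a.
    by rewrite rmorphM /GRing.scale /=; ring.
  by apply: (idlD (hMi _)); [exact: idlM|exact: idlMr].
Qed.

(** I contains the trace on U of (gs)^N, so approximating z by an element of I modulo (gs)^N already
    puts z in I. *)
Lemma extend_contract (I U : set A) N z : is_ideal I -> is_ideal U -> I `<=` U ->
  (forall z, gpow gs N z -> U z -> I z) -> extend I (iota z) -> U z -> I z.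
Proof.
move=> hI hU IU sub /(extend_approx N hI)[a Ia]; rewrite -rmorphB => /(cpl_mem hB) h Uz.
rewrite -(subrK a z); apply: (idlD hI) => //; apply: sub => //.
by apply: (idlB hU) => //; exact: IU.
Qed.

Lemma sc_extend (D : comNzRingType) (phi : {rmorphism D -> B}) n (I U : set A) N :
  is_ideal I -> is_ideal U -> I `<=` U -> (forall z, gpow gs N z -> U z -> I z) ->
  @sc A A^o n I U -> @sc D (restr phi) n (extend I) (extend U).
Proof.
move=> + hU; elim: n I => // n IH I hI IU hN [J [hJ [IJ nJI] JU sJ]].
exists (extend J); split.
- by apply: ideal_dsub; exact: extend_ideal.
- split; first exact: extend_mono.
  move=> sub; apply: nJI => x Jx; apply: (extend_contract hI hU IU hN); last exact: JU.
  by apply: sub; exact: extend_mem.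
- exact: extend_mono.
- by apply: IH => // z /hN h /h /IJ.
Qed.

End Extension.

Section FiniteLength.
Variables (D B : comNzRingType) (phi : {rmorphism D -> B}) (n : set D) (M1 : set B).
Hypothesis dense : forall b, exists a, M1 (b - phi a).
Hypothesis phin : forall a, n a -> M1 (phi a).

Lemma dfl_gens N (L : set B) : dfl phi n N L setT -> exists us : seq B, forall b, dadjs phi L us b.
Proof.
elim: N L => [|N IH] L /=; first by move=> h; exists [::] => b; exact: h.
move=> [y [_ _ /IH[us hus]]]; exists (rcons us y) => b.
have : dadjs phi (dadj phi L y) us b by exact: hus.
rewrite /dadjs /dadj /adjoins foldr_rcons; exact.
Qed.

End FiniteLength.

(** * Descent from the completion to the local ring *)

Section LocalCore.
Variables (A : comNzRingType) (k : fieldType) (f : {rmorphism A -> k}) (p : nat).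
Let m : set A := [set x | f x = 0].
Hypothesis noethA : noetherian A.
Hypothesis f_surj : forall c, exists a, f a = c.
Hypothesis primem : forall P, prime_ideal P -> P `<=` m.
Hypothesis pA : p \in [pchar A].
Variable gs : seq A.
Hypothesis mgs : m = gpow gs 1.
Variable fa : nat -> set A.
Variable w : nat.
Hypothesis fa_ideal : forall e, is_ideal (fa e).
Hypothesis fa_frob : forall e z, fa e z -> fa e.+1 (z ^+ p).
Hypothesis fa_low : forall e, gpow gs (w * p ^ e) `<=` fa e.
Hypothesis fa_shift : forall e0, exists t, forall e x z, gpow gs t x -> fa (e + e0)%N z ->
  ideal_gen [set u | exists2 y, fa e y & u = y ^+ (p ^ e0)] (x * z).

Local Notation lenA := (@flen A m A^o).
Local Notation flA := (@fl A m A^o).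

Lemma m_prime : prime_ideal m.
Proof.
split=> [|/= /eqP|x y /= /eqP]; last 2 first.
- by rewrite rmorph1 oner_eq0.
- by rewrite rmorphM mulf_eq0 => /orP[/eqP|/eqP]; [left|right].
apply: (preimage_ideal f (J := [set 0])); exact: (@submod_zero k k^o).
Qed.

Lemma m_res a : ~ m a -> exists b, m (a * b - 1).
Proof.
move=> /eqP fa0; have [b fb] := f_surj (f a)^-1; exists b.
by rewrite /m /= rmorphB rmorphM fb rmorph1 divff // subrr.
Qed.

Lemma flA_finite t (I : set A) : gpow gs t `<=` I -> flA (t ^ size gs) I setT.
Proof. by move=> sub; apply: fl_finite sub; rewrite mgs. Qed.

(** With a system of d' parameters x, [fa e] contains the powers x^(w p^e), so the length grows at
    most like p^{ed'}. *)
Lemma small_dim d d' : (d' < d)%N -> dim_le [set (0 : A)] d' ->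
  exists C, forall e, (lenA (fa e) setT <= C * p ^ (e * d.-1))%N.
Proof.
move=> dd hdim; have m0 : [set (0 : A)] `<=` m by move=> _ ->; rewrite /m /= rmorph0.
have [xs [sxs xsm [t ht]]] := system_of_parameters noethA m_prime primem mgs (@submod_zero A A^o) m0 hdim.
have f1 := flA_finite ht; exists (w ^ d' * t ^ size gs)%N => e.
have fe := fl_exprs (w * p ^ e) (@submod_zero A A^o) f1.
apply: leq_trans (flen_le (n := (w * p ^ e) ^ size xs * t ^ size gs) _) _.
  apply: fl_mono fe; apply: adjoins_min; first exact: fa_ideal.
    by move=> _ ->; exact: idl0 (fa_ideal e).
  move=> _ /mapP[x /xsm mx ->]; apply: fa_low; rewrite mgs in mx.
  by have := gpow_exp (w * p ^ e) mx; rewrite mul1n.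
rewrite sxs expnMn mulnAC leq_mul2l -expnM leq_pexp2l ?orbT ?prime_gt0 ?(pcharf_prime pA) //.
by rewrite leq_mul2l -ltnS prednK ?dd ?orbT //; apply: leq_ltn_trans dd.
Qed.

(** [core] is applied to the completion B, finite over k[[X]] by means of a coefficient field and a
    system of parameters. Lengths are compared through filtrations, which extend to B, and strict
    chains, which remain strict there. *)
Lemma local_core d (K : set A) : (0 < d)%N -> dim_le [set (0 : A)] d -> is_ideal K ->
  exists e0 C, exists g : nat -> nat,
   [/\ forall e, (g e.+1 <= p ^ d * g e + C * p ^ (e.+1 * d.-1))%N,
       forall e, (lenA (fa (e + e0)) setT <= g e)%N,
       forall e, (g e <= lenA (fa (e + e0)) setT + C * p ^ (e * d.-1))%N &
       forall e, (lenA (idprod (fa (e + e0)) K) K + lenA (ideal_add K (fa (e + e0))) setT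
                  <= lenA (fa (e + e0)) setT + C * p ^ (e * d.-1))%N].
Proof.
move=> d0 hdim hK; have m0 : [set (0 : A)] `<=` m by move=> _ ->; rewrite /m /= rmorph0.
have [xs [sxs xsm [t ht]]] := system_of_parameters noethA m_prime primem mgs (@submod_zero A A^o) m0 hdim.
have proper : ~ gpow gs 1 1 by rewrite -mgs /m /= rmorph1 => /eqP; rewrite oner_eq0.
have [B [M [iota hB]]] := completion_exists proper.
have hM := cpl_filt hB; have hMi j := filt_ideal hM j.
have M_iota1 a : M 1%N (iota a) <-> f a = 0.
  by rewrite -[f a = 0]/(m a) mgs; exact: (cpl_mem hB 1 a).
(* The residue map of B is f applied to a representative in A modulo M 1. *)
have /choice[r hr] := cpl_dense hB 1.
have rE b a : M 1%N (b - iota a) -> f (r b) = f a.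
  move=> h; apply/eqP; rewrite -subr_eq0 -rmorphB; apply/eqP/M_iota1; rewrite rmorphB.
  have -> : iota (r b) - iota a = (b - iota a) - (b - iota (r b)) by ring.
  exact: idlB.
have gz : zmod_morphism (f \o r).
  move=> b c; rewrite /= -rmorphB; apply: rE; rewrite rmorphB.
  have -> : b - c - (iota (r b) - iota (r c)) = (b - iota (r b)) - (c - iota (r c)) by ring.
  exact: idlB.
have gm : monoid_morphism (f \o r).
  split=> [|b c] /=; first by rewrite -(rmorph1 f); apply: rE; rewrite rmorph1 subrr; exact: idl0.
  rewrite -rmorphM; apply: rE; rewrite rmorphM.
  have -> : b * c - iota (r b) * iota (r c) = (b - iota (r b)) * c + iota (r b) * (c - iota (r c)) by ring.
  by apply: (idlD (hMi _)); [exact: idlMr|exact: idlM].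
pose gB : {rmorphism B -> k} := HB.pack (f \o r)
  (GRing.isZmodMorphism.Build _ _ _ gz) (GRing.isMonoidMorphism.Build _ _ _ gm).
have gB_iota a : gB (iota a) = f a by apply: rE; rewrite subrr; exact: idl0.
have gB_surj c : exists b, gB b = c by have [a <-] := f_surj c; exists (iota a).
have gB_ker b : gB b = 0 <-> M 1%N b.
  rewrite /gB /= -M_iota1; split=> h.
    by rewrite -(subrK (iota (r b)) b); apply: idlD.
  by rewrite -(subKr b (iota (r b))); apply: idlB.
have pB : p \in [pchar B].
  by rewrite inE (pcharf_prime pA) -(rmorph_nat iota) (pcharf0 pA) rmorph0 eqxx.
have [kap0 hkap0] := coefficient_field hM pB gB_surj gB_ker.
have [D [Xs [kap [sXs hD]]]] := power_series_ring_exists k d.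
have ysM y : y \in map iota xs -> M 1%N y.
  by move=> /mapP[x /xsm mx ->]; apply/M_iota1.
have [|phi [phik phiX]] := psr_eval hD hM kap0 (ys := map iota xs) _ ysM.
  by rewrite size_map sxs sXs.
have hdom := psr_dom hD.
have hphiX y : y \in map phi Xs -> M 1%N y by rewrite phiX; exact: ysM.
have phiM j a : gpow Xs j a -> M j (phi a) by apply: (phi_filt hM hphiX).
pose n : set D := gpow Xs 1.
have resD a : ~ n a -> exists b, n (a * b - 1).
  move=> na; have [c hc] := psr_res hD a.
  have c0 : c != 0 by apply/eqP => c0; apply: na; move: hc; rewrite c0 rmorph0 subr0.
  exists (kap c^-1); have -> : a * kap c^-1 - 1 = (a - kap c) * kap c^-1.
    by rewrite mulrBl -rmorphM divff // rmorph1.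
  exact: idlMr (gpow_ideal _ _) hc.
have denseD b : exists a, M 1%N (b - phi a).
  exists (kap (gB b)); rewrite phik; apply/gB_ker.
  by rewrite rmorphB hkap0 subrr.
have nM a : n a -> M 1%N (phi a) by exact: phiM.
have torD c : c != 0 -> exists k0, forall N,
    @fl D n D^o (k0 * N ^ (size Xs).-1) (adjoin (gpow Xs N : set D^o) c) setT.
  by move=> /(psr_torsion hD)[k0 hk0]; exists (k0 * size Xs)%N.
(* Since D maps onto B modulo M 1, and M 1 kills each step, the steps over A become steps over D
   after extension. *)
have down N (I U : set A) : flA N I U -> dfl phi n N (extend iota I) (extend iota U).
  elim: N I => [|N IH] I; first exact: extend_mono.
  move=> [y [Uy my fN]]; have hE := extend_ideal iota I.
  have M1y b : M 1%N b -> extend iota I (b * iota y).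
    have m1 : gpow gs 1 `<=` m by rewrite mgs.
    move=> /(filt_sub_extend hB (ex_intro _ gs mgs) m1); move: b.
    suff : extend iota m `<=` [set b | extend iota I (iota y * b)] by move=> h b /h /=; rewrite mulrC.
    apply: extend_min; first exact: pre_ideal.
    by move=> a /my ha; rewrite /= mulrC -rmorphM; exact: extend_mem.
  exists (iota y); split; [exact: extend_mem|by move=> a /nM; exact: M1y|].
  apply: (@fl_mono D n (restr phi) N (extend iota (adjoin (I : set A^o) y))); last exact: IH.
  have hdI := ideal_dsub phi hE.
  apply: extend_min.
    split.
    - exact: dsub0 (dadj_submod (iota y) hdI).
    - by move=> u v; exact: dsubD (dadj_submod (iota y) hdI).
    - move=> b z [a ha]; have [a' ha'] := denseD (b * phi a); exists a'.
      move: ha; rewrite /GRing.scale /= /restr_scale => ha.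
      have -> : b * z - phi a' * iota y = b * (z - phi a * iota y) + (b * phi a - phi a') * iota y by ring.
      by apply: (idlD hE); [exact: (idlM b hE ha)|exact: M1y].
  move=> z [b hb]; have [a' ha'] := denseD (iota b); exists a'.
  rewrite /GRing.scale /= /restr_scale.
  have -> : iota z - phi a' * iota y = iota (z - b * y) + (iota b - phi a') * iota y.
    by rewrite rmorphB rmorphM; ring.
  by apply: (idlD hE); [exact: extend_mem|exact: M1y].
(* A power of m meets U inside I, so strict chains between I and U survive extension and bound the
   length over D from below. *)
have up N t0 (I U : set A) : is_ideal I -> is_ideal U -> I `<=` U ->
    (forall z, gpow gs t0 z -> U z -> I z) -> flA N I U ->
    (lenA I U <= dlen phi n (extend iota I) (extend iota U))%N.
  move=> hI hU IU hsub fN.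
  apply: (@sc_fl D n (restr phi) resD _ _ (extend iota I) (extend iota U)).
  - exact: ideal_dsub (extend_ideal _ _).
  - exact: ideal_dsub (extend_ideal _ _).
  - by apply: (sc_extend hB phi hI hU IU hsub); exact: flen_sc fN.
  - exact: (@flenP D n (restr phi)) (down _ _ _ fN).
have ET : extend iota setT = setT.
  apply/seteqP; split=> // b _; rewrite -[b]mulr1 -(rmorph1 iota).
  by apply: (idlM _ (extend_ideal _ _)); exact: extend_mem.
(* B modulo the parameters has finite length over D, hence finitely many generators; by Nakayama for
   complete modules they generate B. *)
have [us hus] : exists us : seq B, forall b, dadjs phi [set 0] us b.
  have hX : is_ideal (gpow xs 1) by apply: gpow_ideal.
  have htx : gpow gs t `<=` gpow xs 1.
    apply: subset_trans ht _; apply: (@adjoins_min A A^o) => //; first by move=> _ ->; exact: idl0 hX.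
    by move=> x; exact: gpow1_mem.
  have := down _ _ _ (flA_finite htx); rewrite ET => /dfl_gens[us hus].
  exists us; apply: (complete_finite hD hM hphiX) => b.
  by have := hus b; rewrite extend_gpow phiX.
pose fB e := extend iota (fa e).
have fB_frob e z : fB e z -> fB e.+1 (z ^+ p).
  move: z; suff : fB e `<=` [set z | fB e.+1 (z ^+ p)] by [].
  have hE := extend_ideal iota (fa e.+1).
  apply: extend_min => [|x fx]; last by rewrite /= -rmorphXn; apply: extend_mem; apply: fa_frob.
  split=> [|x y hx hy|a x hx] /=.
  - by rewrite expr0n gtn_eqF ?(p_gt0 pB) //; exact: idl0 hE.
  - by rewrite (exprDp1 pB); exact: idlD hE hx hy.
  - by rewrite /GRing.scale /= exprMn; exact: idlM hE hx.
have fB_low e a : gpow Xs (w * p ^ e) a -> fB e (phi a).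
  by move=> /phiM; apply: (filt_sub_extend hB (fingen noethA (fa_ideal e)) (@fa_low e)).
have fB_shift e0 : exists2 x : D, x != 0 & forall e z, fB (e + e0)%N z ->
  ideal_gen [set u | exists2 y, fB e y & u = y ^+ (p ^ e0)] (phi x * z).
  have [t0 ht0] := fa_shift e0.
  (* As d > 0 there is a first variable X, sent to a parameter x. Since x^t0 lies in (gs)^t0, the
     multiplier X^t0 works. *)
  case: (Xs) (xs) sXs sxs phiX xsm (psr_neq0 hD) => [|X Xs'] [|x xs'] //=; try by move=> e; rewrite -e in d0.
  move=> _ _ [phiXx _] xm Xneq0; exists (X ^+ t0).
    by apply: (dom_exp hdom); apply: Xneq0; rewrite mem_head.
  move=> e z; rewrite rmorphXn phiXx; move: z.
  pose J := ideal_gen [set u | exists2 y, fB e y & u = y ^+ (p ^ e0)].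
  have hJ : is_ideal J by apply: ideal_gen_ideal.
  suff : fB (e + e0)%N `<=` [set z | J (iota x ^+ t0 * z)] by [].
  apply: extend_min; first exact: pre_ideal.
  move=> z fz; rewrite /= -rmorphXn -rmorphM.
  have hx : gpow gs t0 (x ^+ t0).
    have mx : gpow gs 1 x by rewrite -mgs; apply: xm; rewrite mem_head.
    by have := gpow_exp t0 mx; rewrite mul1n.
  have := ht0 e _ _ hx fz; move: (x ^+ t0 * z).
  suff : ideal_gen [set u | exists2 y, fa e y & u = y ^+ (p ^ e0)] `<=` [set u | J (iota u)] by [].
  apply: ideal_gen_min; first exact: preimage_ideal.
  move=> _ [y fy ->] /=; rewrite rmorphXn; apply: ideal_gen_mem.
  by exists (iota y) => //; exact: extend_mem.
have hEK := extend_ideal iota K.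
have [gsK eK] := fingen noethA hK.
have gEK : exists cs, extend iota K = gpow cs 1 by exists (map iota gsK); rewrite eK extend_gpow.
have [e0 [C [g [g' [gS g1 g2 g3 g4]]]]] := core pB hdom resD torD hus
  (fun e => extend_ideal iota (fa e)) fB_frob fB_low fB_shift hEK gEK.
rewrite sXs in gS g2 g3; exists e0, C, g.
have lenT I t0 : is_ideal I -> gpow gs t0 `<=` I ->
    (lenA I setT <= dlen phi n (extend iota I) setT)%N /\
    (dlen phi n (extend iota I) setT <= lenA I setT)%N.
  move=> hI sub; have fI := flenP (flA_finite sub); split.
    have := up _ t0 _ _ hI (@idlT A) (@subsetT _ _) (fun z hz _ => sub z hz) fI.
    by rewrite ET.
  by apply: (@flen_le D n (restr phi)); have := down _ _ _ fI; rewrite ET.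
have lenfa e := lenT _ _ (fa_ideal e) (@fa_low e).
split=> // e; first exact: leq_trans (lenfa _).1 (g1 e).
  by apply: leq_trans (g2 e) _; rewrite leq_add2r; exact: (lenfa _).2.
apply: leq_trans (leq_trans _ (g3 e)) _; last by rewrite leq_add2r; exact: (lenfa _).2.
set E := (e + e0)%N; have hfE := fa_ideal E.
have hKf : is_ideal (ideal_add K (fa E)) by exact: (@sum_submod A A^o _ _ hK hfE).
have Kf_low : gpow gs (w * p ^ E) `<=` ideal_add K (fa E).
  by apply: subset_trans (@fa_low E) _; exact: (@sum_subr A A^o).
have eqsum : dsum (extend iota K) (extend iota (fa E)) = extend iota (ideal_add K (fa E)).
  apply/seteqP; split.
    apply: dsum_min; first exact: (ideal_dsub phi (extend_ideal _ _)).
      by apply: extend_mono; exact: (@sum_subl A A^o).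
    by apply: extend_mono; exact: (@sum_subr A A^o).
  apply: extend_min.
    exact: (@sum_submod B B^o _ _ (extend_ideal _ _) (extend_ideal _ _)).
  move=> _ [x [y [Kx fy ->]]]; rewrite rmorphD; exists (iota x), (iota y).
  by split=> //; exact: extend_mem.
have eqpr : pr phi (extend iota (fa E)) (extend iota K) = extend iota (idprod (fa E) K).
  have hE := extend_ideal iota (idprod (fa E) K).
  apply/seteqP; split.
    apply: pr_min; first exact: ideal_dsub.
    move=> x y; move: x; suff : extend iota (fa E) `<=` [set x | forall y, extend iota K y ->
      extend iota (idprod (fa E) K) (x * y)] by move=> h x /h; apply.
    apply: extend_min.
      split=> [z _|u v hu hv z hz|a u hu z hz] /=; first by rewrite mul0r; exact: idl0.
        by rewrite mulrDl; apply: (idlD hE); [exact: hu|exact: hv].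
      by rewrite /GRing.scale /= -mulrA; apply: (idlM _ hE); exact: hu.
    move=> x fx; suff : extend iota K `<=` [set y | extend iota (idprod (fa E) K) (iota x * y)] by [].
    apply: extend_min; first exact: pre_ideal.
    move=> z Kz; rewrite /= -rmorphM; apply: extend_mem; apply: ideal_gen_mem.
    by exists x, z.
  have hP : is_ideal (pr phi (extend iota (fa E)) (extend iota K)).
    split=> [|u v|b u]; [exact: dsub0 (pr_submod _ _ _)|exact: dsubD (pr_submod _ _ _)|].
    by apply: pr_stable => z; exact: (idlM b hEK).
  apply: extend_min => // z.
  suff : idprod (fa E) K `<=` [set z | pr phi (extend iota (fa E)) (extend iota K) (iota z)] by apply.
  apply: ideal_gen_min; first exact: preimage_ideal.
  move=> _ [x [y [fx Ky ->]]] /=; rewrite rmorphM; apply: pr_mem; exact: extend_mem.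
apply: leq_add; last first.
  by apply: leq_trans (g4 e); rewrite eqsum; exact: (lenT _ _ hKf Kf_low).1.
rewrite -/E eqpr.
have hIP : is_ideal (idprod (fa E) K) by exact: ideal_gen_ideal.
have IPK : idprod (fa E) K `<=` K.
  by apply: ideal_gen_min => // _ [x [y [_ Ky ->]]]; exact: idlM.
(* Artin-Rees supplies the power of m whose trace on K lies in the product ideal, as [up]
   requires. *)
have [N hN] := artin_rees noethA gs (w * p ^ E) hK.
have fIP : flA (size gsK * (w * p ^ E) ^ size gs) (idprod (fa E) K) K.
  apply: (@fl_gen A m A^o _ _ (fa E) gsK) => //.
  - by move=> y yin; rewrite eK; exact: gpow1_mem.
  - move=> y a yin ha; apply: ideal_gen_mem; exists a, y; split=> //.
    by rewrite eK; exact: gpow1_mem.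
  - rewrite {1}eK; apply: subset_trans (@gpow1_adjoins A gsK) _.
    by apply: adjoins_mono => _ ->; exact: idl0 hIP.
  - exact: flA_finite (@fa_low E).
apply: (up _ N _ _ hIP hK IPK _ fIP) => z hz Kz.
have := hN z hz Kz; move: z {hz Kz}; apply: ideal_gen_min => // _ [x [y [hx Ky ->]]].
by apply: ideal_gen_mem; exists x, y; split=> //; exact: (@fa_low E).
Qed.

End LocalCore.

(** * The ideals defining s-multiplicity *)

Section IdealPow.
Variable A : comNzRingType.

Lemma ideal_pow_gpow (cs : seq A) n : ideal_pow (gpow cs 1) n = gpow cs n.
Proof.
apply/seteqP; split.
  apply: ideal_gen_min; first exact: gpow_ideal.
  move=> _ [x [hx ->]]; elim: n x hx => [//|n IH] x hx.
  rewrite big_ord_recl; apply: (@gpow_mul _ cs 1 n); first exact: hx.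
  by apply: IH => i; exact: hx.
apply: (gpow_min (U := fun n => ideal_pow (gpow cs 1) n)).
- by move=> j; exact: ideal_gen_ideal.
- apply/seteqP; split=> // x _; rewrite -[x]mulr1; apply: (idlM _ (ideal_gen_ideal _)).
  by apply: ideal_gen_mem; exists (fun=> 1); split; [case|rewrite big_ord0].
- move=> j g a gin; move: a.
  suff : ideal_pow (gpow cs 1) j `<=` [set a | ideal_pow (gpow cs 1) j.+1 (g * a)] by [].
  apply: ideal_gen_min; first exact: pre_ideal (ideal_gen_ideal _).
  move=> _ [x [hx ->]]; apply: ideal_gen_mem.
  exists (fun i => if unlift ord0 i is Some i' then x i' else g); split.
    by move=> i; case: unliftP => [i' _|_]; [exact: hx|exact: gpow1_mem].
  rewrite big_ord_recl unlift_none; congr (_ * _); apply: eq_bigr => i _.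
  by rewrite liftK.
Qed.

Lemma gpow_gpow (gs cs : seq A) t n : gpow gs t `<=` gpow cs 1 -> gpow gs (t * n) `<=` gpow cs n.
Proof.
move=> sub; elim: n => [|n IH]; first by rewrite muln0.
rewrite mulnS; apply: subset_trans (gpow_add_sub sub) _; exact: gmul_mono.
Qed.

End IdealPow.

Section CeilBounds.
Variables (K : realType) (s : K) (p : nat).
Hypotheses (s_gt0 : 0 < s) (p_gt0 : (0 < p)%N).
Definition ceil_pow e := `|Num.ceil (s * (p ^ e)%:R)|%N.

Lemma natceil_spec (x : K) (n := `|Num.ceil x|%N) : 0 < x ->
  [/\ x <= n%:R, n%:R < x + 1 & forall j : nat, x <= j%:R -> (n <= j)%N].
Proof.
move=> x0; have en : Num.ceil x = n%:Z by rewrite /n gez0_abs // ltW // ceil_gt0.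
split.
- by have := ceil_ge x; rewrite en.
- by have := ceilB1_lt x; rewrite en intrB mulr1z ltrBlDr.
- by move=> j xj; rewrite -lez_nat -en ceil_le_int.
Qed.

Let ppos e : (0 : K) < (p ^ e)%:R. Proof. by rewrite ltr0n expn_gt0 p_gt0. Qed.
Let spos e : 0 < s * (p ^ e)%:R. Proof. exact: mulr_gt0. Qed.

Lemma ceil_powS e : (ceil_pow e.+1 <= p * ceil_pow e)%N.
Proof.
have [h1 _ _] := natceil_spec (spos e); have [_ _] := natceil_spec (spos e.+1); apply.
by rewrite expnS !natrM mulrCA ler_wpM2l.
Qed.

Lemma ceil_pow_le e : (ceil_pow e <= ceil_pow 0 * p ^ e)%N.
Proof.
have [h1 _ _] := natceil_spec (spos 0); have [_ _] := natceil_spec (spos e); apply.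
by rewrite natrM; apply: ler_wpM2r => //; move: h1; rewrite /ceil_pow expn0 mulr1.
Qed.

(** Rounding up costs less than 1 before multiplication by p^e0, hence at most p^e0 after it,
    uniformly in e. *)
Lemma ceil_pow_ge e e0 : (p ^ e0 * ceil_pow e <= ceil_pow (e + e0) + p ^ e0)%N.
Proof.
have [_ h1 _] := natceil_spec (spos e); have [h2 _ _] := natceil_spec (spos (e + e0)).
rewrite -(ler_nat K) natrD natrM; apply: le_trans (_ : (p ^ e0)%:R * (s * (p ^ e)%:R + 1) <= _).
  by apply: ler_wpM2l => //; exact: ltW.
rewrite mulrDr mulr1 lerD2r; apply: le_trans h2.
by rewrite expnD natrM mulrCA [(p ^ e0)%:R * _]mulrC.
Qed.

End CeilBounds.

Section SIdeal.
Variables (K : realType) (s : K) (A : comNzRingType) (p : nat).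
Hypotheses (s_gt0 : 0 < s) (pA : p \in [pchar A]).
Variables (I J : set A) (gs cs : seq A) (t0 : nat).
Hypotheses (hJ : is_ideal J) (Ics : I = gpow cs 1) (It0 : gpow gs t0 `<=` I).
Let p0 : (0 < p)%N := p_gt0 pA.
Local Notation fa := (s_ideal p I J s).
Local Notation N := (ceil_pow s p).

Lemma frobenius_pow_ideal q : is_ideal (frobenius_pow J q).
Proof. exact: ideal_gen_ideal. Qed.

Lemma s_ideal_ideal e : is_ideal (fa e).
Proof. exact: (@sum_submod A A^o _ _ (ideal_gen_ideal _) (ideal_gen_ideal _)). Qed.

Lemma s_ideal_gpow e x : gpow cs (N e) x -> fa e x.
Proof.
rewrite -ideal_pow_gpow -Ics => h; exists x, 0; rewrite addr0; split=> //.
exact: idl0 (frobenius_pow_ideal _).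
Qed.

Lemma s_ideal_frobenius e x : frobenius_pow J (p ^ e) x -> fa e x.
Proof. by move=> h; exists 0, x; rewrite add0r; split=> //; exact: idl0 (ideal_gen_ideal _). Qed.

Lemma s_ideal_split e z : fa e z -> exists x y,
  [/\ gpow cs (N e) x, frobenius_pow J (p ^ e) y & z = x + y].
Proof. by move=> [x [y []]]; rewrite Ics ideal_pow_gpow => hx hy ->; exists x, y. Qed.

Lemma s_ideal_frob e z : fa e z -> fa e.+1 (z ^+ p).
Proof.
move=> /s_ideal_split[x [y [hx hy ->]]]; rewrite (exprDp1 pA).
apply: (idlD (s_ideal_ideal _)).
  apply: s_ideal_gpow; apply: gpow_decr (gpow_exp p hx).
  by rewrite mulnC ceil_powS.
apply: s_ideal_frobenius; move: y hy.
suff : frobenius_pow J (p ^ e) `<=` [set y | frobenius_pow J (p ^ e.+1) (y ^+ p)] by [].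
have hF := frobenius_pow_ideal (p ^ e.+1).
apply: ideal_gen_min => [|_ [y Jy ->]]; last first.
  by rewrite /= -exprM -expnSr; apply: ideal_gen_mem; exists y.
split=> [|u v hu hv|a u hu] /=.
- by rewrite expr0n gtn_eqF //; exact: idl0 hF.
- by rewrite (exprDp1 pA); exact: idlD hF hu hv.
- by rewrite /GRing.scale /= exprMn; exact: idlM hF hu.
Qed.

Lemma s_ideal_low e : gpow gs (t0 * N 0 * p ^ e) `<=` fa e.
Proof.
have sub : gpow gs t0 `<=` gpow cs 1 by rewrite -Ics.
move=> x hx; apply: s_ideal_gpow; apply: (gpow_gpow (n := N e) sub).
by apply: gpow_decr hx; rewrite -mulnA leq_mul2l ceil_pow_le ?orbT.
Qed.

(** For J there is no loss, since p^(e+e0)-th powers are p^e0-th powers of p^e-th powers. Only the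
    powers of I need a multiplier, bounded independently of e. *)
Lemma s_ideal_shift e0 : exists t, forall e x z, gpow gs t x -> fa (e + e0)%N z ->
  ideal_gen [set u | exists2 y, fa e y & u = y ^+ (p ^ e0)] (x * z).
Proof.
pose q0 := (p ^ e0)%N; have q0_gt0 : (0 < q0)%N by rewrite expn_gt0 p0.
(* One q0 pays for the ceiling, q0 times [size cs] for [gpow_frob], and t0 converts powers of (gs)
   into powers of (cs). *)
exists (t0 * (q0 + q0 * size cs))%N => e x z hx /s_ideal_split[u [v [hu hv ->]]].
have hG := ideal_gen_ideal [set u | exists2 y, fa e y & u = y ^+ (p ^ e0)].
have sub : gpow gs t0 `<=` gpow cs 1 by rewrite -Ics.
rewrite mulrDr; apply: (idlD hG).
  have : gpow cs (q0 * (N e + size cs)) (x * u).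
    apply: gpow_decr (gpow_mul (gpow_gpow sub hx) hu).
    by rewrite mulnDr addnAC leq_add2r addnC ceil_pow_ge.
  move=> /(gpow_frob q0_gt0); apply: ideal_gen_min => // _ [y hy ->].
  by apply: ideal_gen_mem; exists y => //; exact: s_ideal_gpow.
apply: (idlM _ hG); move: v hv; apply: ideal_gen_min => // _ [y Jy ->].
apply: ideal_gen_mem; exists (y ^+ (p ^ e)); last by rewrite -exprM -expnD.
by apply: s_ideal_frobenius; apply: ideal_gen_mem; exists y.
Qed.

End SIdeal.

(** * Lengths over a ring and over its quotients *)

Section Image.
Variables (P A : comNzRingType) (pi : {rmorphism P -> A}).
Hypothesis pi_surj : forall a, exists x, pi x = a.

Lemma image_ideal (I : set P) : is_ideal I -> is_ideal (pi @` I).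
Proof.
move=> hI; split.
- by exists 0; [exact: idl0 hI|rewrite rmorph0].
- by move=> _ _ [x Ix <-] [y Iy <-]; exists (x + y); [exact: idlD hI Ix Iy|rewrite rmorphD].
- move=> a _ [x Ix <-]; have [b <-] := pi_surj a.
  by exists (b * x); [exact: idlM hI Ix|rewrite rmorphM].
Qed.

Lemma image_gpow gs n : gpow (map pi gs) n `<=` pi @` gpow gs n.
Proof.
apply: (gpow_min (U := fun n => pi @` gpow gs n)).
- by move=> j; apply: image_ideal; exact: gpow_ideal.
- by apply/seteqP; split=> // a _; have [x <-] := pi_surj a; exists x.
- move=> j _ _ /mapP[g gin ->] [x hx <-]; exists (g * x); last by rewrite rmorphM.
  by apply: gmul_mem => //; exact: gpow_ideal.
Qed.

Lemma gpow_image gs n x : gpow gs n x -> gpow (map pi gs) n (pi x).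
Proof.
move: x; apply: (gpow_min (U := fun n => [set x | gpow (map pi gs) n (pi x)])).
- by move=> j; apply: preimage_ideal; exact: gpow_ideal.
- by apply/seteqP.
- move=> j g a gin ha; rewrite /mkset rmorphM; apply: (@gmul_mem _ _ (gpow (map pi gs) j)) => //.
    exact: gpow_ideal.
  exact: map_f.
Qed.

Variables (mP : set P) (mA : set A).
Hypothesis m_compat : forall x, mP x <-> mA (pi x).

Lemma fl_image n (L U : set A) :
  @fl P mP (restr pi) n L U <-> @fl A mA A^o n L U.
Proof.
elim: n L => [//|n IH] L /=.
have E (y : A) : @adjoin P (restr pi) L y = @adjoin A A^o L y.
  apply/seteqP; split=> z [a La]; first by exists (pi a).
  by have [b eb] := pi_surj a; exists b; rewrite /GRing.scale /= /restr_scale eb.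
split=> -[y [Uy my fy]]; exists y; split=> //.
- by move=> a ma; have [b eb] := pi_surj a; rewrite -eb; apply: (my b); apply/m_compat; rewrite eb.
- by rewrite -E; apply/IH.
- by move=> a /m_compat; exact: my.
- by rewrite E; apply/IH.
Qed.

Lemma fl_preimage n (L : set A) :
  @fl A mA A^o n L setT <-> @fl P mP P^o n [set x | L (pi x)] setT.
Proof.
elim: n L => [|n IH] L /=.
  split=> h x _; first exact: h.
  by have [z <-] := pi_surj x; exact: h.
have E (y : P) : @adjoin P P^o [set x | L (pi x)] y = [set x | @adjoin A A^o L (pi y) (pi x)].
  apply/seteqP; split=> z [a La].
    by exists (pi a); move: La; rewrite /= rmorphB /GRing.scale /= rmorphM.
  have [b eb] := pi_surj a; exists b; rewrite /= rmorphB /GRing.scale /= rmorphM eb.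
  exact: La.
split=> -[y [_ my fy]].
- have [y' ey] := pi_surj y; exists y'; split=> //.
  + by move=> a /m_compat /my; rewrite /= /GRing.scale /= rmorphM ey.
  + by rewrite E ey; apply/IH.
- exists (pi y); split=> //.
  + move=> a; have [b <-] := pi_surj a; move=> /m_compat /my.
    by rewrite /= /GRing.scale /= rmorphM.
  + by apply/IH; rewrite -E.
Qed.

Lemma flen_iff (P1 P2 : comNzRingType) (m1 : set P1) (m2 : set P2) (N1 : lmodType P1) (N2 : lmodType P2)
    (L1 U1 : set N1) (L2 U2 : set N2) :
  (forall n, fl m1 n L1 U1 <-> fl m2 n L2 U2) -> flen m1 L1 U1 = flen m2 L2 U2.
Proof.
move=> h; rewrite /flen; congr (xget _ _); apply/seteqP.
by split=> n [/h f hn]; split=> // n' /h; exact: hn.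
Qed.

Lemma flen_image (L U : set A) : @flen P mP (restr pi) L U = @flen A mA A^o L U.
Proof. by apply: flen_iff => n; exact: fl_image. Qed.

Lemma flen_preimage (L : set A) :
  @flen A mA A^o L setT = @flen P mP P^o [set x | L (pi x)] setT.
Proof. by apply: flen_iff => n; exact: fl_preimage. Qed.

Lemma span_ideal_act (I : set P) : is_ideal I ->
  @Defs.span P (restr pi) (@ideal_act P (restr pi) I) = pi @` I.
Proof.
move=> hI; apply/seteqP; split.
  apply: (@span_min P (restr pi)).
    have [h0 hD hZ] := image_ideal hI; split=> // a x hx; exact: hZ.
  move=> _ [a [x [Ia ->]]]; have [b eb] := pi_surj x; exists (a * b); first exact: idlMr hI Ia.
  by rewrite rmorphM eb.
move=> _ [x Ix <-]; apply: (@span_sub P (restr pi)); exists x, (1 : A).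
by rewrite /GRing.scale /= /restr_scale mulr1.
Qed.

End Image.

(** * Krull dimension and local rings *)

Section PrimeChains.
Variable A : comNzRingType.

Definition prime_chain n := exists c : nat -> set A,
  (forall i, (i <= n)%N -> prime_ideal (c i)) /\ (forall i, (i < n)%N -> c i `<` c i.+1).

(** A positive value cannot be the default of [nat_sup], so it is attained and bounds all chains. *)
Lemma krull_dim_pos : (0 < krull_dim A)%N ->
  prime_chain (krull_dim A) /\ forall n, prime_chain n -> (n <= krull_dim A)%N.
Proof. by rewrite /krull_dim /nat_sup; case: xgetP. Qed.

Lemma krull_dim_eq d : prime_chain d -> (forall n, prime_chain n -> (n <= d)%N) -> krull_dim A = d.
Proof. exact: nat_sup_eq. Qed.

Lemma krull_dim_bounded (P : set A) b : prime_ideal P -> (forall n, prime_chain n -> (n <= b)%N) ->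
  forall n, prime_chain n -> (n <= krull_dim A)%N.
Proof.
move=> hP hb; have ex : exists n, `[< prime_chain n >].
  by exists 0%N; apply/asboolP; exists (fun=> P).
have bnd n : `[< prime_chain n >] -> (n <= b)%N by move=> /asboolP; exact: hb.
have [d /asboolP hd dmax] := ex_maxnP ex bnd.
have dmax' n : prime_chain n -> (n <= d)%N by move=> h; apply: dmax; apply/asboolP.
by rewrite (krull_dim_eq hd dmax').
Qed.

Lemma dim_le_krull d (I : set A) : (forall n, prime_chain n -> (n <= d)%N) -> dim_le I d.
Proof. by move=> h n c hc ltc; apply: h; exists c; split=> // i /hc[]. Qed.

End PrimeChains.

Section SurjectivePrimes.
Variables (A B : comNzRingType) (f : {rmorphism A -> B}).
Hypothesis f_surj : forall b, exists a, f a = b.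

Lemma prime_preimage (Q : set B) : prime_ideal Q -> prime_ideal [set a | Q (f a)].
Proof.
move=> [hQ Q1 Qp]; split=> [||x y] /=; first exact: preimage_ideal.
  by rewrite rmorph1.
by rewrite rmorphM; exact: Qp.
Qed.

Lemma prime_chain_preimage n : prime_chain B n -> prime_chain A n.
Proof.
move=> [c [hc ltc]]; exists (fun i => [set a | c i (f a)]); split=> [i /hc|i /ltc].
  exact: prime_preimage.
move=> [sub nsub]; split=> [x /sub //|h]; apply: nsub => b.
by have [a <-] := f_surj b; exact: h.
Qed.

Lemma prime_image (Q : set A) : (forall a, f a = 0 -> Q a) -> prime_ideal Q ->
  prime_ideal (f @` Q) /\ forall a, (f @` Q) (f a) -> Q a.
Proof.
move=> kQ [hQ Q1 Qp].
have im a : (f @` Q) (f a) -> Q a.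
  move=> [b Qb fb]; rewrite -(subrK b a); apply: (idlD hQ) => //.
  by apply: kQ; rewrite rmorphB fb subrr.
split=> //; split=> [||x y]; first exact: image_ideal.
  by rewrite -(rmorph1 f) => /im.
have [a <-] := f_surj x; have [b <-] := f_surj y; rewrite -rmorphM => /im /Qp[h|h].
  by left; exists a.
by right; exists b.
Qed.

Lemma prime_chain_image n (c : nat -> set A) : (forall a, f a = 0 -> c 0%N a) ->
  (forall i, (i <= n)%N -> prime_ideal (c i)) -> (forall i, (i < n)%N -> c i `<` c i.+1) ->
  prime_chain B n.
Proof.
move=> k0 hc ltc.
have ki i a : (i <= n)%N -> f a = 0 -> c i a.
  elim: i => [|i IH] le fa0; first exact: k0.
  by have /properW := ltc i le; apply; apply: IH => //; exact: ltnW.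
exists (fun i => f @` c i); split=> [i le|i lt].
  by have [] := prime_image (fun a => @ki i a le) (hc i le).
have [sub nsub] := ltc i lt; split; first exact: image_subset.
move=> h; apply: nsub => a ca.
have [_ im] := prime_image (fun a => @ki i a (ltnW lt)) (hc i (ltnW lt)).
by apply/im/h; exists a.
Qed.

End SurjectivePrimes.

Section LocalRings.
Variables (A : comNzRingType) (m : set A) (k : fieldType).
Hypothesis hA : local_ring m k.

Lemma local_prime_sub (P : set A) : prime_ideal P -> P `<=` m.
Proof.
case: hA => noethA _ uniqm _ [hP P1 _].
have [M [[hM M1 PM] Mmax]] := noetherian_max noethA
  (F := fun I => [/\ is_ideal I, ~ I 1 & P `<=` I]) (And3 hP P1 (@subset_refl _ P))
  (fun I h => let: And3 h1 _ _ := h in h1).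
rewrite -(uniqm M) //; split=> // J hJ MJ.
have [J1|J1] := pselect (J 1).
  by right; apply/seteqP; split=> // x _; rewrite -[x]mulr1; exact: (idlM _ hJ).
by left; apply/seteqP; split=> //; apply: Mmax => //; split=> //; exact: subset_trans MJ.
Qed.

Lemma local_residue : exists f : {rmorphism A -> k},
  (forall y, exists x, f x = y) /\ m = [set x | f x = 0].
Proof. by case: hA. Qed.

Lemma local_prime : prime_ideal m.
Proof. by have [f [_ ->]] := local_residue; exact: m_prime. Qed.

Lemma local_unit a : ~ m a -> exists b, m (a * b - 1).
Proof. by have [f [fs ->]] := local_residue; exact: m_res. Qed.

Lemma local_noetherian : noetherian A. Proof. by case: hA. Qed.

End LocalRings.

(** If x in mA had image outside mB, then xa - 1 would for some a lie in the preimage of mB, a prime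
    ideal and so contained in mA; then 1 would lie in mA. *)
Lemma local_preimage (A B : comNzRingType) (mA : set A) (mB : set B) (k k' : fieldType)
    (f : {rmorphism A -> B}) : local_ring mA k -> local_ring mB k' ->
  (forall b, exists a, f a = b) -> forall x, mA x <-> mB (f x).
Proof.
move=> hA hB fs x.
have sub y : mB (f y) -> mA y.
  by move=> h; apply: (local_prime_sub hA (prime_preimage f (local_prime hB))).
split=> [mx|]; last exact: sub.
apply: contrapT => /(local_unit hB)[b]; have [a <-] := fs b.
rewrite -rmorphM -(rmorph1 f) -rmorphB => /sub h.
have [hm m1 _] := local_prime hA; apply: m1.
by rewrite -(subKr (x * a) 1); apply: (idlB hm) => //; exact: (idlMr _ hm).
Qed.

Lemma lift_generators (P A : comNzRingType) (pi : {rmorphism P -> A}) (I : set P) :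
  (forall a, exists x, pi x = a) -> noetherian A -> is_ideal I ->
  exists xs, (forall x, x \in xs -> I x) /\
    forall x, I x -> exists2 z, gpow xs 1 z & pi x = pi z.
Proof.
move=> pi_surj noethA hI; have [as_ eas] := fingen noethA (image_ideal pi_surj hI).
have [xs [xsI exs]] : exists xs, (forall x, x \in xs -> I x) /\ map pi xs = as_.
  have : forall a, a \in as_ -> (pi @` I) a by move=> a; rewrite eas; exact: gpow1_mem.
  elim: as_ {eas} => [|a as_ IH] h; first by exists [::].
  have [x Ix px] := h a (mem_head _ _).
  have [|xs [xsI <-]] := IH; first by move=> b bin; apply: h; rewrite inE bin orbT.
  exists (x :: xs); rewrite /= px; split=> // y; rewrite inE => /orP[/eqP ->|/xsI] //.
exists xs; split=> // x Ix; have : (pi @` I) (pi x) by exists x.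
by rewrite eas -exs => /(image_gpow pi_surj)[z hz <-]; exists z.
Qed.

(** * Fiber products *)

Section FiberRing.
Variables (R S T : comNzRingType) (eR : {rmorphism R -> T}) (eS : {rmorphism S -> T}).
Local Notation P := (fiber_prod eR eS).
Local Notation fR := (@fiber_fst R S T eR eS).
Local Notation fS := (@fiber_snd R S T eR eS).

Lemma fiber_eq (x y : P) : fR x = fR y -> fS x = fS y -> x = y.
Proof.
by move=> h1 h2; apply/val_inj; move: h1 h2; rewrite /fiber_fst /fiber_snd; case: (val x); case: (val y) => a b c d /= -> ->.
Qed.

Lemma fiber_mk r s : eR r = eS s -> exists x : P, fR x = r /\ fS x = s.
Proof.
move=> h; have hf : (r, s) \in fiber_pred eR eS by apply/eqP.
by exists (FiberProd hf).
Qed.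

Lemma fiber_fst_surj : (forall t, exists s, eS s = t) -> forall r, exists x : P, fR x = r.
Proof. by move=> es r; have [s /esym/fiber_mk[x [h _]]] := es (eR r); exists x. Qed.

Lemma fiber_snd_surj : (forall t, exists r, eR r = t) -> forall s, exists x : P, fS x = s.
Proof. by move=> es s; have [r /fiber_mk[x [_ h]]] := es (eS s); exists x. Qed.

Lemma fiber_pchar p : p \in [pchar R] -> p \in [pchar S] -> p \in [pchar P].
Proof.
rewrite !inE => /andP[-> /eqP hR] /andP[_ /eqP hS]; apply/eqP.
by apply: fiber_eq; rewrite !rmorph_nat !rmorph0.
Qed.

(** I is generated by lifts of generators of its image in R together with generators of its
    intersection with the kernel of [fR], on which [fS] is injective. *)
Lemma fiber_noetherian : (forall t, exists r, eR r = t) -> (forall t, exists s, eS s = t) ->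
  noetherian R -> noetherian S -> noetherian P.
Proof.
move=> eRs eSs nR nS I hI.
have [xs [xsI hxs]] := lift_generators (fiber_fst_surj eSs) nR hI.
have hK : is_ideal [set x : P | I x /\ fR x = 0].
  have hI0 := @preimage_ideal _ _ fR [set 0] (@submod_zero R R^o).
  exact: (@submodI P P^o _ _ hI hI0).
have [ys [ysI hys]] := lift_generators (fiber_snd_surj eRs) nS hK.
exists (xs ++ ys); rewrite -gpow1_gen; apply/seteqP; split; last first.
  by apply: gpow1_min => // z; rewrite mem_cat => /orP[/xsI//|/ysI[]].
have hG := gpow_ideal (xs ++ ys) 1.
have subl : gpow xs 1 `<=` gpow (xs ++ ys) 1.
  by apply: gpow1_min => // z zin; apply: gpow1_mem; rewrite mem_cat zin.
have subr : gpow ys 1 `<=` gpow (xs ++ ys) 1.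
  by apply: gpow1_min => // z zin; apply: gpow1_mem; rewrite mem_cat zin orbT.
move=> x Ix; have [z hz ez] := hxs _ Ix.
have Iz : I z by move: z hz {ez}; exact: gpow1_min.
have [|w hw ew] := hys (x - z).
  by split; [exact: idlB hI Ix Iz|rewrite rmorphB ez subrr].
have w0 : fR w = 0.
  have : gpow ys 1 `<=` [set x : P | I x /\ fR x = 0] by exact: gpow1_min.
  by case/(_ _ hw).
rewrite -(subrK z x) (_ : x - z = w); first by apply: (idlD hG); [exact: subr|exact: subl].
by apply: fiber_eq => //; rewrite rmorphB ez subrr w0.
Qed.

(** The kernels of the two projections have product 0, so the first prime of a chain contains one of
    them, and the whole chain comes from R or from S. *)
Lemma fiber_krull_dim : (forall t, exists r, eR r = t) -> (forall t, exists s, eS s = t) ->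
  (0 < krull_dim R)%N -> (forall n, prime_chain S n -> (n <= krull_dim R)%N) ->
  krull_dim P = krull_dim R.
Proof.
move=> eRs eSs /krull_dim_pos[cR maxR] maxS; apply: krull_dim_eq.
  exact: (prime_chain_preimage (fiber_fst_surj eSs) cR).
move=> n [c [hc ltc]]; have [_ _ pr] := hc 0%N (leq0n _).
have [k1|k1] := pselect (forall x : P, fR x = 0 -> c 0%N x).
  by apply: maxR; exact: (@prime_chain_image _ _ fR (fiber_fst_surj eSs) n c k1 hc ltc).
apply: maxS; apply: (@prime_chain_image _ _ fS (fiber_snd_surj eRs) n c _ hc ltc) => y y0.
apply: contrapT => ny; apply: k1 => x x0.
have xy : x * y = 0.
  apply: fiber_eq; rewrite rmorphM rmorph0 /=; first by rewrite x0 mul0r.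
  by rewrite (y0 : fS y = 0) mulr0.
have cxy : c 0%N (x * y) by rewrite xy; have [h _ _] := hc 0%N (leq0n _); exact: idl0 h.
by have [] := pr x y cxy.
Qed.

Variables (mP : set P) (mS : set S).
Hypothesis hres : forall a, ~ mP a -> exists b, mP (a * b - 1).
Hypothesis mPS : forall x, mP x <-> mS (fS x).
Hypothesis eRs : forall t, exists r, eR r = t.
Variable I : set P.
Hypothesis hI : is_ideal I.
Variable n0 : nat.
Hypothesis fI : @fl P mP P^o n0 I setT.
Local Notation lenP := (@flen P mP P^o).
Local Notation LR := [set x : P | (fR @` I) (fR x)].
Local Notation LS := [set x : P | (fS @` I) (fS x)].
Local Notation LT := [set x : P | ((eR \o fR) @` I) ((eR \o fR) x)].

Hypothesis eSs : forall t, exists s, eS s = t.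

Let fT_surj : forall t, exists x, (eR \o fR) x = t.
Proof. by move=> t; have [r <-] := eRs t; have [x <-] := fiber_fst_surj eSs r; exists x. Qed.
Let hLR : is_ideal LR. Proof. exact/preimage_ideal/image_ideal/hI/fiber_fst_surj. Qed.
Let hLS : is_ideal LS. Proof. exact/preimage_ideal/image_ideal/hI/fiber_snd_surj. Qed.
Let hLT : is_ideal LT. Proof. exact/preimage_ideal/image_ideal/hI/fT_surj. Qed.
Let ILR : I `<=` LR. Proof. by move=> x Ix; exists x. Qed.
Let ILS : I `<=` LS. Proof. by move=> x Ix; exists x. Qed.
Let LSLT : LS `<=` LT.
Proof. by move=> x [y Iy e]; exists y => //=; rewrite !fiber_prod_comm e. Qed.

(** After splitting both sides at [LR] and at [LT], what remains is that the length of LT/LS is at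
    most that of LR/I. The inclusion of LR in LT induces a surjection because LT = LR + LS. *)
Lemma flen_fiber_ge : (lenP LR setT + lenP LS setT <= lenP I setT + lenP LT setT)%N.
Proof.
have fLR := fl_sub hres hI hLR ILR (@subsetT _ _) fI.
rewrite (flen_add hres hI hLR (@idlT P) ILR (@subsetT _ _) fI).
rewrite (flen_add hres hLS hLT (@idlT P) LSLT (@subsetT _ _) (@fl_mono P mP P^o _ _ _ _ ILS fI)).
rewrite [X in (_ <= X)%N]addnAC [X in (_ <= X)%N]addnC leq_add2l leq_add2r.
apply: (@flen_le P mP P^o); rewrite -[flen _ _ _]addn0.
apply: (@fl_rel P mP P^o P^o (fun x y => y = x) _ _ I LR) => //.
- by move=> x x' y y' -> ->.
- by move=> c x y ->.
- move=> x [y Iy e]; exists x => //; exists y => //=; by rewrite e.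
- by move=> x y Ix ->; exact: ILS.
- exact: flenP fLR.
(* The pair u = (fR(x - y), 0) belongs to P because fR(x - y) vanishes in T. Then y + u lies in LS
   and x - y - u in the kernel of fR, hence in LR. *)
move=> x [y Iy /= e]; have [u [u1 u2]] : exists u : P, fR u = fR (x - y) /\ fS u = 0.
  by apply: fiber_mk; rewrite !rmorphB e subrr rmorph0.
exists (y + u), (x - y - u); split; last by rewrite [y + u]addrC [RHS]addrC addrA !subrK.
  by exists y => //; rewrite rmorphD /= u2 addr0.
exists (x - y - u) => //; exists 0; first exact: idl0 hI.
by rewrite rmorphB /= u1 subrr rmorph0.
Qed.

Local Notation kS := [set s : S | eS s = 0].

(** LR is I plus the kernel of [fR], and s |-> (0, s) identifies the kernel of [eS] with the latter,
    carrying the product of that kernel with the image of I into I. *)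
Lemma flen_fiber_le b : @fl S mS S^o b (idprod (fS @` I) kS) kS ->
  (lenP I setT <= lenP LR setT + @flen S mS S^o (idprod (fS @` I) kS) kS)%N.
Proof.
move=> fb; rewrite (flen_add hres hI hLR (@idlT P) ILR (@subsetT _ _) fI) addnC leq_add2l.
apply: (@flen_le P mP P^o); rewrite -[flen _ _ _]addn0.
have fSs := fiber_snd_surj eRs.
have hI0 : is_ideal [set x : P | I x /\ fR x = 0].
  have h0 := @preimage_ideal _ _ fR [set 0] (@submod_zero R R^o).
  exact: (@submodI P P^o _ _ hI h0).
apply: (@fl_rel P mP (restr fS) P^o (fun s x => fS x = s /\ fR x = 0) _ _
  (idprod (fS @` I) kS) kS) => //.
- by move=> x x' y y' [<- h] [<- h']; rewrite !rmorphD /= h h' addr0.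
- by move=> c s x [<- h]; rewrite !rmorphM /= h mulr0.
- move=> s ks; have [|x [x1 x2]] := @fiber_mk 0 s; first by rewrite rmorph0 ks.
  by exists x => //; exists 0; [exact: idl0 hI|rewrite x1].
- have : idprod (fS @` I) kS `<=` fS @` [set x : P | I x /\ fR x = 0].
    apply: ideal_gen_min; first exact: image_ideal.
    move=> _ [_ [s [[x Ix <-] ks ->]]].
    have [|y [y1 y2]] := @fiber_mk 0 s; first by rewrite rmorph0 ks.
    exists (x * y); last by rewrite rmorphM /= y2.
    by split; [exact: idlMr hI Ix|rewrite rmorphM /= y1 mulr0].
  move=> sub s x /sub[y [Iy y0] ys] [xs x0].
  by rewrite (fiber_eq (x := x) (y := y)) ?xs ?ys ?x0 ?y0.
- by apply/(fl_image fSs mPS); exact: flenP fb.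
move=> x [y Iy e]; exists y, (x - y); split=> //; last by rewrite addrC subrK.
have h : fR (x - y) = 0 by rewrite rmorphB /= e subrr.
by exists (fS (x - y)); rewrite // /mkset -fiber_prod_comm h rmorph0.
Qed.

Lemma fiber_image_ker : [set s | ((eR \o fR) @` I) (eS s)] = ideal_add kS (fS @` I).
Proof.
apply/seteqP; split=> [s [x Ix /= e]|_ [u [_ [ku [x Ix <-] ->]]]]; last first.
  by exists x => //=; rewrite rmorphD ku add0r fiber_prod_comm.
exists (s - fS x), (fS x); split; [|by exists x|by rewrite subrK].
by rewrite /= rmorphB -e /= fiber_prod_comm subrr.
Qed.

End FiberRing.

(** * Limits *)

Section Limits.
Variables (K : realType) (p d : nat).
Hypotheses (p_gt1 : (1 < p)%N) (d_gt0 : (0 < d)%N).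
Import numFieldNormedType.Exports.

Definition scaled (l : nat -> nat) (e : nat) : K := (l e)%:R / (p ^ (e * d))%:R.

Let pp e : (0 : K) < (p ^ e)%:R. Proof. by rewrite ltr0n expn_gt0 (ltnW p_gt1). Qed.

Lemma scaled_error C e : scaled (fun e => C * p ^ (e * d.-1))%N e = C%:R / (p ^ e)%:R.
Proof.
rewrite /scaled -{2}(prednK d_gt0) mulnS expnD !natrM invfM [_^-1 * _]mulrC mulrA mulfK //.
by rewrite gt_eqF.
Qed.

Lemma scaled_le l l' e : (l e <= l' e)%N -> scaled l e <= scaled l' e.
Proof. by move=> h; rewrite ler_pM2r ?ler_nat // invr_gt0. Qed.

Lemma scaledD l l' e : scaled (fun e => l e + l' e)%N e = scaled l e + scaled l' e.
Proof. by rewrite /scaled natrD mulrDl. Qed.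

Lemma scaled_ge0 l e : 0 <= scaled l e.
Proof. by rewrite divr_ge0. Qed.

Lemma cvg_error (C : K) : (fun e => C / (p ^ e)%:R : K) @ \oo --> (0 : K).
Proof.
have -> : (fun e => C / (p ^ e)%:R : K) = geometric C p%:R^-1.
  by apply/funext => e; rewrite /geometric /= natrX exprVn.
apply: cvg_geometric; rewrite normfV normr_nat invf_lt1 ?ltr1n //.
by rewrite ltr0n ltnW.
Qed.

Lemma cvg_scaled_small C l : (forall e, (l e <= C * p ^ (e * d.-1))%N) ->
  scaled l @ \oo --> (0 : K).
Proof.
move=> h; apply: (@squeeze_cvgr _ _ _ _ (fun=> 0) (fun e => C%:R / (p ^ e)%:R)).
- by near=> e; rewrite scaled_ge0 -scaled_error scaled_le.
- exact: cvg_cst.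
- exact: cvg_error.
Unshelve. all: by end_near. Qed.

Lemma cvg_scaled (l g : nat -> nat) e0 C :
  (forall e, (g e.+1 <= p ^ d * g e + C * p ^ (e.+1 * d.-1))%N) ->
  (forall e, (l (e + e0) <= g e)%N) ->
  (forall e, (g e <= l (e + e0) + C * p ^ (e * d.-1))%N) ->
  cvgn (scaled l).
Proof.
move=> gS lg gl.
(* The added term absorbs the error: w decreases since twice C / p^(e+1) is at most C / p^e, as p >=
   2. *)
pose w e := scaled g e + C%:R / (p ^ e)%:R.
have wS e : w e.+1 <= w e.
  have h1 : scaled g e.+1 <= scaled g e + C%:R / (p ^ e.+1)%:R.
    rewrite -scaled_error.
    apply: le_trans (_ : scaled (fun e' => p ^ d * g e'.-1 + C * p ^ (e' * d.-1))%N e.+1 <= _).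
      exact: scaled_le.
    rewrite scaledD lerD2r /scaled /= mulSn expnD !natrM invfM mulrACA divff ?mul1r //.
    by rewrite gt_eqF.
  have h2 : C%:R / (p ^ e.+1)%:R + C%:R / (p ^ e.+1)%:R <= C%:R / (p ^ e)%:R :> K.
    rewrite -mulrDl ler_pdivrMr // mulrAC ler_pdivlMr // expnS -natrD -!natrM ler_nat.
    by nia.
  by rewrite /w; lra.
have wcvg : cvgn w.
  apply: nonincreasing_is_cvgn; first exact/nonincreasing_seqP.
  by exists 0 => _ [e _ <-]; rewrite addr_ge0 ?scaled_ge0 // divr_ge0.
have gcvg : scaled g @ \oo --> lim (w @ \oo).
  have -> : scaled g = (fun e => w e - C%:R / (p ^ e)%:R) by apply/funext => e; rewrite /w addrK.
  by rewrite -[X in _ --> X]subr0; apply: cvgB (@cvg_error _); exact: wcvg.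
have scvg : scaled (fun e => l (e + e0)%N) @ \oo --> lim (w @ \oo).
  apply: (@squeeze_cvgr _ _ _ _ (fun e => scaled g e - C%:R / (p ^ e)%:R) (scaled g)) => //.
    by near=> e; rewrite lerBlDr -scaled_error -scaledD !scaled_le.
  by rewrite -[X in _ --> X]subr0; apply: cvgB (@cvg_error _).
apply/cvg_ex; exists (lim (w @ \oo) / (p ^ (e0 * d))%:R).
rewrite -(cvg_shiftn e0).
have -> : [sequence scaled l (n + e0)%N]_n =
    (fun e => scaled (fun e => l (e + e0)%N) e / (p ^ (e0 * d))%:R).
  by apply/funext => e; rewrite /scaled /= mulnDl expnD natrM invfM mulrA.
by apply: cvgM => //; exact: cvg_cst.
Unshelve. all: by end_near. Qed.

Lemma cvg_scaled_fiber (lP lR lS lT : nat -> nat) (LR LS LT : K) e0 C :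
  (forall e, (lR e + lS e <= lP e + lT e)%N) ->
  (forall e, (lP (e + e0) + lT (e + e0) <=
              lR (e + e0) + lS (e + e0) + C * p ^ (e * d.-1))%N) ->
  scaled lR @ \oo --> LR -> scaled lS @ \oo --> LS -> scaled lT @ \oo --> LT ->
  scaled lP @ \oo --> LR + LS - LT.
Proof.
move=> lo up cR cS cT.
have cc : (fun e => scaled lR e + scaled lS e - scaled lT e) @ \oo --> LR + LS - LT.
  by apply: cvgB => //; exact: cvgD.
rewrite -(cvg_shiftn e0) in cc; rewrite -(cvg_shiftn e0).
apply: (@squeeze_cvgr _ _ _ _ (fun e => scaled lR (e + e0) + scaled lS (e + e0) - scaled lT (e + e0))
  (fun e => scaled lR (e + e0) + scaled lS (e + e0) - scaled lT (e + e0) + C%:R / (p ^ e)%:R)) => //.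
  near=> e; have lo' : scaled (fun e => lR e + lS e)%N (e + e0) <=
      scaled (fun e => lP e + lT e)%N (e + e0) by exact/scaled_le/lo.
  rewrite !scaledD in lo'.
  have h : C%:R / (p ^ e)%:R >= scaled (fun=> C * p ^ (e * d.-1))%N (e + e0).
    rewrite -scaled_error /scaled; apply: ler_wpM2l => //.
    by rewrite lef_pV2 ?posrE // ler_nat leq_pexp2l ?(ltnW p_gt1) // leq_mul2r leq_addr orbT.
  have : scaled (fun e => lP e + lT e)%N (e + e0) <=
      scaled (fun e' => lR e' + lS e' + C * p ^ (e * d.-1))%N (e + e0) by exact/scaled_le/up.
  by rewrite !scaledD /=; lra.
by rewrite -[X in _ --> X]addr0; apply: cvgD => //; exact: cvg_error.
Unshelve. all: by end_near. Qed.

End Limits.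

(** * The s-lengths of a quotient ring of P *)

Section SLengthImage.
Import numFieldNormedType.Exports.
Variables (K : realType) (s : K) (P : comNzRingType) (mP : set P) (p : nat).
Hypotheses (s_gt0 : 0 < s) (pP : p \in [pchar P]).
Variables (I J : set P) (gs cs : seq P) (t0 : nat).
Hypotheses (Ics : I = gpow cs 1) (It0 : gpow gs t0 `<=` I) (mgs : mP = gpow gs 1).
Hypothesis unitP : forall a, ~ mP a -> exists b, mP (a * b - 1).
Local Notation fP := (s_ideal p I J s).

Lemma s_ideal_finite e : exists n, @fl P mP P^o n (fP e) setT.
Proof.
have h := s_ideal_low s_gt0 pP J Ics It0 (e:=e).
by eexists; apply: (fl_finite _ h); rewrite mgs.
Qed.

Lemma s_length_ring e : s_length p I J P^o s e = @flen P mP P^o (fP e) setT.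
Proof.
have E : @Defs.span P P^o (@ideal_act P P^o (fP e)) = fP e.
  apply/seteqP; split.
    apply: ideal_gen_min; first exact: s_ideal_ideal.
    by move=> _ [a [x [ha ->]]]; exact: idlMr (s_ideal_ideal _ _ _ _ _ ) ha.
  by move=> x hx; apply: (@span_sub P P^o); exists x, 1; rewrite /GRing.scale /= mulr1.
have [n fn] := s_ideal_finite e.
by rewrite /s_length (@length_quot_mod P P^o _ mP unitP n) E.
Qed.

Variables (A : comNzRingType) (mA : set A) (k : fieldType) (pi : {rmorphism P -> A}).
Hypotheses (hA : local_ring mA k) (pi_surj : forall a, exists x, pi x = a).
Hypotheses (pA : p \in [pchar A]) (mPA : forall x, mP x <-> mA (pi x)).

Let w := (t0 * ceil_pow s p 0)%N.

Let mAgs : mA = gpow (map pi gs) 1.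
Proof.
apply/seteqP; split=> a.
  by have [x <-] := pi_surj a => /mPA; rewrite mgs; exact: gpow_image.
by move=> /(image_gpow pi_surj)[x hx <-]; apply/mPA; rewrite mgs.
Qed.

Let fa_ideal e : is_ideal (pi @` fP e).
Proof. exact: image_ideal (s_ideal_ideal _ _ _ _ _). Qed.

Let fa_frob e z : (pi @` fP e) z -> (pi @` fP e.+1) (z ^+ p).
Proof. by move=> [x hx <-]; exists (x ^+ p); [exact: (s_ideal_frob s_gt0 pP Ics)|rewrite rmorphXn]. Qed.

Let fa_low e : gpow (map pi gs) (w * p ^ e) `<=` pi @` fP e.
Proof.
move=> _ /(image_gpow pi_surj)[x hx <-]; exists x => //.
exact: (s_ideal_low s_gt0 pP J Ics It0).
Qed.

Let fa_shift e0 : exists t, forall e x z, gpow (map pi gs) t x -> (pi @` fP (e + e0)%N) z ->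
  ideal_gen [set u | exists2 y, (pi @` fP e) y & u = y ^+ (p ^ e0)] (x * z).
Proof.
have [t ht] := s_ideal_shift s_gt0 pP J Ics It0 e0.
exists t => e _ _ /(image_gpow pi_surj)[x hx <-] [z hz <-]; rewrite -rmorphM.
have := ht e x z hx hz; move: (x * z).
suff : ideal_gen [set u | exists2 y, fP e y & u = y ^+ (p ^ e0)] `<=` [set u |
   ideal_gen [set u | exists2 y, (pi @` fP e) y & u = y ^+ (p ^ e0)] (pi u)] by [].
apply: ideal_gen_min; first exact: preimage_ideal (ideal_gen_ideal _).
move=> _ [y hy ->] /=; apply: ideal_gen_mem; rewrite rmorphXn.
by exists (pi y) => //; exists y.
Qed.

Lemma image_finite e : exists n, @fl A mA A^o n (pi @` fP e) setT.
Proof. by eexists; apply: (fl_finite _ (@fa_low e)); rewrite -mAgs. Qed.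

Lemma s_length_image e : s_length p I J (restr pi) s e = @flen A mA A^o (pi @` fP e) setT.
Proof.
have [n fn] := image_finite e; have E := span_ideal_act pi_surj (s_ideal_ideal s p I J e).
rewrite /s_length (@length_quot_mod P (restr pi) _ mP unitP n) E; last exact/(fl_image pi_surj mPA).
exact: flen_image.
Qed.

Lemma image_small_dim d d' : (d' < d)%N -> dim_le [set (0 : A)] d' ->
  exists C, forall e, (@flen A mA A^o (pi @` fP e) setT <= C * p ^ (e * d.-1))%N.
Proof.
move=> dd hd; have [f [fs ef]] := local_residue hA.
have pr := local_prime_sub hA; have mg := mAgs; rewrite ef in pr mg *.
exact: (small_dim (local_noetherian hA) pr pA mg fa_ideal fa_low dd hd).
Qed.

Lemma image_core d (L : set A) : (0 < d)%N -> dim_le [set (0 : A)] d -> is_ideal L ->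
  exists e0 C, 
   cvgn (scaled K p d (fun e => @flen A mA A^o (pi @` fP e) setT)) /\
   forall e, [/\ exists n, @fl A mA A^o n (idprod (pi @` fP (e + e0)) L) L &
     (@flen A mA A^o (idprod (pi @` fP (e + e0)) L) L + @flen A mA A^o (ideal_add L (pi @` fP (e + e0))) setT
                  <= @flen A mA A^o (pi @` fP (e + e0)) setT + C * p ^ (e * d.-1))%N].
Proof.
move=> d0 hd hL; have [f [fs ef]] := local_residue hA.
have pr := local_prime_sub hA; have mg := mAgs; have fin := image_finite; rewrite ef in pr mg fin *.
have [e0 [C [g [g1 g2 g3 g4]]]] := local_core (local_noetherian hA) fs pr pA mg fa_ideal fa_frob fa_low fa_shift d0 hd hL.
exists e0, C; split.
  exact: (@cvg_scaled K p d (prime_gt1 (pcharf_prime pA)) d0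
    (fun e => @flen A [set x | f x = 0] A^o (pi @` fP e) setT) g e0 C g1 g2 g3).
move=> e; split; last exact: g4.
have [n fn] := fin (e + e0)%N; have [ls els] := fingen (local_noetherian hA) hL.
have hid := ideal_gen_ideal [set z | exists x y, [/\ (pi @` fP (e + e0)) x, L y & z = x * y]].
exists (size ls * n)%N; apply: (@fl_gen A _ A^o _ _ (pi @` fP (e + e0)%N) ls) => //.
- by move=> y yin; rewrite els; exact: gpow1_mem.
- move=> y a yin ha; apply: ideal_gen_mem; exists a, y; split=> //.
  by rewrite els; exact: gpow1_mem.
rewrite {1}els; apply: subset_trans (@gpow1_adjoins A ls) _.
by apply: adjoins_mono => _ ->; exact: idl0 hid.
Qed.

End SLengthImage.

(** * The additivity formula for the fiber product *)

Section FiberMult.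
Import numFieldNormedType.Exports.
Variables (K : realType) (k : fieldType) (R S T : comNzRingType)
    (mR : set R) (mS : set S) (mT : set T)
    (hR : local_ring mR k) (hS : local_ring mS k) (hT : local_ring mT k)
    (p : nat) (pR : p \in [pchar R]) (pS : p \in [pchar S])
    (eR : {rmorphism R -> T}) (eS : {rmorphism S -> T})
    (eRs : forall t, exists r, eR r = t) (eSs : forall t, exists s, eS s = t).
Local Notation P := (fiber_prod eR eS).
Local Notation fR := (@fiber_fst R S T eR eS).
Local Notation fS := (@fiber_snd R S T eR eS).
Local Notation fT := (eR \o fR).
Local Notation mP := (fiber_max mR mS : set P).
Variables (I J : set P) (hI : is_primary_to mP I) (s : K) (s_gt0 : 0 < s) (d : nat).
Hypotheses (d_gt0 : (0 < d)%N) (dimP : krull_dim P = d).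
Hypotheses (dimR : dim_le [set (0 : R)] d) (dimS : dim_le [set (0 : S)] d)
  (dimT : dim_le [set (0 : T)] d).

Let fRs := fiber_fst_surj eR eSs.
Let fSs := fiber_snd_surj eS eRs.
Let fTs : forall t, exists x, fT x = t.
Proof. by move=> t; have [r <-] := eRs t; have [x <-] := fRs r; exists x. Qed.

Let mRT := local_preimage hR hT eRs.
Let mST := local_preimage hS hT eSs.
Let mPT x : mP x <-> mT (fT x).
Proof.
split=> [[/mRT]//|h]; split; first exact/mRT.
by apply/mST; rewrite -fiber_prod_comm.
Qed.
Let mPR x : mP x <-> mR (fR x).
Proof. by rewrite mPT; apply: iff_sym; exact: mRT. Qed.
Let mPS x : mP x <-> mS (fS x).
Proof. by rewrite mPT /= fiber_prod_comm; apply: iff_sym; exact: mST. Qed.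

Let unitP a : ~ mP a -> exists b, mP (a * b - 1).
Proof.
move=> /mPR/(local_unit hR)[b hb]; have [c ec] := fRs b.
by exists c; apply/mPR; rewrite rmorphB rmorphM rmorph1 /= ec.
Qed.

Let pP := fiber_pchar eR eS pR pS.
Let pT : p \in [pchar T]. Proof. exact: rmorph_pchar pR. Qed.
Let p_gt1 : (1 < p)%N. Proof. exact: prime_gt1 (pcharf_prime pR). Qed.
Let noethP := fiber_noetherian eRs eSs (local_noetherian hR) (local_noetherian hS).

Let hmP : is_ideal mP.
Proof.
have -> : mP = [set x | mR (fR x)] by apply/seteqP; split=> x /mPR.
by apply: preimage_ideal; case: (local_prime hR).
Qed.

Let data : exists gs cs t0, [/\ I = gpow cs 1, gpow gs t0 `<=` I & mP = gpow gs 1].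
Proof.
have [[hI' _ _] radI] := hI; have [cs ecs] := fingen noethP hI'.
have [gs egs] := fingen noethP hmP.
have [|t0 ht0] := @gpow_radical _ I gs hI'.
  by move=> g /gpow1_mem; rewrite -egs -radI.
by exists gs, cs, t0.
Qed.

Local Notation len N := (s_length p I J N s).
Local Notation lim_len N := (lim (scaled K p d (len N) @ \oo)).

(** For S, [image_core] is applied with L the kernel of [eS]. Since S/(L + I_e S) is T/I_e T, its
    estimate turns l(P/I_e) <= l(R/I_e R) + l(L/I_e L) into the missing upper bound, and the limits
    follow by squeezing. *)
Lemma fiber_lengths :
  [/\ cvgn (scaled K p d (len (modR eR eS))), cvgn (scaled K p d (len (modS eR eS))),
      cvgn (scaled K p d (len (modT eR eS))) &
      scaled K p d (len P^o) @ \oo -->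
        lim_len (modR eR eS) + lim_len (modS eR eS) - lim_len (modT eR eS)].
Proof.
have [gs [cs [t0 [Ics It0 mgs]]]] := data.
have lR := s_length_image s_gt0 pP J Ics It0 mgs unitP fRs mPR.
have lS := s_length_image s_gt0 pP J Ics It0 mgs unitP fSs mPS.
have lT := s_length_image s_gt0 pP J Ics It0 mgs unitP fTs mPT.
have lP := s_length_ring s_gt0 pP J Ics It0 mgs unitP.
have [_ [_ [cR _]]] := image_core s_gt0 pP J Ics It0 mgs hR fRs pR mPR d_gt0 dimR (@idlT R).
have [_ [_ [cT _]]] := image_core s_gt0 pP J Ics It0 mgs hT fTs pT mPT d_gt0 dimT (@idlT T).
have hk : is_ideal [set s | eS s = 0].
  exact: (@preimage_ideal _ _ eS [set 0] (@submod_zero T T^o)).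
have [e0 [C [cS hC]]] := image_core s_gt0 pP J Ics It0 mgs hS fSs pS mPS d_gt0 dimS hk.
move: cR cS cT; rewrite -!(funext lR, funext lS, funext lT) => cR cS cT; split=> //.
apply: (cvg_scaled_fiber p_gt1 d_gt0 (e0 := e0) (C := C) _ _ cR cS cT) => e.
  rewrite lR lS lT lP; have [n fn] := s_ideal_finite s_gt0 pP J Ics It0 mgs e.
  have := flen_fiber_ge unitP eRs (s_ideal_ideal s p I J e) fn eSs.
  by rewrite (flen_preimage fRs mPR) (flen_preimage fSs mPS) (flen_preimage fTs mPT).
rewrite lR lS lT lP; have [n fn] := s_ideal_finite s_gt0 pP J Ics It0 mgs (e + e0)%N.
have [[b fb]] := hC e.
have := flen_fiber_le unitP mPS eRs (s_ideal_ideal s p I J (e + e0)) fn eSs fb.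
rewrite -(flen_preimage fRs mPR) -fiber_image_ker -(flen_preimage eSs mST).
move=> h1 h2; apply: leq_trans (leq_add h1 (leqnn _)) _.
by rewrite -!addnA leq_add2l; exact: h2.
Qed.

Lemma h_mult_scaled N : h_mult p I J N s = lim_len N.
Proof. by rewrite /h_mult dimP. Qed.

Lemma h_mult_fiber : h_mult p I J P^o s =
  h_mult p I J (modR eR eS) s + h_mult p I J (modS eR eS) s - h_mult p I J (modT eR eS) s.
Proof. by rewrite !h_mult_scaled; case: fiber_lengths => _ _ _ /cvg_lim ->. Qed.

Lemma h_multS_small d' : (d' < d)%N -> dim_le [set (0 : S)] d' -> h_mult p I J (modS eR eS) s = 0.
Proof.
move=> dd hd; have [gs [cs [t0 [Ics It0 mgs]]]] := data.
have lS := s_length_image s_gt0 pP J Ics It0 mgs unitP fSs mPS.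
have [C hC] := image_small_dim s_gt0 pP J Ics It0 mgs hS fSs pS mPS dd hd.
rewrite h_mult_scaled; apply: cvg_lim => //; apply: (cvg_scaled_small p_gt1 d_gt0 (C := C)) => e.
by rewrite lS.
Qed.

Lemma h_multT_small d' : (d' < d)%N -> dim_le [set (0 : T)] d' -> h_mult p I J (modT eR eS) s = 0.
Proof.
move=> dd hd; have [gs [cs [t0 [Ics It0 mgs]]]] := data.
have lT := s_length_image s_gt0 pP J Ics It0 mgs unitP fTs mPT.
have [C hC] := image_small_dim s_gt0 pP J Ics It0 mgs hT fTs pT mPT dd hd.
rewrite h_mult_scaled; apply: cvg_lim => //; apply: (cvg_scaled_small p_gt1 d_gt0 (C := C)) => e.
by rewrite lT.
Qed.

End FiberMult.

Theorem corollary3p2 (K : realType) (k : fieldType) (R S T : comNzRingType)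
    (mR : set R) (mS : set S) (mT : set T)
    (hR : local_ring mR k) (hS : local_ring mS k) (hT : local_ring mT k)
    (p : nat) (pR : p \in [pchar R]) (pS : p \in [pchar S])
    (eR : {rmorphism R -> T}) (eS : {rmorphism S -> T})
    (eR_surj : forall t, exists r, eR r = t)
    (eS_surj : forall t, exists s, eS s = t)
    (dimR : (0 < krull_dim R)%N)
    (I J : set (fiber_prod eR eS))
    (hI : is_primary_to (fiber_max mR mS) I)
    (hJ : is_primary_to (fiber_max mR mS) J)
    (s : K) (s_gt0 : 0 < s) :
  [/\ krull_dim R = krull_dim S -> krull_dim S = krull_dim T ->
      e_mult p I J (fiber_prod eR eS)^o s =
      e_mult p I J (modR eR eS) s + e_mult p I J (modS eR eS) s
      - e_mult p I J (modT eR eS) s,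
      krull_dim R = krull_dim S -> (krull_dim T < krull_dim S)%N ->
      e_mult p I J (fiber_prod eR eS)^o s =
      e_mult p I J (modR eR eS) s + e_mult p I J (modS eR eS) s
    & (krull_dim S < krull_dim R)%N -> (krull_dim T < krull_dim S)%N ->
      e_mult p I J (fiber_prod eR eS)^o s = e_mult p I J (modR eR eS) s].
Proof.
have [cR maxR] := krull_dim_pos dimR.
(* Chains of T pull back to R, so they are bounded and dim T is a genuine maximum even when its
   value is 0. *)
have maxT : forall n, prime_chain T n -> (n <= krull_dim T)%N.
  apply: (krull_dim_bounded (local_prime hT) (b := krull_dim R)) => n.
  by move=> /(prime_chain_preimage eR_surj)/maxR.
have hdT : (krull_dim T <= krull_dim R)%N.
  have [|T0] := posnP (krull_dim T); first by move=> ->.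
  by have [/(prime_chain_preimage eR_surj)/maxR] := krull_dim_pos T0.
have dR : dim_le [set (0 : R)] (krull_dim R) by exact: dim_le_krull.
have dT' : dim_le [set (0 : T)] (krull_dim T) by exact: dim_le_krull.
have dT : dim_le [set (0 : T)] (krull_dim R).
  by move=> n c h1 h2; apply: leq_trans (dT' n c h1 h2) hdT.
(* In each case dim S is positive, being equal to dim R or larger than dim T; so it is not a default
   value and bounds the chains of S. *)
have fiber : (0 < krull_dim S)%N -> (krull_dim S <= krull_dim R)%N ->
  h_mult p I J (fiber_prod eR eS)^o s = h_mult p I J (modR eR eS) s
    + h_mult p I J (modS eR eS) s - h_mult p I J (modT eR eS) s /\
  ((krull_dim S < krull_dim R)%N -> h_mult p I J (modS eR eS) s = 0) /\
  ((krull_dim T < krull_dim R)%N -> h_mult p I J (modT eR eS) s = 0).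
  move=> S0 SR; have [_ maxS] := krull_dim_pos S0.
  have dS' : dim_le [set (0 : S)] (krull_dim S) by exact: dim_le_krull.
  have dS : dim_le [set (0 : S)] (krull_dim R).
    by move=> n c h1 h2; apply: leq_trans (dS' n c h1 h2) SR.
  have dP : krull_dim (fiber_prod eR eS) = krull_dim R.
    by apply: fiber_krull_dim => // n /maxS h; exact: leq_trans h SR.
  split; [|split=> lt].
  - exact: (h_mult_fiber hR hS hT pR pS eR_surj eS_surj J hI s_gt0 dimR dP dR dS dT).
  - exact: (h_multS_small hR hS hT pR pS eR_surj eS_surj J hI s_gt0 dimR dP lt dS').
  - exact: (h_multT_small hR hS hT pR pS eR_surj eS_surj J hI s_gt0 dimR dP lt dT').
rewrite /e_mult -!mulrDl -mulrBl; split.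
- by move=> RS ST; have [||-> _] := fiber; rewrite -?RS.
- by move=> RS TS; have [||-> [_ ->]] := fiber; rewrite -?RS ?subr0 // RS.
- move=> SR TS; have [||-> [-> // ->]] := fiber; rewrite ?addr0 ?subr0 //.
  + exact: leq_ltn_trans TS.
  + exact: ltnW.
  + exact: ltn_trans SR.
Qed.
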